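(* Let $0\le\alpha<d$, $1<p<\infty$, $\frac1q=\frac1p-\frac\alpha d>0$, let $q\le s\le\infty$, and let $w$ be a weight on $\mathbb R^d$. Then $M_\alpha:L^{p,p}_w\to L^{q,s}_w$ is bounded if and only if $w\in A_{(p,p),(q,s)}$. Furthermore, $$\|M_\alpha\|_{L^{p,p}_w\to L^{q,s}_w}\lesssim[w]_{A_{(p,p),(q,s)}}^{1+p'/q},$$ with implicit constant independent of $w$.
   Context: A weight is a measurable function on $\mathbb R^d$ with values in $(0,\infty)$ almost everywhere; cubes have sides parallel to the axes. For a measurable $f$ on $\mathbb R^d$ with decreasing rearrangement $f^*$, $\|f\|_{L^{a,b}}:=\big(\frac ba\int_0^\infty[t^{1/a}f^*(t)]^b\frac{dt}t\big)^{1/b}$ for $0<a,b<\infty$, and $\|f\|_{L^{a,\infty}}:=\sup_{t>0}t^{1/a}f^*(t)$. $L^{a,b}_w:=\{f: fw\in L^{a,b}(\mathbb R^d)\}$ with $\|f\|_{L^{a,b}_w}:=\|fw\|_{L^{a,b}}$. For a cube $Q$, $\|h\|_{L^{a,b}(Q)}:=|Q|^{-1/a}\|h\mathbf 1_Q\|_{L^{a,b}}$. Primes denote conjugate exponents. $M_\alpha f(x)=\sup_{Q\ni x}|Q|^{\alpha/d}\frac1{|Q|}\int_Q|f|$, the supremum over cubes containing $x$. A weight $w$ belongs to $A_{(p,p),(q,s)}$ if $$[w]_{A_{(p,p),(q,s)}}:=\sup_Q\|w\|_{L^{q,s}(Q)}\,\|w^{-1}\|_{L^{p',p'}(Q)}<\infty,$$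 where $\|w^{-1}\|_{L^{p',p'}(Q)}=\big(\frac1{|Q|}\int_Qw^{-p'}\big)^{1/p'}$. *)

(* Defs.v *)
From HB Require Import structures.
From mathcomp Require Import all_boot all_order all_algebra.
From mathcomp Require Import all_classical all_reals all_analysis.
From mathcomp Require Import measurable_realfun.

Set Implicit Arguments.
Unset Strict Implicit.
Unset Printing Implicit Defensive.

Import Order.TTheory GRing.Theory Num.Theory.
Import numFieldNormedType.Exports.

Local Open Scope classical_set_scope.
Local Open Scope ring_scope.
Local Open Scope ereal_scope.

Section cons_measure.
Context {R : realType} (n : nat).
Variable nu :
  {sigma_finite_measure set (n.-tuple (measurableTypeR R)) -> \bar R}.

Definition tcons (u : measurableTypeR R * n.-tuple (measurableTypeR R)) :
  n.+1.-tuple (measurableTypeR R) := [the n.+1.-tuple _ of u.1 :: u.2].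

Lemma measurable_tcons : measurable_fun [set: _] tcons.
Proof. exact: measurable_cons. Qed.

Lemma behead_tcons u : [tuple of behead (tcons u)] = u.2.
Proof. exact: val_inj. Qed.

Definition cons_measure : set (n.+1.-tuple (measurableTypeR R)) -> \bar R :=
  pushforward (@lebesgue_measure R \x nu) tcons.

Let cons_measure0 : cons_measure set0 = 0.
Proof. by rewrite /cons_measure /pushforward preimage_set0 measure0. Qed.

Let cons_measure_ge0 A : 0 <= cons_measure A.
Proof. by rewrite /cons_measure /pushforward measure_ge0. Qed.

Let cons_measure_sigma_additive : semi_sigma_additive cons_measure.
Proof.
move=> F mF tF mUF; rewrite /cons_measure /pushforward preimage_bigcup.
apply: measure_semi_sigma_additive.
- by move=> k; rewrite -[X in measurable X]setTI; exact: measurable_tcons.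
- apply/trivIsetP => /= i j _ _ ij; rewrite -preimage_setI.
  by move/trivIsetP : tF => /(_ _ _ _ _ ij) ->//; rewrite preimage_set0.
- rewrite -preimage_bigcup -[X in measurable X]setTI.
  exact: measurable_tcons.
Qed.

HB.instance Definition _ := isMeasure.Build _ _ _ cons_measure
  cons_measure0 cons_measure_ge0 cons_measure_sigma_additive.

Lemma cons_measureE (A : set (measurableTypeR R))
    (B : set (n.-tuple (measurableTypeR R))) :
  measurable A -> measurable B ->
  cons_measure [set t | A (thead t) /\ B [tuple of behead t]] =
  lebesgue_measure A * nu B.
Proof.
move=> mA mB; rewrite /cons_measure /pushforward.
rewrite (_ : _ @^-1` _ = A `*` B) ?product_measure1E//.
by apply/seteqP; split=> u /=; rewrite behead_tcons.
Qed.

Let cons_measure_sigma_finite : sigma_finite setT cons_measure.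
Proof.
have /sigma_finiteP[F [TF ndF Foo]] := sigma_finiteT (@lebesgue_measure R).
have /sigma_finiteP[G [TG ndG Goo]] := sigma_finiteT nu.
exists (fun k => [set t : n.+1.-tuple (measurableTypeR R) |
    F k (thead t) /\ G k [tuple of behead t]]).
  apply/seteqP; split=> // t _.
  have [i _ Fi] : (\bigcup_i F i) (thead t) by rewrite -TF.
  have [j _ Gj] : (\bigcup_i G i) [tuple of behead t] by rewrite -TG.
  exists (maxn i j) => //; split.
  - by move: Fi; exact/subsetPset/ndF/leq_maxl.
  - by move: Gj; exact/subsetPset/ndG/leq_maxr.
move=> k; have [mF ?] := Foo k; have [mG ?] := Goo k; split.
  apply: measurableI.
    rewrite -[X in measurable X]setTI.
    exact: (@measurable_tnth _ (measurableTypeR R) n.+1 ord0 measurableT _ mF).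
  rewrite -[X in measurable X]setTI.
  exact: (@measurable_behead _ (measurableTypeR R) n measurableT _ mG).
by rewrite cons_measureE// lte_mul_pinfty// ge0_fin_numE.
Qed.

HB.instance Definition _ := Measure_isSigmaFinite.Build _ _ _ cons_measure
  cons_measure_sigma_finite.

End cons_measure.

(* n-fold product of the one-dimensional Lebesgue measure, on Borel sets *)
Fixpoint borel_lebesgue {R : realType} (n : nat) :
    {sigma_finite_measure set (n.-tuple (measurableTypeR R)) -> \bar R} :=
  match n with
  | 0 => [the {sigma_finite_measure set _ -> \bar R} of
           @dirac _ (0.-tuple (measurableTypeR R)) [tuple] R]
  | m.+1 => [the {sigma_finite_measure set _ -> \bar R} of
           cons_measure (borel_lebesgue m)]
  end.

(* R^d, equipped with the Lebesgue (i.e. completed Borel) sigma-algebra *)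
Definition euclid (R : realType) (d : nat) : Type :=
  caratheodory_type (mu_ext (@borel_lebesgue R d)).

Section Lebesgue.
Context {R : realType} (d : nat).

HB.instance Definition _ := Measurable.copy (euclid R d)
  (caratheodory_type (mu_ext (@borel_lebesgue R d))).

Definition lebesgue : set (euclid R d) -> \bar R :=
  @completed_measure_extension _ _ R (borel_lebesgue d).

HB.instance Definition _ := Measure.on lebesgue.

Let lebesgue_sigma_finite : sigma_finite setT lebesgue.
Proof.
exact/completed_measure_extension_sigma_finite/sigma_finiteT.
Qed.

HB.instance Definition _ := Measure_isSigmaFinite.Build _ _ _ lebesgue
  lebesgue_sigma_finite.

End Lebesgue.

Section Cubes.
Context {R : realType} {d : nat}.
Implicit Types (c x : euclid R d) (l : R) (Q : set (euclid R d)).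

Definition coord x (i : 'I_d) : R := tnth (x : d.-tuple R) i.

(* closed cubes; the maximal function and the weight constant below are the
   same for open or half-open ones *)
Definition cube c l : set (euclid R d) :=
  [set x | forall i, (coord c i <= coord x i <= coord c i + l)%R].

Definition cubes : set (set (euclid R d)) :=
  [set Q | exists c l, (0 < l)%R /\ Q = cube c l].

End Cubes.

Section CubeVolume.
Context {R : realType}.

Definition box n (a b : 'I_n -> R) : set (n.-tuple (measurableTypeR R)) :=
  [set t | forall i, (a i <= tnth t i <= b i)%R].

Lemma box_cons n (a b : 'I_n.+1 -> R) : box a b =
  [set t | [set` `[a ord0, b ord0]] (thead t) /\
    box (a \o lift ord0) (b \o lift ord0) [tuple of behead t]].
Proof.
have tS (t : n.+1.-tuple (measurableTypeR R)) j :
    tnth t (lift ord0 j) = tnth [tuple of behead t] j.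
  by rewrite {1}(tuple_eta t) tnthS.
apply/seteqP; split=> t /=.
  move=> ht; split; first by rewrite in_itv/=; exact: ht.
  by move=> i; rewrite -tS; exact: ht.
rewrite in_itv/= => -[h0 h] i.
by case: (unliftP ord0 i) => [j ->|->//]; rewrite tS; exact: h.
Qed.

Lemma measurable_box n (a b : 'I_n -> R) : measurable (box a b).
Proof.
rewrite (_ : box a b = \bigcap_(i in [set: 'I_n])
    [set t | [set` `[a i, b i]] (tnth t i)]); last first.
  apply/seteqP; split=> t /= h i; first by move=> _ /=; rewrite in_itv/=; exact: h.
  by have := h i Logic.I; rewrite /= in_itv.
apply: fin_bigcap_measurable => // i _.
rewrite -[X in measurable X]setTI.
apply: (@measurable_tnth _ (measurableTypeR R) n i) => //.
Qed.

Lemma borel_lebesgue_box n (a b : 'I_n -> R) : (forall i, a i <= b i)%R ->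
  borel_lebesgue n (box a b) = (\prod_(i < n) (b i - a i))%:E.
Proof.
elim: n a b => [|n ih] a b ab.
  rewrite big_ord0 /= diracE mem_set//.
  by case.
rewrite box_cons [LHS](@cons_measureE R n (borel_lebesgue n)
  [set` `[a ord0, b ord0]]); last 2 first.
- exact: measurable_itv.
- exact: measurable_box.
rewrite ih; last by move=> i; exact: ab.
rewrite big_ord_recl /= EFinM; congr (_ * _).
rewrite lebesgue_measure_itv/= lte_fin.
have := ab ord0; rewrite le_eqVlt => /predU1P[->|->]; last by rewrite EFinB.
by rewrite ltxx subrr.
Qed.

Lemma lebesgue_cube d (c : euclid R d) l : (0 <= l)%R ->
  lebesgue (cube c l) = (l ^+ d)%:E.
Proof.
move=> l0; rewrite /lebesgue /completed_measure_extension.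
rewrite -[cube c l]/(@box d (coord c) (fun i => coord c i + l)%R).
rewrite measurable_mu_extE; last exact: measurable_box.
rewrite [LHS](@borel_lebesgue_box d); last by move=> i; rewrite lerDl.
rewrite (eq_bigr (fun=> l)) ?prodr_const ?card_ord// => i _.
by rewrite addrC addKr.
Qed.

Lemma measurable_cube d (c : euclid R d) l : measurable (cube c l).
Proof.
apply: caratheodory_measurable_mu_ext.
exact: (@measurable_box d (coord c) (fun i => coord c i + l)%R).
Qed.

End CubeVolume.

Section Lorentz.
Context {R : realType} {d : nat}.
Notation E := (euclid R d).
Notation mu := (@lebesgue R d).
Implicit Types (f w : E -> \bar R) (a : R) (b : \bar R).

Definition rearrangement f (t : R) : \bar R :=
  ereal_inf [set y%:E | y in
    [set y : R | (0 <= y)%R /\ mu [set x | y%:E < `|f x|] <= t%:E]].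

(* The exponent b = -oo is outside the intended range. *)
Definition lorentz a b f : \bar R :=
  match b with
  | b'%:E =>
      ((b' / a)%:E *
       \int[@lebesgue_measure R]_(t in `]0%R, +oo[)
         (((t `^ a^-1)%:E * rearrangement f t) `^ b' * (t^-1)%:E)) `^ b'^-1
  | +oo => ereal_sup [set (t `^ a^-1)%:E * rearrangement f t | t in `]0%R, +oo[]
  | -oo => 0
  end.

Definition lorentz_cube a b (Q : set E) f : \bar R :=
  mu Q `^ (- a^-1) * lorentz a b (fun x => f x * (\1_Q x)%:E).

(* Functions are extended-real valued, so a weight may take the values 0 and
   +oo, or negative ones, on a null set; there inve 0 = +oo, inve +oo = 0. *)
Definition weight w : Prop :=
  measurable_fun [set: E] w /\ {ae mu, forall x, 0 < w x < +oo}.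

Definition lorentz_weighted a b w f : \bar R :=
  lorentz a b (fun x => f x * w x).

Definition lorentz_space a b w : set (E -> \bar R) :=
  [set f | measurable_fun [set: E] f /\ lorentz_weighted a b w f < +oo].

Definition fractional_maximal (alpha : R) f (x : E) : \bar R :=
  ereal_sup [set mu Q `^ (alpha / d%:R) * ((mu Q)^-1 * \int[mu]_(y in Q) `|f y|)
    | Q in [set Q | cubes Q /\ Q x]].

(* [w]_{A_{(p,p),(q,s)}}, where p' is the conjugate exponent of p *)
Definition A_const (p' q : R) (s : \bar R) w : \bar R :=
  ereal_sup [set lorentz_cube q s Q w *
                 lorentz_cube p' p'%:E Q (fun x => (w x)^-1)
    | Q in cubes].

Definition A_class (p' q : R) (s : \bar R) w : Prop :=
  weight w /\ A_const p' q s w < +oo.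

Section Operators.
Variables (a1 : R) (b1 : \bar R) (a2 : R) (b2 : \bar R).
Variables (w : E -> \bar R) (T : (E -> \bar R) -> (E -> \bar R)).

Definition op_bound (C : R) : Prop :=
  (0 <= C)%R /\ forall f, lorentz_space a1 b1 w f ->
    lorentz_weighted a2 b2 w (T f) <= C%:E * lorentz_weighted a1 b1 w f.

Definition bounded_op : Prop :=
  (forall f, lorentz_space a1 b1 w f -> lorentz_space a2 b2 w (T f)) /\
  exists C, op_bound C.

Definition op_norm : \bar R := ereal_inf [set C%:E | C in op_bound].

End Operators.

End Lorentz.

(* Main.v *)
(* Write W(Q) for the L^{q,s} norm of w 1_Q and sigma = w^(-p').  Necessity is
   the usual test on f = sigma 1_G, where G is the part of Q on which w stays
   away from 0, so that everything is finite before G increases to Q.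

   For sufficiency, the one-third trick bounds M_alpha f on a bounded range of
   scales by the sum of 2^d dyadic maximal functions, and Fatou's property
   removes the truncation.  In one grid, replace the dyadic maximal function
   by 2 times the value c_P of the last principal cell P around x, a cell being
   principal when its average doubles.  Since s >= q, Minkowski's inequality
   gives L^{q,s} an upper q-estimate, which reduces the norm to the sum of
   (c_P W(F_P))^q over the disjoint parts F_P of the principal cells left over
   by their successors; these have at least half of the volume of P.  By the
   weak Hoelder inequality |F|^(1/q + 1/p') <~ W(F) sigma(F)^(1/p'), the A
   condition gives sigma(P) <~ K^(p') sigma(F_P).  The sum is then controlled by
   the L^p(sigma) norm of the dyadic maximal function of f/sigma with respect
   to sigma, to which Doob's inequality applies. *)

Require Import Defs.
From mathcomp Require Import all_boot all_order all_algebra.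
From mathcomp Require Import all_classical all_reals all_analysis.
From mathcomp Require Import measurable_realfun.
From mathcomp Require Import ring lra.

Set Implicit Arguments.
Unset Strict Implicit.
Unset Printing Implicit Defensive.

Import Order.TTheory GRing.Theory Num.Theory.
Import numFieldNormedType.Exports.

Local Open Scope classical_set_scope.
Local Open Scope ring_scope.

(** For [s > q] the functional of L^{q,s} need not satisfy the triangle inequality, so norms are
    never added directly. Each one is rewritten as an integral over levels of a power of the
    distribution function. Its q-th power is then an L^{s/q} norm that is linear in the distribution
    function, and Minkowski applies because [s/q >= 1]. The case [s = +oo] runs in parallel with
    suprema.

    The exponent [1 + p'/q] is [(q + p')/q]. For one principal cell P the A condition is used once
    in the q-th power of c_P W(P), which costs [K^q], and once in passing from sigma(P) to
    sigma(F_P), which costs [K^p']. Hoelder absorbs [q - p] powers into the norm of [f], leaving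
    exactly the power [p] for Doob.

    Only generations up to a finite [n] are used and the coarsest cell counts as principal, so the
    selection of principal cells is a finite recursion; all constants are uniform in [n]. A weight
    is first replaced by an everywhere positive real function equal to it almost everywhere, which
    changes no norm. *)

Lemma mem_set_bool (T : Type) (P : T -> bool) (x : T) :
  (x \in [set y | P y]) = P x.
Proof. by apply/idP/idP; rewrite inE. Qed.

(** * Power integrals and the layer-cake formula *)

Section PowerIntegral.
Context {R : realType}.
Notation leb := (@lebesgue_measure R).
Local Open Scope ereal_scope.

Lemma powR_continuous_gt0 (a x : R) : (0 < x)%R -> {for x, continuous (@powR R ^~ a)}.
Proof.
move=> x0; apply/differentiable_continuous/derivable1_diffP.
by apply: ex_derive; exact: is_derive1_powR.
Qed.

Lemma measurable_powR_deriv r (D : set R) :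
  measurable_fun D (fun x : R => (r * x `^ (r - 1))%:E).
Proof.
apply/measurable_EFinP; apply: measurable_funM => //.
by apply: measurable_funTS; exact: measurable_powR.
Qed.

Lemma integral_powR_itv (r a b : R) : (0 < a)%R -> (a < b)%R ->
  \int[leb]_(x in `[a, b]) (r * x `^ (r - 1))%:E = (b `^ r - a `^ r)%:E.
Proof.
move=> a0 ab; rewrite EFinB.
have b0 : (0 < b)%R := lt_trans a0 ab.
apply: (@continuous_FTC2 _ _ (@powR R ^~ r)) => //.
- apply: continuous_in_subspaceT => x; rewrite inE/= in_itv/= => /andP[ax _].
  apply: (@cvgM _ _ (nbhs x)); first exact: cvg_cst.
  by apply: powR_continuous_gt0; exact: lt_le_trans ax.
- split.
  + move=> x; rewrite in_itv/= => /andP[ax _]; apply: ex_derive.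
    by apply: is_derive1_powR; exact: lt_trans ax.
  + by apply: cvg_at_right_filter; exact: powR_continuous_gt0.
  + by apply: cvg_at_left_filter; exact: powR_continuous_gt0.
- move=> x; rewrite in_itv/= => /andP[ax _]; apply: powR_derive1.
  by rewrite in_itv/= (lt_trans a0).
Qed.

(** For [r < 1] the integrand is unbounded at 0, so the fundamental theorem of calculus is applied
    on closed intervals away from 0, followed by monotone convergence. *)
Lemma integral_powR_bounded (r b : R) : (0 < r)%R -> (0 < b)%R ->
  \int[leb]_(x in `]0%R, b]) (r * x `^ (r - 1))%:E = (b `^ r)%:E.
Proof.
move=> r0 b0.
(* [n.+2] keeps the left endpoint strictly below [b] already for [n = 0], as the formula on closed
   intervals requires. *)
pose F (n : nat) : set R := `[(b / n.+2%:R)%R, b]%classic.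
have n0 (n : nat) : (0 < b / n.+2%:R)%R by rewrite divr_gt0.
have bF : \bigcup_n F n = `]0%R, b]%classic.
  apply/seteqP; split=> [x [n _]|x]; rewrite /F/= !in_itv/=.
    by move=> /andP[? ->]; rewrite andbT (lt_le_trans (n0 n)).
  move=> /andP[x0 xb]; exists (Num.truncn (b / x)%R) => //; rewrite /= in_itv/= xb andbT.
  rewrite ler_pdivrMr// -ler_pdivrMl// mulrC.
  by apply/ltW/(lt_trans (truncnS_gt _)); rewrite ltr_nat.
rewrite -bF.
apply/esym/(@cvg_unique _ (@ereal_hausdorff R)
  ((\int[leb]_(x in F n) (r * x `^ (r - 1))%:E) @[n --> \oo])); last first.
  apply: ge0_nondecreasing_set_cvg_integral.
  - move=> m n mn; apply/subsetPset => x; rewrite /F/= !in_itv/= => /andP[h ->].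
    rewrite andbT (le_trans _ h)// ler_pM2l// lef_pV2 ?posrE//.
    by rewrite ler_nat !ltnS.
  - by move=> n; exact: measurable_itv.
  - by move=> n; exact: measurable_powR_deriv.
  - by move=> n x; rewrite /F/= in_itv/= => /andP[/(lt_le_trans (n0 n)) x0 _]; rewrite lee_fin mulr_ge0 ?powR_ge0 ?ltW.
rewrite (_ : (fun n => _) = (fun n => (b `^ r - (b / n.+2%:R) `^ r)%R%:E)); last first.
  apply/funext => n; rewrite integral_powR_itv//.
  by rewrite ltr_pdivrMr// ltr_pMr// ltr1n.
apply: cvg_EFin; first by apply: nearW.
rewrite -[X in _ --> X]subr0; apply: cvgB; first exact: cvg_cst.
have /cvg_at_rightP := powR_cvg0 r0; apply; split; first exact: n0.
rewrite -[X in _ --> X](mulr0 b); apply: cvgM; first exact: cvg_cst.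
by have := @cvg_harmonic R; rewrite -(@cvg_shiftS R^o (@harmonic R)).
Qed.

Lemma integral_powR_lt (r : R) (y : \bar R) : (0 < r)%R -> 0 <= y ->
  \int[leb]_(x in `]0%R, +oo[ `&` [set x : R | x%:E < y])
    (r * x `^ (r - 1))%:E = y `^ r.
Proof.
move=> r0; case: y => [y| |]//.
- rewrite lee_fin le_eqVlt => /predU1P[<-|y0].
    rewrite (_ : _ `&` _ = set0) ?integral_set0 ?poweR0r ?gt_eqF//.
    apply/seteqP; split=> x //=; rewrite in_itv/= andbT => -[x0].
    by rewrite lte_fin => /(lt_trans x0); rewrite ltxx.
  rewrite poweR_EFin -integral_powR_bounded// -integral_itv_bndo_bndc; last first.
    exact: measurable_powR_deriv.
  congr (integral _ _ _); apply/seteqP; split=> x /=; rewrite !in_itv/= lte_fin ?andbT.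
    by case=> -> ->.
  by move=> /andP[].
(* The integral over the half-line is at least every [A > 0], since it contains the integral up to
   the r-th root of [A], which equals [A]. *)
- move=> _; rewrite poweRyr ?gt_eqF// (_ : _ `&` _ = `]0%R, +oo[%classic); last first.
    by apply/seteqP; split=> x /=; rewrite ?ltry// => -[].
  apply/eqyP => A A0.
  have A1 : (0 < A `^ r^-1)%R by rewrite powR_gt0.
  rewrite (_ : A = (A `^ r^-1) `^ r)%R; last first.
    by rewrite -powRrM mulVf ?gt_eqF// powRr1// ltW.
  rewrite -integral_powR_bounded//; apply: ge0_subset_integral => //=.
  + exact: measurable_powR_deriv.
  + by move=> x _; rewrite lee_fin mulr_ge0 ?powR_ge0// ltW.
  + by apply: subset_itvl.
Qed.
End PowerIntegral.

Section LayerCake.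
Context {R : realType} {d : measure_display} {X : measurableType d}.
Variable nu : {sigma_finite_measure set X -> \bar R}.
Notation leb := (@lebesgue_measure R).
Local Open Scope ereal_scope.

(** Tonelli, after writing [g ^ r] as the integral of [r l ^ (r - 1)] over [0 < l < g]. The density
    [u] lets one formula serve for Lebesgue norms ([u = 1]), for the rearrangement ([u] a power of
    [t]) and for Doob's inequality ([u] equal to [sigma] or [f]). *)
Lemma layer_cake (D : set X) (u g : X -> \bar R) (r : R) :
  (0 < r)%R -> measurable D -> measurable_fun D u -> measurable_fun D g ->
  (forall x, D x -> 0 <= u x) -> (forall x, D x -> 0 <= g x) ->
  \int[nu]_(x in D) (u x * g x `^ r) =
  \int[leb]_(l in `]0%R, +oo[) ((r * l `^ (r - 1))%:E *
     \int[nu]_(x in D `&` [set x | l%:E < g x]) u x).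
Proof.
move=> r0 mD mu_ mg u0 g0.
pose u' := u \_ D; pose g' := g \_ D.
pose I := (`]0%R, +oo[%classic : set (measurableTypeR R)).
pose k (l : measurableTypeR R) := (r * l `^ (r - 1))%:E.
pose k' := k \_ I.
have k0 l : 0 <= k l by rewrite lee_fin mulr_ge0 ?powR_ge0 ?ltW.
have mI : measurable I by exact: measurable_itv.
have mk (D' : set (measurableTypeR R)) : measurable_fun D' k.
  exact: measurable_powR_deriv.
have mk' : measurable_fun setT k'.
  exact: (measurable_restrictT k mI).1 (mk _).
have mu' : measurable_fun setT u' by exact: (measurable_restrictT _ mD).1.
have mg' : measurable_fun setT g' by exact: (measurable_restrictT _ mD).1.
have u'0 x : 0 <= u' x by exact: erestrict_ge0.
have g'0 x : 0 <= g' x by exact: erestrict_ge0.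
have k'0 x : 0 <= k' x by exact: erestrict_ge0.
pose A := [set z : X * measurableTypeR R | z.2%:E < g' z.1].
have mA : measurable A.
  rewrite -[A]setTI; apply: measurable_lte => //.
    by apply/measurable_EFinP; exact: measurable_snd.
  by apply: measurableT_comp => //; exact: measurable_fst.
pose F (z : X * measurableTypeR R) := u' z.1 * (k' z.2 * (\1_A z)%:E).
have mF : measurable_fun setT F.
  apply: emeasurable_funM; first by apply: measurableT_comp => //; exact: measurable_fst.
  apply: emeasurable_funM; first by apply: measurableT_comp => //; exact: measurable_snd.
  exact/measurable_EFinP.
have F0 z : 0 <= F z by rewrite !mule_ge0// lee_fin.
have := @fubini_tonelli _ _ _ _ R nu leb F mF F0.
rewrite (_ : (\int[nu]_x _) = \int[nu]_(x in D) (u x * g x `^ r)); last first.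
  rewrite [RHS]integral_mkcond; apply: eq_integral => x _.
  rewrite /F/= ge0_integralZl//; last 2 first.
  - apply: emeasurable_funM => //; apply/measurable_EFinP.
    by apply: measurableT_comp => //; exact: measurable_pair1.
  - by move=> l _; rewrite mule_ge0 ?lee_fin.
  rewrite (_ : \int[_]_y _ = g' x `^ r).
    by rewrite /u' /g' !patchE; case: ifPn => // _; rewrite mul0e.
  rewrite -integral_powR_lt// [RHS]integral_mkcondr epatch_indic.
  rewrite [RHS]integral_mkcond; apply: eq_integral => l _.
  by rewrite /k' !patchE; case: ifPn => // _; rewrite mul0e.
move=> ->.
rewrite [RHS]integral_mkcond; apply: eq_integral => l _.
rewrite [RHS]patchE; case: ifPn => lI; last first.
  apply: integral0_eq => x _.
  by rewrite /F/= /k' patchE (negbTE lI) mul0e mule0.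
pose B : set X := [set x | (l : R)%:E < g' x].
have mB : measurable B by rewrite -[B]setTI; apply: measurable_lte.
rewrite /F/= -/(k l) [X in _ = _ * X](_ : _ =
    \int[nu]_x (u' x * (\1_B x)%:E)); last first.
  rewrite integral_mkcond; apply: eq_integral => x _.
  rewrite patchE in_setI indicE /B !mem_set_bool /u' /g' !patchE.
  by case: (x \in D) => /=; rewrite ?mul0e//; case: ifPn; rewrite ?mule1 ?mule0.
rewrite -ge0_integralZl//; last 2 first.
- by apply: emeasurable_funM => //; exact/measurable_EFinP.
- by move=> x _; rewrite mule_ge0 ?lee_fin.
apply: eq_integral => x _; rewrite /k' patchE lI muleCA; congr (_ * (_ * _%:E)).
Qed.

End LayerCake.

Section PoweRFacts.
Context {R : realType}.
Local Open Scope ereal_scope.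
Implicit Types x y : \bar R.

Lemma le_poweR2 (r : R) x y : (0 <= r)%R -> 0 <= x -> x <= y -> x `^ r <= y `^ r.
Proof.
move=> r0 x0 xy; apply: gt0_ler_poweR => //; rewrite in_itv/= ?x0 ?leey//.
by rewrite (le_trans x0).
Qed.

Lemma poweRK (r : R) x : r != 0%R -> 0 <= x -> (x `^ r) `^ r^-1 = x.
Proof. by move=> r0 x0; rewrite -poweRrM mulfV// poweRe1. Qed.

Lemma poweRVK (r : R) x : r != 0%R -> 0 <= x -> (x `^ r^-1) `^ r = x.
Proof. by move=> r0 x0; rewrite -poweRrM mulVf// poweRe1. Qed.

Lemma poweR_le_root (r : R) x y : (0 < r)%R -> 0 <= x ->
  x `^ r <= y -> x <= y `^ r^-1.
Proof.
move=> r0 x0 xy; rewrite -[leLHS](@poweRK r)// ?gt_eqF//.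
by apply: le_poweR2; rewrite ?poweR_ge0// invr_ge0 ltW.
Qed.

Lemma root_le_poweR (r : R) x y : (0 < r)%R -> 0 <= x -> 0 <= y ->
  x <= y `^ r^-1 -> x `^ r <= y.
Proof.
move=> r0 x0 y0 xy; rewrite -[leRHS](@poweRVK r)// ?gt_eqF//.
by apply: le_poweR2; rewrite // ltW.
Qed.

Lemma le_root_poweR (r : R) x y : (0 < r)%R -> 0 <= x -> 0 <= y ->
  x <= y `^ r -> x `^ r^-1 <= y.
Proof.
move=> r0 x0 y0 xy; rewrite -[leRHS](@poweRK r)// ?gt_eqF//.
by apply: le_poweR2; rewrite // invr_ge0 ltW.
Qed.

(** For quantities known only through the finite levels below them, as [rearrangement] is through
    [rearrangement_gt]. *)
Lemma eq_ge0_lt x y : 0 <= x -> 0 <= y ->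
  (forall l : R, (0 <= l)%R -> (l%:E < x) = (l%:E < y)) -> x = y.
Proof.
have H u v : 0 <= u -> 0 <= v ->
    (forall l : R, (0 <= l)%R -> (l%:E < u) = (l%:E < v)) -> v <= u.
  move=> u0 v0 h; rewrite leNgt; apply/negP; case: u u0 h => [u| |] // u0 h uv.
    by move: uv; rewrite -h ?ltxx// -lee_fin.
  by move: uv; rewrite ltNge leey.
move=> x0 y0 h; apply/eqP; rewrite eq_le (H x y)// ?(H y x)//.
by move=> l l0; rewrite h.
Qed.

End PoweRFacts.

(** * Lorentz functionals of a distribution function *)

Section LorentzFun.
Context {R : realType}.
Notation leb := (@lebesgue_measure R).
Local Open Scope ereal_scope.

(** The Lorentz functional of a function whose distribution function is [D]. The normalisation
    [b / a] in [lorentz] is the one for which the constant here is just [s]. Distribution functions,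
    unlike rearrangements, are subadditive over pieces. *)
Definition lorentz_of_dist (q : R) (s : \bar R) (D : R -> \bar R) : \bar R :=
  match s with
  | s'%:E => (\int[leb]_(l in `]0%R, +oo[)
               ((s' * l `^ (s' - 1))%:E * D l `^ (s' / q))) `^ s'^-1
  | +oo => ereal_sup [set l%:E * D l `^ q^-1 | l in `]0%R, +oo[]
  | -oo => 0
  end.

Variables (q : R) (s : \bar R).
Hypotheses (q0 : (0 < q)%R) (qs : q%:E <= s).

Let I := (`]0%R, +oo[%classic : set (measurableTypeR R)).

Let mI : measurable I. Proof. exact: measurable_itv. Qed.

Let mpow r (D : R -> \bar R) r' : measurable_fun I (D : measurableTypeR R -> _) ->
  measurable_fun I (fun l : measurableTypeR R => (r * l `^ (r - 1))%:E * D l `^ r').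
Proof.
move=> mD; apply: emeasurable_funM; first exact: measurable_powR_deriv.
exact: (measurableT_comp (measurable_poweR r') mD).
Qed.

Lemma lorentz_of_dist_ge0 D : 0 <= lorentz_of_dist q s D.
Proof.
rewrite /lorentz_of_dist; case: s => [s'| |]//; first exact: poweR_ge0.
apply: le_ereal_sup_tmp; exists (1%:E * D 1%R `^ q^-1); last by rewrite mul1e poweR_ge0.
by exists 1%R => //=; rewrite in_itv/= ltr01.
Qed.

(** [D] is at least [D l] on []0, l]], and the weight [s' x ^ (s' - 1)] has integral [l ^ s']
    there. *)
Lemma lorentz_of_dist_weak D l : (0 < l)%R -> (forall l', 0 <= D l') ->
  (forall l1 l2, (l1 <= l2)%R -> D l2 <= D l1) ->
  measurable_fun I (D : measurableTypeR R -> _) ->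
  l%:E * D l `^ q^-1 <= lorentz_of_dist q s D.
Proof.
move=> l0 D0 Dni mD; rewrite /lorentz_of_dist; case: s qs => [s'| |]//; last first.
  by move=> _; apply: ereal_sup_ubound; exists l => //=; rewrite in_itv/= l0.
rewrite lee_fin => qs'; have s0 : (0 < s')%R := lt_le_trans q0 qs'.
apply: poweR_le_root => //; first by rewrite mule_ge0 ?poweR_ge0// lee_fin ltW.
rewrite poweRM ?poweR_ge0 ?lee_fin ?(ltW l0)// -poweRrM poweR_EFin muleC.
rewrite -integral_powR_bounded// -ge0_integralZl//; last 3 first.
- exact: measurable_powR_deriv.
- by move=> x; rewrite /= in_itv/= => /andP[x0 _]; rewrite lee_fin mulr_ge0 ?powR_ge0// ltW.
- exact: poweR_ge0.
apply: (@le_trans _ _ (\int[leb]_(l' in `]0%R, l])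
    ((s' * l' `^ (s' - 1))%:E * D l' `^ (s' / q)))).
  apply: ge0_le_integral => //.
  - by move=> x _; rewrite mule_ge0 ?poweR_ge0// lee_fin mulr_ge0 ?powR_ge0// ltW.
  - by apply: emeasurable_funM => //; exact: measurable_powR_deriv.
  - apply: measurable_funS (mpow s' (s'/q) mD) => //.
    exact: subset_itvl.
  - move=> x; rewrite /= in_itv/= => /andP[x0 xl]; rewrite muleC lee_wpmul2l//.
      by rewrite lee_fin mulr_ge0 ?powR_ge0// ltW.
    by rewrite mulrC; apply: le_poweR2; rewrite ?Dni// mulr_ge0 ?invr_ge0// ltW.
apply: ge0_subset_integral => //.
- exact: mpow.
- by move=> x _; rewrite mule_ge0 ?poweR_ge0// lee_fin mulr_ge0 ?powR_ge0// ltW.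
- exact: subset_itvl.
Qed.

Lemma le_lorentz_of_dist D1 D2 : (forall l, 0 <= D1 l) ->
  (forall l, (0 < l)%R -> D1 l <= D2 l) ->
  measurable_fun I (D1 : measurableTypeR R -> _) ->
  measurable_fun I (D2 : measurableTypeR R -> _) ->
  lorentz_of_dist q s D1 <= lorentz_of_dist q s D2.
Proof.
move=> D0 D12 mD1 mD2; rewrite /lorentz_of_dist; case: s qs => [s'| |]//; last first.
  move=> _; apply: ge_ereal_sup => /= _ [l + <-]; rewrite /= in_itv/= andbT => l0.
  apply: le_ereal_sup_tmp; exists (l%:E * D2 l `^ q^-1).
    by exists l => //=; rewrite in_itv/= l0.
  rewrite lee_wpmul2l ?lee_fin ?(ltW l0)//; apply: le_poweR2 => //; last exact: D12.
  by rewrite invr_ge0 ltW.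
rewrite lee_fin => qs'; have s0 : (0 < s')%R := lt_le_trans q0 qs'.
apply: le_poweR2; first by rewrite invr_ge0 ltW.
  apply: integral_ge0 => x _; rewrite mule_ge0 ?poweR_ge0// lee_fin.
  by rewrite mulr_ge0 ?powR_ge0// ltW.
apply: ge0_le_integral => //.
- by move=> x _; rewrite mule_ge0 ?poweR_ge0// lee_fin mulr_ge0 ?powR_ge0// ltW.
- exact: mpow.
- exact: mpow.
- move=> x; rewrite /= in_itv/= andbT => x0; rewrite lee_wpmul2l//.
    by rewrite lee_fin mulr_ge0 ?powR_ge0// ltW.
  by apply: le_poweR2; rewrite ?D12// mulr_ge0 ?invr_ge0// ltW.
Qed.

(** Monotone convergence in the level variable. Only an upper bound of [D] by the limit is assumed,
    which is what a Fatou argument or a series of measures provides. *)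
Lemma lorentz_of_dist_lim (D : R -> \bar R) (Dn : nat -> R -> \bar R) B :
  (forall l, 0 <= D l) -> (forall n l, 0 <= Dn n l) ->
  measurable_fun I (D : measurableTypeR R -> _) ->
  (forall n, measurable_fun I (Dn n : measurableTypeR R -> _)) ->
  (forall l, nondecreasing_seq (Dn ^~ l)) ->
  (forall l, (0 < l)%R -> D l <= limn (Dn ^~ l)) ->
  (forall n, lorentz_of_dist q s (Dn n) <= B) -> lorentz_of_dist q s D <= B.
Proof.
move=> D0 Dn0 mD mDn ndD DDn hB.
have B0 : 0 <= B by exact: le_trans (lorentz_of_dist_ge0 _) (hB 0%N).
move: hB; rewrite /lorentz_of_dist; case: s qs => [s'| |]//; last first.
  move=> _ hB; apply: ge_ereal_sup => /= _ [l + <-]; rewrite /= in_itv/= andbT => l0.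
  rewrite -lee_pdivlMl//; apply: le_root_poweR => //.
    by rewrite mule_ge0// lee_fin invr_ge0 ltW.
  apply: (le_trans (DDn _ l0)); apply: lime_le.
    exact: ereal_nondecreasing_is_cvgn.
  apply: nearW => n; rewrite -[q]invrK; apply: poweR_le_root => //; first by rewrite invr_gt0.
  rewrite lee_pdivlMl//; apply: le_trans (hB n).
  by apply: ereal_sup_ubound; exists l => //=; rewrite in_itv/= l0.
rewrite lee_fin => qs' hB; have s0 : (0 < s')%R := lt_le_trans q0 qs'.
have r0 : (0 < s' / q)%R by rewrite divr_gt0.
have k0 x : (0 <= s' * x `^ (s' - 1))%R by rewrite mulr_ge0 ?powR_ge0// ltW.
have ndk l : nondecreasing_seq (fun n => (s' * l `^ (s' - 1))%:E * Dn n l `^ (s' / q)).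
  move=> m n mn; rewrite lee_wpmul2l ?lee_fin//; apply: le_poweR2 => //.
    exact: ltW.
  exact: ndD.
apply: le_root_poweR => //.
  by apply: integral_ge0 => x _; rewrite mule_ge0 ?poweR_ge0// lee_fin.
apply: (@le_trans _ _ (\int[leb]_(l in I)
   limn (fun n => (s' * l `^ (s' - 1))%:E * Dn n l `^ (s' / q)))).
  apply: ge0_le_integral => //.
  - by move=> x _; rewrite mule_ge0 ?poweR_ge0// lee_fin.
  - exact: mpow.
  - apply: (emeasurable_fun_cvg (fun n l => (s' * l `^ (s' - 1))%:E * Dn n l `^ (s' / q))).
      by move=> n; exact: mpow.
    by move=> x _; exact: ereal_nondecreasing_is_cvgn.
  (* The power is moved across the inequality before the limit is compared, so its monotonicity
     suffices and its continuity is not invoked. *)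
  - move=> x; rewrite /I/= in_itv/= andbT => x0.
    have kx0 : (0 < s' * x `^ (s' - 1))%R by rewrite mulr_gt0// powR_gt0.
    rewrite -lee_pdivlMl//; apply: root_le_poweR => //.
      rewrite mule_ge0 ?lee_fin ?invr_ge0//.
      apply: lime_ge; first exact: ereal_nondecreasing_is_cvgn.
      by apply: nearW => n; rewrite mule_ge0 ?poweR_ge0 ?lee_fin.
    apply: (le_trans (DDn _ x0)); apply: lime_le; first exact: ereal_nondecreasing_is_cvgn.
    apply: nearW => n; apply: poweR_le_root => //; rewrite lee_pdivlMl//.
    apply: lime_ge; first exact: ereal_nondecreasing_is_cvgn.
    by exists n => // m /= nm; exact: ndk.
rewrite monotone_convergence//; last 2 first.
- by move=> n; exact: mpow.
- by move=> n x _; rewrite mule_ge0 ?poweR_ge0 ?lee_fin.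
apply: lime_le.
  apply: ereal_nondecreasing_is_cvgn => m n mn; apply: ge0_le_integral => //.
  - by move=> x _; rewrite mule_ge0 ?poweR_ge0 ?lee_fin.
  - exact: mpow.
  - exact: mpow.
  - by move=> x _; exact: ndk.
apply: nearW => n; rewrite -[s' in leRHS]invrK; apply: poweR_le_root => //.
  by rewrite invr_gt0.
by apply: integral_ge0 => x _; rewrite mule_ge0 ?poweR_ge0// lee_fin.
Qed.

End LorentzFun.

Section LorentzMinkowski.
Context {R : realType}.
Notation leb := (@lebesgue_measure R).
Local Open Scope ereal_scope.
Notation I := (`]0%R, +oo[%classic : set (measurableTypeR R)).

Lemma Lnorm_sum_le (r : R) (h : nat -> measurableTypeR R -> R) m :
  (1 <= r)%R -> (forall n, measurable_fun setT (h n)) ->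
  Lnorm leb r%:E (EFin \o (fun x => \sum_(n < m) h n x)%R) <=
    \sum_(n < m) Lnorm leb r%:E (EFin \o h n).
Proof.
move=> r1 mh; elim: m => [|m ih].
  rewrite big_ord0 [X in Lnorm _ _ X](_ : _ = cst 0); last first.
    by apply/funext => x /=; rewrite big_ord0.
  by rewrite Lnorm0// eqe gt_eqF// (lt_le_trans _ r1).
rewrite big_ord_recr/= [X in Lnorm _ _ X](_ : _ =
    EFin \o ((fun x => \sum_(n < m) h n x)%R \+ h m)%R); last first.
  by apply/funext => x /=; rewrite big_ord_recr.
apply: le_trans (minkowski_EFin _ _ _ _) _ => //.
  exact: measurable_sum.
by rewrite leeD2r.
Qed.

(** The weight [s ^ (q/s) l ^ (q - q/s)] is the one whose power [s/q] is [s l ^ (s - 1)]. Inside the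
    norm the expression is linear in [D], as Minkowski demands; finiteness of [D] makes [fine]
    lossless. *)
Lemma lorentz_of_dist_Lnorm (q s : R) (D : R -> \bar R) : (0 < q)%R -> (q <= s)%R ->
  (forall l, (0 < l)%R -> 0 <= D l < +oo) ->
  lorentz_of_dist q s%:E D `^ q = Lnorm leb (s / q)%:E
    (EFin \o (fun l => if (0 < l)%R then
       s `^ (q / s) * l `^ (q - q / s) * fine (D l) else 0)%R).
Proof.
move=> q0 qs D0; have s0 : (0 < s)%R := lt_le_trans q0 qs.
rewrite unlock /lorentz_of_dist -poweRrM invf_div [(s^-1 * q)%R]mulrC; congr (_ `^ _).
rewrite [LHS]integral_mkcond; apply: eq_integral => l _.
rewrite patchE mem_set_bool in_itv/= andbT; case: ifPn => l0; last first.
  by rewrite normr0 powR0// gt_eqF// divr_gt0.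
have /andP[Dl0 Dly] := D0 _ l0.
have fD0 : (0 <= fine (D l))%R by exact: fine_ge0.
rewrite ger0_norm ?mulr_ge0 ?powR_ge0// -[D l in LHS]fineK ?ge0_fin_numE//.
rewrite poweR_EFin -EFinM; congr _%:E.
rewrite !powRM ?mulr_ge0 ?powR_ge0// -!powRrM; congr (_ * _ * _)%R.
  by rewrite mulrA divfK ?gt_eqF// divff ?gt_eqF// powRr1// ltW.
congr (_ `^ _)%R; rewrite mulrBl mulrCA mulfV ?gt_eqF// mulr1.
by rewrite mulrA divfK ?gt_eqF// divff ?gt_eqF.
Qed.

(** The upper q-estimate at the level of distribution functions: Minkowski in L^{s/q} for the
    partial sums, then monotone convergence. For [s = +oo] a supremum of sums is bounded by the sum
    of suprema. *)
Lemma lorentz_of_dist_sum (q : R) (s : \bar R) (D : R -> \bar R)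
    (Dn : nat -> R -> \bar R) :
  (0 < q)%R -> q%:E <= s ->
  (forall l, 0 <= D l) -> (forall n l, 0 <= Dn n l) ->
  measurable_fun I (D : measurableTypeR R -> _) ->
  (forall n, measurable_fun I (Dn n : measurableTypeR R -> _)) ->
  (forall n l1 l2, (l1 <= l2)%R -> Dn n l2 <= Dn n l1) ->
  (forall l, (0 < l)%R -> D l <= \sum_(n <oo) Dn n l) ->
  lorentz_of_dist q s D `^ q <= \sum_(n <oo) lorentz_of_dist q s (Dn n) `^ q.
Proof.
move=> q0 qs D0 Dn0 mD mDn niD DDn.
set B := leRHS.
have L0 n : 0 <= lorentz_of_dist q s (Dn n) `^ q by exact: poweR_ge0.
have B0 : 0 <= B by exact: nneseries_ge0.
(* If the right-hand side is finite, so is each term, and the weak-type bound makes each [Dn n l]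
   finite; real-valued Minkowski then applies. *)
have [->|By] := eqVneq B +oo; first by rewrite leey.
have Lfin n : lorentz_of_dist q s (Dn n) < +oo.
  apply: (@lty_poweRy _ _ q); first by rewrite gt_eqF.
  apply: (@le_lt_trans _ _ B); last by rewrite ltey.
  apply: le_trans (nneseries_lim_ge n.+1 _) => //.
  by rewrite big_nat_recr//= leeDr// sume_ge0.
have Dnfin n l : (0 < l)%R -> Dn n l < +oo.
  move=> l0; apply: (@lty_poweRy _ _ q^-1); first by rewrite gt_eqF// invr_gt0.
  have := @lorentz_of_dist_weak _ q s q0 qs (Dn n) l l0 (Dn0 n) (niD n) (mDn n).
  rewrite -lee_pdivlMl// => /le_lt_trans; apply.
  by apply: lte_mul_pinfty => //; rewrite lee_fin invr_ge0 ltW.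
apply: root_le_poweR => //; first exact: lorentz_of_dist_ge0.
pose S m l := \sum_(n < m) Dn n l.
have S0 m l : 0 <= S m l by exact: sume_ge0.
have mS m : measurable_fun I (S m : measurableTypeR R -> _) by exact: emeasurable_sum.
have cS l : S ^~ l = fun m => \sum_(0 <= n < m) Dn n l.
  by apply/funext => m; rewrite /S big_mkord.
apply: (@lorentz_of_dist_lim _ q s q0 qs D S) => //.
- by move=> l; rewrite cS => m n mn; apply: lee_sum_nneg_natr => //.
- by move=> l l0; rewrite cS; exact: DDn.
move=> m; apply: poweR_le_root => //; first exact: lorentz_of_dist_ge0.
apply: (@le_trans _ _ (\sum_(n < m) lorentz_of_dist q s (Dn n) `^ q)); last first.
  by rewrite -(big_mkord xpredT (fun n => lorentz_of_dist q s (Dn n) `^ q)); exact: nneseries_lim_ge.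
move: qs; case: s Lfin {B L0 B0 By} => [s'| |]// Lfin qs'; last first.
  apply: root_le_poweR => //; first exact: lorentz_of_dist_ge0.
    by apply: sume_ge0 => n _; exact: poweR_ge0.
  apply: ge_ereal_sup => /= _ [l + <-]; rewrite /= in_itv/= andbT => l0.
  apply: poweR_le_root => //; first by rewrite mule_ge0 ?poweR_ge0// lee_fin ltW.
  rewrite poweRM ?poweR_ge0// ?lee_fin ?(ltW l0)// poweRVK ?gt_eqF// /S ge0_sume_distrr//.
  apply: lee_sum => n _; rewrite -[Dn n l](@poweRVK _ q) ?gt_eqF//.
  rewrite -poweRM ?poweR_ge0// ?lee_fin ?(ltW l0)//; apply: le_poweR2; first exact: ltW.
    by rewrite mule_ge0 ?poweR_ge0// lee_fin ltW.
  by apply: ereal_sup_ubound; exists l => //=; rewrite in_itv/= l0.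
rewrite lee_fin in qs'.
have s0 : (0 < s')%R := lt_le_trans q0 qs'.
pose h n (l : measurableTypeR R) := (if (0 < l)%R then
       s' `^ (q / s') * l `^ (q - q / s') * fine (Dn n l) else 0)%R.
have mh n : measurable_fun setT (h n).
  have -> : h n = (fun l => s' `^ (q / s') * l `^ (q - q / s') * fine (Dn n l))%R \_ I.
    by apply/funext => l; rewrite patchE mem_set_bool in_itv/= andbT.
  apply: (measurable_restrictT _ _).1; first exact: measurable_itv.
  apply: measurable_funM.
    apply: measurable_funM => //; apply: measurable_funTS; exact: measurable_powR.
  exact: (measurableT_comp (fine_measurable measurableT) (mDn n)).
rewrite lorentz_of_dist_Lnorm//; last first.
  move=> l l0; rewrite S0/=; apply: lte_sum_pinfty => n _; exact: Dnfin.
rewrite [X in Lnorm _ _ X](_ : _ = EFin \o (fun x => \sum_(n < m) h n x)%R); last first.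
  apply/funext => l /=; congr _%:E; rewrite /h; case: ifPn => l0; last first.
    by rewrite big1.
  by rewrite -mulr_sumr sum_fine// => n _; rewrite ge0_fin_numE// Dnfin.
rewrite (eq_bigr (fun n : 'I_m => Lnorm leb (s' / q)%:E (EFin \o h n))); last first.
  by move=> n _; rewrite lorentz_of_dist_Lnorm// => l l0; rewrite Dn0/= Dnfin.
by apply: Lnorm_sum_le => //; rewrite ler_pdivlMr// mul1r.
Qed.

End LorentzMinkowski.

(** Superlevel sets of a monotone function on an interval are intervals. *)
Lemma nonincreasing_emeasurable {R : realType} (D : set (measurableTypeR R))
    (f : measurableTypeR R -> \bar R) : is_interval (D : set R) ->
  (forall x y : R, (x <= y)%R -> (f y <= f x)%E) -> measurable_fun D f.
Proof.
move=> iD fni; have mD : measurable D by exact: is_interval_measurable.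
apply: (measurability _ (ErealGenOInfty.measurableE R)).
move=> /= _ [_ [x ->]] <-; apply: is_interval_measurable => a b [Da fa] [Db fb] c /andP[ac cb].
split; first by apply: (iD a b) => //; rewrite ac cb.
by move: fb; rewrite /= !in_itv/= !andbT => /lt_le_trans; apply; exact: fni.
Qed.

(** * Lorentz functionals of functions, computed from the distribution function *)

Section Lorentz.
Context {R : realType} {d : nat}.
Notation E := (euclid R d).
Notation mu := (@lebesgue R d).
Notation leb := (@lebesgue_measure R).
Local Open Scope ereal_scope.
Implicit Types (f g : E -> \bar R).
Notation I := (`]0%R, +oo[%classic : set (measurableTypeR R)).

Definition distribution f (l : R) : \bar R := mu [set x | l%:E < `|f x|].

Lemma measurable_superlevel f (l : R) : measurable_fun setT f ->
  measurable [set x | l%:E < `|f x|].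
Proof.
move=> mf; have maf : measurable_fun setT (abse \o f) by exact: measurableT_comp.
by have := measurable_lte measurableT (measurable_cst l%:E) maf; rewrite setTI.
Qed.

Lemma distribution_ni f l1 l2 : measurable_fun setT f -> (l1 <= l2)%R ->
  distribution f l2 <= distribution f l1.
Proof.
move=> mf l12; apply: le_measure; rewrite ?inE; try exact: measurable_superlevel.
by move=> x /=; apply: le_lt_trans; rewrite lee_fin.
Qed.

Lemma measurable_distribution f (D : set (measurableTypeR R)) : measurable_fun setT f ->
  is_interval (D : set R) ->
  measurable_fun D (distribution f : measurableTypeR R -> \bar R).
Proof.
by move=> mf iD; apply: nonincreasing_emeasurable => // x y; exact: distribution_ni.
Qed.

Lemma rearrangement_ge0 f t : 0 <= rearrangement f t.
Proof. by apply: le_ereal_inf_tmp => /= _ [y [y0 _] <-]; rewrite lee_fin. Qed.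

Lemma rearrangement_ni f (t1 t2 : R) : (t1 <= t2)%R ->
  rearrangement f t2 <= rearrangement f t1.
Proof.
move=> t12; apply: ereal_inf_le_tmp => /= _ [y [y0 h] <-]; exists y => //; split=> //.
by rewrite (le_trans h)// lee_fin.
Qed.

(** One direction is the definition of the infimum. For the other, continuity from below along the
    levels [l + 1/(n+1)] yields some [n] at which the superlevel set still has measure above [t];
    this keeps the rearrangement at [t] strictly above [l]. *)
Lemma rearrangement_gt f (l t : R) : measurable_fun setT f -> (0 <= l)%R ->
  (l%:E < rearrangement f t) = (t%:E < distribution f l).
Proof.
move=> mf l0; apply/idP/idP => [|tD].
  apply: contraTT; rewrite -!leNgt => h; apply: ereal_inf_lbound.
  by exists l.
pose F n := [set x | (l + n.+1%:R^-1)%:E < `|f x|].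
have mF n : measurable (F n) by exact: measurable_superlevel.
have UF : \bigcup_n F n = [set x | l%:E < `|f x|].
  apply/seteqP; split=> [x [n _]|x] /=.
    by apply: le_lt_trans; rewrite lee_fin lerDl.
  move=> lx; suff [n hn] : exists n, (l + n.+1%:R^-1)%:E < `|f x| by exists n.
  move: lx; case: (`|f x|) => [y| |]//; last by move=> _; exists 0%N; rewrite ltry.
  rewrite lte_fin => ly; have yl0 : (0 < y - l)%R by rewrite subr_gt0.
  exists (Num.truncn (y - l)^-1); rewrite lte_fin addrC -ltrBrDr.
  by rewrite invf_plt ?posrE// truncnS_gt.
have ndF : {homo F : n m / (n <= m)%N >-> (n <= m)%O}.
  move=> n m nm; apply/subsetPset => x /=; apply: le_lt_trans.
  by rewrite lee_fin lerD2l lef_pV2 ?posrE// ler_nat.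
have mUF : measurable (\bigcup_n F n) by exact: bigcup_measurable.
have /cvg_lim cv := @nondecreasing_cvg_mu _ _ _ mu _ mF mUF ndF.
have [n tn] : exists n, t%:E < mu (F n).
  apply: contrapT => /forallNP h.
  suff : distribution f l <= t%:E by rewrite leNgt tD.
  rewrite /distribution -UF -cv//; apply: lime_le.
    apply: ereal_nondecreasing_is_cvgn => m k mk; apply: le_measure; rewrite ?inE//.
    exact/subsetPset/ndF.
  by apply: nearW => n; rewrite /= leNgt; exact/negP.
apply: (@lt_le_trans _ _ (l + n.+1%:R^-1)%:E); first by rewrite lte_fin ltrDl.
apply: le_ereal_inf_tmp => /= _ [y [y0 h] <-]; rewrite lee_fin leNgt; apply/negP => yl.
have : mu (F n) <= t%:E.
  by apply: le_trans h; apply: distribution_ni => //; exact: ltW.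
by rewrite leNgt tn.
Qed.

(** For finite [s], the layer-cake formula with density [t ^ (s/q - 1)] and [rearrangement_gt]
    produce the inner integral [(q/s) D(l) ^ (s/q)], whose constant cancels the normalisation
    [s/q]. *)
Lemma lorentzE (q : R) (s : \bar R) f : (0 < q)%R -> q%:E <= s ->
  measurable_fun setT f -> lorentz q s f = lorentz_of_dist q s (distribution f).
Proof.
move=> q0 qs mf; rewrite /lorentz /lorentz_of_dist; case: s qs => [s| |]//.
- rewrite lee_fin => qs; have s0 : (0 < s)%R := lt_le_trans q0 qs.
  congr (_ `^ _).
  rewrite (_ : \int[_]_(t in _) _ = \int[leb]_(t in I)
      ((t `^ (s / q - 1))%:E * rearrangement f t `^ s)); last first.
    apply: eq_integral => t; rewrite inE/= in_itv/= andbT => t0.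
    rewrite poweRM ?lee_fin ?powR_ge0// ?rearrangement_ge0// poweR_EFin -powRrM.
    rewrite muleAC -EFinM; congr (_%:E * _).
    have tn0 : t != 0%R by rewrite gt_eqF.
    by rewrite powRB ?tn0 ?implybT// powRr1 ?(ltW t0)// [(q^-1 * s)%R]mulrC.
  rewrite layer_cake//; last 4 first.
  - apply/measurable_EFinP; apply: measurable_funTS; exact: measurable_powR.
  - apply: nonincreasing_emeasurable; first exact: interval_is_interval.
    by move=> x y; exact: rearrangement_ni.
  - by move=> x _; rewrite lee_fin powR_ge0.
  - by move=> x _; exact: rearrangement_ge0.
  rewrite -ge0_integralZl//; last 3 first.
  - apply: emeasurable_funM; first exact: measurable_powR_deriv.
    apply: nonincreasing_emeasurable; first exact: interval_is_interval.
    move=> x y xy; apply: ge0_subset_integral => //.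
    + apply: measurableI => //.
      rewrite -[X in measurable X]setTI; apply: measurable_lte => //.
      apply: nonincreasing_emeasurable; first by move=> ? ?.
      by move=> ? ?; exact: rearrangement_ni.
    + apply: measurableI => //.
      rewrite -[X in measurable X]setTI; apply: measurable_lte => //.
      apply: nonincreasing_emeasurable; first by move=> ? ?.
      by move=> ? ?; exact: rearrangement_ni.
    + apply/measurable_EFinP; apply: measurable_funTS; exact: measurable_powR.
    + by move=> z _; rewrite lee_fin powR_ge0.
    + by apply: setIS => z /=; apply: le_lt_trans; rewrite lee_fin.
  - move=> x _; rewrite mule_ge0//; first by rewrite lee_fin mulr_ge0 ?powR_ge0// ltW.
    by apply: integral_ge0 => z _; rewrite lee_fin powR_ge0.
  - by rewrite lee_fin divr_ge0// ltW.
  apply: eq_integral => l; rewrite inE/= in_itv/= andbT => l0.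
  rewrite muleCA; congr (_ * _).
  have r0 : (0 < s / q)%R by rewrite divr_gt0.
  rewrite -integral_powR_lt//.
  rewrite (_ : I `&` _ = I `&` [set t | t%:E < distribution f l]); last first.
    by congr setI; apply/funext => t /=; rewrite rearrangement_gt// ltW.
  rewrite -ge0_integralZl//.
  - apply: measurableI => //.
    by rewrite -[X in measurable X]setTI; apply: measurable_lte.
  - apply/measurable_EFinP; apply: measurable_funTS; exact: measurable_powR.
  - by move=> x _; rewrite lee_fin powR_ge0.
  - by rewrite lee_fin ltW.
(* For [s = +oo] both sides are the supremum of [t ^ (1/q) l] over the pairs with [t < D(l)],
   equivalently [l] below the rearrangement at [t]. Each inequality picks a number strictly between
   two candidates to produce such a pair. *)
- move=> _; apply/eqP; rewrite eq_le; apply/andP; split.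
  + apply: ge_ereal_sup => /= _ [t + <-]; rewrite /= in_itv/= andbT => t0.
    set B := ereal_sup _.
    have tq0 : (0 < t `^ q^-1)%R by rewrite powR_gt0.
    rewrite -lee_pdivlMl//.
    have hB l : (0 < l)%R -> l%:E < rearrangement f t ->
        (t `^ q^-1)%:E * l%:E <= B.
      move=> l0; rewrite rearrangement_gt ?(ltW l0)// => tD.
      rewrite muleC; apply: le_trans (_ : l%:E * distribution f l `^ q^-1 <= B); last first.
        by apply: ereal_sup_ubound; exists l => //=; rewrite in_itv/= l0.
      rewrite lee_wpmul2l ?lee_fin ?(ltW l0)// -poweR_EFin.
      by apply: le_poweR2; rewrite ?invr_ge0 ?lee_fin ?(ltW q0) ?(ltW t0) ?(ltW tD).
    rewrite leNgt; apply/negP => h.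
    have B0 : 0 <= B.
      apply: le_ereal_sup_tmp; exists (1%:E * distribution f 1 `^ q^-1); last by rewrite mul1e poweR_ge0.
      by exists 1%R => //=; rewrite in_itv/= ltr01.
    have B'0 : 0 <= ((t `^ q^-1)^-1)%:E * B by rewrite mule_ge0// lee_fin invr_ge0 powR_ge0.
    have [l [l0 Bl lr]] : exists l : R, [/\ (0 < l)%R,
        ((t `^ q^-1)^-1)%:E * B < l%:E & l%:E < rearrangement f t].
      move: h B'0; case: (_ * B) => [b| |]//; last by rewrite ltNge leey.
      case: (rearrangement f t) => [r| |]//.
        rewrite lte_fin lee_fin => br b0; exists ((b + r) / 2)%R; split.
        - by rewrite divr_gt0// ltr_pwDr// (le_lt_trans b0).
        - by rewrite lte_fin midf_lt.
        - by rewrite lte_fin midf_lt.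
      rewrite lee_fin => _ b0; exists (b + 1)%R; split.
      - by rewrite ltr_wpDl.
      - by rewrite lte_fin ltrDl.
      - by rewrite ltry.
    have := hB _ l0 lr; rewrite -lee_pdivlMl// leNgt.
    by rewrite Bl.
  + apply: ge_ereal_sup => /= _ [l + <-]; rewrite /= in_itv/= andbT => l0.
    set B := ereal_sup _.
    have B0 : 0 <= B.
      apply: le_ereal_sup_tmp; exists ((1 `^ q^-1)%:E * rearrangement f 1).
        by exists 1%R => //=; rewrite in_itv/= ltr01.
      by rewrite mule_ge0 ?rearrangement_ge0// lee_fin powR_ge0.
    rewrite -lee_pdivlMl//; apply: le_root_poweR => //.
      by rewrite mule_ge0// lee_fin invr_ge0 ltW.
    set B' := _ `^ q; rewrite leNgt; apply/negP => h.
    have B'0 : 0 <= B' by exact: poweR_ge0.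
    have [t [t0 Bt tr]] : exists t : R, [/\ (0 < t)%R, B' < t%:E & t%:E < distribution f l].
      move: h B'0; case: B' => [b| |]//; last by rewrite ltNge leey.
      case: (distribution f l) => [r| |]//.
        rewrite lte_fin lee_fin => br b0; exists ((b + r) / 2)%R; split.
        - by rewrite divr_gt0// ltr_pwDr// (le_lt_trans b0).
        - by rewrite lte_fin midf_lt.
        - by rewrite lte_fin midf_lt.
      rewrite lee_fin => _ b0; exists (b + 1)%R; split.
      - by rewrite ltr_wpDl.
      - by rewrite lte_fin ltrDl.
      - by rewrite ltry.
    suff : t%:E <= B' by rewrite leNgt Bt.
    rewrite /B' -[q in leRHS]invrK; apply: poweR_le_root; rewrite ?invr_gt0 ?lee_fin ?(ltW t0)//.
    rewrite lee_pdivlMl// poweR_EFin.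
    apply: le_trans (_ : (t `^ q^-1)%:E * rearrangement f t <= B); last first.
      by apply: ereal_sup_ubound; exists t => //=; rewrite in_itv/= t0.
    rewrite muleC lee_wpmul2l ?lee_fin ?powR_ge0//.
    by apply: ltW; rewrite rearrangement_gt// ltW.
Qed.

End Lorentz.

Section LorentzNorm.
Context {R : realType} {d : nat}.
Notation E := (euclid R d).
Notation mu := (@lebesgue R d).
Notation leb := (@lebesgue_measure R).
Local Open Scope ereal_scope.
Implicit Types (f g : E -> \bar R).
Notation I := (`]0%R, +oo[%classic : set (measurableTypeR R)).

Let mdist f (mf : measurable_fun setT f) :
  measurable_fun I (distribution f : measurableTypeR R -> \bar R).
Proof. by apply: measurable_distribution => //; exact: interval_is_interval. Qed.

Section fixed_exponents.
Variables (q : R) (s : \bar R).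
Hypotheses (q0 : (0 < q)%R) (qs : q%:E <= s).

Lemma lorentz_ge0 f : measurable_fun setT f -> 0 <= lorentz q s f.
Proof. by move=> mf; rewrite lorentzE//; exact: lorentz_of_dist_ge0. Qed.

Lemma lorentz_le f g : measurable_fun setT f -> measurable_fun setT g ->
  (forall x, `|f x| <= `|g x|) -> lorentz q s f <= lorentz q s g.
Proof.
move=> mf mg fg; rewrite !lorentzE//; apply: le_lorentz_of_dist => //.
- move=> l l0; apply: le_measure; rewrite ?inE; try exact: measurable_superlevel.
  by move=> x /= h; exact: lt_le_trans (fg x).
- exact: mdist.
- exact: mdist.
Qed.

Lemma distribution_ae f g l : measurable_fun setT f -> measurable_fun setT g ->
  {ae mu, forall x, f x = g x} -> distribution f l = distribution g l.
Proof.
suff H h1 h2 : measurable_fun setT h1 -> measurable_fun setT h2 ->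
    {ae mu, forall x, h1 x = h2 x} -> distribution h1 l <= distribution h2 l.
  move=> mf mg fg; apply/eqP; rewrite eq_le !H//.
  by apply: filterS fg => x ->.
move=> m1 m2 [N [mN N0 h12N]].
apply: (@le_trans _ _ (mu ([set x | l%:E < `|h2 x|] `|` N))).
  apply: le_measure; rewrite ?inE; try exact: measurable_superlevel.
    by apply: measurableU => //; exact: measurable_superlevel.
  move=> x /= lx; have [h|/h12N] := pselect (h1 x = h2 x); last by right.
  by left; rewrite /= -h.
apply: le_trans (measureU2 _ _ _) _ => //; first exact: measurable_superlevel.
by rewrite [X in _ + X <= _](_ : _ = 0) ?adde0//; exact: N0.
Qed.

Lemma lorentz_ae f g : measurable_fun setT f -> measurable_fun setT g ->
  {ae mu, forall x, f x = g x} -> lorentz q s f = lorentz q s g.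
Proof.
move=> mf mg fg; rewrite !lorentzE//; congr lorentz_of_dist; apply/funext => l.
exact: distribution_ae.
Qed.

Lemma lorentz_weak f l : measurable_fun setT f -> (0 < l)%R ->
  l%:E * distribution f l `^ q^-1 <= lorentz q s f.
Proof.
move=> mf l0; rewrite lorentzE//; apply: lorentz_of_dist_weak => //.
- by move=> l1 l2; exact: distribution_ni.
- exact: mdist.
Qed.

Lemma rearrangementZ (c : R) f t : (0 < c)%R -> measurable_fun setT f ->
  rearrangement (fun x => c%:E * f x) t = c%:E * rearrangement f t.
Proof.
move=> c0 mf; apply: eq_ge0_lt; first exact: rearrangement_ge0.
  by rewrite mule_ge0 ?rearrangement_ge0 ?lee_fin ?(ltW c0).
have mcf : measurable_fun setT (fun x => c%:E * f x) by exact: measurable_funeM.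
move=> l l0; rewrite rearrangement_gt//.
rewrite -lte_pdivrMl// -EFinM rearrangement_gt//; last by rewrite mulr_ge0 ?invr_ge0 ?(ltW c0).
congr (_ < mu _); apply/funext => x /=.
by rewrite abseM gee0_abs ?lee_fin ?(ltW c0)// EFinM lte_pdivrMl.
Qed.

(** Where the reverse inequality is needed, this one is applied with [c^-1]. *)
Lemma lorentzZ_le (c : R) f : (0 < c)%R -> measurable_fun setT f ->
  lorentz q s (fun x => c%:E * f x) <= c%:E * lorentz q s f.
Proof.
move=> c0 mf; rewrite /lorentz; case: s qs => [s'| |]//; last first.
  move=> _; apply: ge_ereal_sup => /= _ [t + <-]; rewrite /= in_itv/= andbT => t0.
  rewrite rearrangementZ// muleCA lee_wpmul2l ?lee_fin ?(ltW c0)//.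
  by apply: ereal_sup_ubound; exists t => //=; rewrite in_itv/= t0.
rewrite lee_fin => qs'; have s0 : (0 < s')%R := lt_le_trans q0 qs'.
under eq_integral => t _ do rewrite rearrangementZ// muleCA.
rewrite (_ : \int[_]_(t in _) _ = (c `^ s')%:E * \int[leb]_(t in I)
   (((t `^ q^-1)%:E * rearrangement f t) `^ s' * t^-1%:E)); last first.
  rewrite -ge0_integralZl//; last 3 first.
  - apply: emeasurable_funM.
      apply: (measurableT_comp (measurable_poweR s')); apply: emeasurable_funM.
        by apply/measurable_EFinP; apply: measurable_funTS; exact: measurable_powR.
      apply: nonincreasing_emeasurable; first exact: interval_is_interval.
      by move=> x y; exact: rearrangement_ni.
    apply: (@eq_measurable_fun _ _ _ _ _ (fun t : measurableTypeR R => (t `^ (-1))%:E)).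
      by move=> t; rewrite inE/= in_itv/= andbT => t0; rewrite powR_inv1 ?(ltW t0).
    by apply/measurable_EFinP; apply: measurable_funTS; exact: measurable_powR.
  - move=> t; rewrite /= in_itv/= andbT => t0; rewrite mule_ge0 ?poweR_ge0// lee_fin invr_ge0.
    exact: ltW.
  - by rewrite lee_fin powR_ge0.
  apply: eq_integral => t; rewrite inE/= in_itv/= andbT => t0.
  rewrite (@poweRM _ c%:E) ?lee_fin ?(ltW c0)//; last first.
    by rewrite mule_ge0 ?rearrangement_ge0 ?lee_fin ?powR_ge0.
  by rewrite muleA.
rewrite muleCA (@poweRM _ (c `^ s')%:E) ?lee_fin ?powR_ge0//; last first.
  rewrite mule_ge0 ?lee_fin ?divr_ge0 ?(ltW s0) ?(ltW q0)//.
  apply: integral_ge0 => t; rewrite /= in_itv/= andbT => t0.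
  by rewrite mule_ge0 ?poweR_ge0// lee_fin invr_ge0 ltW.
by rewrite poweR_EFin -powRrM mulfV ?gt_eqF// powRr1// ltW.
Qed.

(** The superlevel sets of [f] are covered by those of the [fn], so the distribution functions
    compare as in the upper q-estimate. The hypothesis fits a splitting into disjoint pieces and,
    after scaling, a finite sum. *)
Lemma lorentz_sup_sum f (fn : nat -> E -> \bar R) :
  measurable_fun setT f -> (forall n, measurable_fun setT (fn n)) ->
  (forall x l, (0 < l)%R -> l%:E < `|f x| -> exists n, l%:E < `|fn n x|) ->
  lorentz q s f `^ q <= \sum_(n <oo) lorentz q s (fn n) `^ q.
Proof.
move=> mf mfn ffn; rewrite lorentzE//.
under eq_eseriesr do rewrite lorentzE//.
apply: lorentz_of_dist_sum => //.
- exact: mdist.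
- by move=> n; exact: mdist.
- by move=> n l1 l2; exact: distribution_ni.
- move=> l l0; apply: measure_sigma_subadditive.
  + by move=> n; exact: measurable_superlevel.
  + exact: measurable_superlevel.
  + by move=> x /= /(ffn _ _ l0)[n lx]; exists n.
Qed.

(** The sequence need not be monotone, so the sets where all later [fn n] exceed [l] are used: they
    increase with [N], and their union contains the superlevel set of [f]. *)
Lemma lorentz_fatou f (fn : nat -> E -> \bar R) B :
  measurable_fun setT f -> (forall n, measurable_fun setT (fn n)) ->
  (forall x l, (0 < l)%R -> l%:E < `|f x| ->
    exists N, forall n, (N <= n)%N -> l%:E < `|fn n x|) ->
  (forall n, lorentz q s (fn n) <= B) -> lorentz q s f <= B.
Proof.
move=> mf mfn ffn hB; rewrite lorentzE//.
pose A N (l : R) := \bigcap_(n in [set n | (N <= n)%N]) [set x | l%:E < `|fn n x|].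
have mA N l : measurable (A N l).
  by apply: bigcap_measurable; [exists N => /=|move=> n _; exact: measurable_superlevel].
have niA N l1 l2 : (l1 <= l2)%R -> mu (A N l2) <= mu (A N l1).
  move=> l12; apply: le_measure; rewrite ?inE// => x Ax n Nn.
  by apply: le_lt_trans (Ax n Nn); rewrite lee_fin.
have mmuA N : measurable_fun I ((fun l => mu (A N l)) : measurableTypeR R -> \bar R).
  apply: nonincreasing_emeasurable; first exact: interval_is_interval.
  by move=> x y; exact: niA.
have ndA l : {homo A ^~ l : n m / (n <= m)%N >-> (n <= m)%O}.
  by move=> n m nm; apply/subsetPset => x Ax k mk; apply: Ax; exact: leq_trans mk.
apply: (@lorentz_of_dist_lim _ q s q0 qs _ (fun N l => mu (A N l))) => //.
- exact: mdist.
- move=> l n m nm; apply: le_measure; rewrite ?inE//.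
  exact/subsetPset/ndA.
- move=> l l0; have mUA : measurable (\bigcup_N A N l) by exact: bigcup_measurable.
  have /cvg_lim -> // := @nondecreasing_cvg_mu _ _ _ mu _ (mA ^~ l) mUA (ndA l).
  apply: le_measure; rewrite ?inE//; first exact: measurable_superlevel.
  by move=> x /= /(ffn _ _ l0)[N h]; exists N.
- move=> n; apply: le_trans (hB n); rewrite lorentzE//.
  apply: le_lorentz_of_dist => //; last exact: mdist.
  move=> l l0; apply: le_measure; rewrite ?inE//; first exact: measurable_superlevel.
  by move=> x Ax; apply: (Ax n) => /=.
Qed.

End fixed_exponents.

Lemma lorentz_diag (p : R) f : (0 < p)%R -> measurable_fun setT f ->
  lorentz p p%:E f = (\int[mu]_x `|f x| `^ p) `^ p^-1.
Proof.
move=> p0 mf; rewrite lorentzE// /lorentz_of_dist; congr (_ `^ _).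
transitivity (\int[mu]_x (cst 1 x * `|f x| `^ p)); last first.
  by apply: eq_integral => x _; rewrite mul1e.
have maf : measurable_fun setT (fun x => `|f x|) by exact: measurableT_comp.
rewrite [RHS](@layer_cake _ _ _ mu setT (cst 1) (fun x => `|f x|) p p0 measurableT
  (measurable_cst _) maf) => [|x _|x _]; [|exact: lee01|exact: abse_ge0].
apply: eq_integral => l _; congr (_ * _); rewrite mulfV ?gt_eqF// poweRe1//.
by rewrite setTI integral_cst ?mul1e//; exact: measurable_superlevel.
Qed.

End LorentzNorm.

(** * Stopping cells and Doob's maximal inequality on a nested grid *)

Section NestedGrid.
Context {R : realType} {dX : measure_display} {X : measurableType dX} {J : countType}.
Variable mu : {sigma_finite_measure set X -> \bar R}.
Variable cell : nat -> X -> J.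
Hypothesis measurable_cell : forall k j, measurable [set x | cell k x = j].
Hypothesis nested : forall k x y, cell k.+1 x = cell k.+1 y -> cell k x = cell k y.
Local Open Scope ereal_scope.

(** A grid is encoded by labellings: the cells of generation [k] are the fibres of [cell k], and
    each label determines the previous one, so nesting involves no geometry. *)
Definition cell_at k x : set X := [set y | cell k y = cell k x].

Lemma measurable_cell_at k x : measurable (cell_at k x).
Proof. exact: measurable_cell. Qed.

Lemma nested_le k n x y : (k <= n)%N -> cell n x = cell n y -> cell k x = cell k y.
Proof.
move=> /subnK <-; elim: (n - k)%N => [//|m ih]; rewrite addSn => /nested; exact: ih.
Qed.

Lemma cell_at_eq k x y : cell_at k x y -> cell_at k y = cell_at k x.
Proof. by rewrite /cell_at /= => ->. Qed.

Section fibers.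
Variables (B : set X) (L : X -> nat).
Hypothesis mBL : forall n, measurable (B `&` L @^-1` [set n]).

Lemma measurable_fibers : measurable B.
Proof.
rewrite (_ : B = \bigcup_n (B `&` L @^-1` [set n])); first exact: bigcup_measurable.
by apply/seteqP; split=> [x Bx|x [n _ []]//]; exists (L x).
Qed.

Lemma integral_fibers (f : X -> \bar R) : measurable_fun B f -> (forall x, B x -> 0 <= f x) ->
  \int[mu]_(x in B) f x = \sum_(n <oo) \int[mu]_(x in B `&` L @^-1` [set n]) f x.
Proof.
have UB : \bigcup_n (B `&` L @^-1` [set n]) = B.
  by apply/seteqP; split=> [x [n _ []]//|x Bx]; exists (L x).
move=> mf f0; rewrite -{1}UB ge0_integral_bigcup ?UB//.
apply/trivIsetP => i j _ _ ij; apply/seteqP; split=> // x /= [[_ h1] [_ h2]].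
by move: ij; rewrite -h1 -h2 eqxx.
Qed.

(** The fibres of a map to [nat] form a countable measurable partition, so integrals may be compared
    one fibre at a time. *)
Lemma le_integral_fibers (f g : X -> \bar R) : measurable_fun setT f -> measurable_fun setT g ->
  (forall x, 0 <= f x) -> (forall x, 0 <= g x) ->
  (forall x, B x -> \int[mu]_(y in B `&` L @^-1` [set L x]) f y <=
                    \int[mu]_(y in B `&` L @^-1` [set L x]) g y) ->
  \int[mu]_(x in B) f x <= \int[mu]_(x in B) g x.
Proof.
move=> mf mg f0 g0 fg; rewrite !integral_fibers//; try exact: measurable_funTS.
apply: lee_nneseries => [n *|n _]; first exact: integral_ge0.
have [->|/set0P[x [Bx <-]]] := eqVneq (B `&` L @^-1` [set n]) set0.
  by rewrite !integral_set0.
exact: fg.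
Qed.

End fibers.

Section first_stop.
Variable P : nat -> X -> bool.
Hypothesis adP : forall k x y, cell k x = cell k y -> P k x = P k y.

Let B := [set x | exists k, P k x].

Let T x := if pselect (exists k, P k x) is left h then ex_minn h else 0%N.

Let TP x : B x -> P (T x) x.
Proof. by rewrite /B/= /T; case: pselect => // h _; case: ex_minnP. Qed.

Let Tmin x k : P k x -> (T x <= k)%N.
Proof.
move=> Pk; rewrite /T; case: pselect => [h|//].
by case: ex_minnP => m _; apply.
Qed.

Let adT x y : B x -> cell (T x) x = cell (T x) y -> B y /\ T y = T x.
Proof.
move=> Bx xy; have Py : P (T x) y by rewrite -(adP xy); exact: TP.
have By : B y by exists (T x).
split=> //; apply/eqP; rewrite eqn_leq Tmin//= Tmin//.
by rewrite (adP (nested_le (Tmin Py) xy)); exact: TP.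
Qed.

(** Codes the first stopped cell around [x], by generation and label, as a natural number; the
    fibres in [B] are exactly the maximal stopped cells. *)
Let L x := pickle (T x, cell (T x) x).

Let fiberE x : B x -> B `&` L @^-1` [set L x] = cell_at (T x) x.
Proof.
move=> Bx; apply/seteqP; split=> [y /= [By]|y /= xy].
  by move=> /(pcan_inj pickleK)[Txy]; rewrite /cell_at/= Txy.
have [By Txy] := adT Bx (esym xy).
by split=> //=; rewrite /L Txy xy.
Qed.

Let mfiber n : measurable (B `&` L @^-1` [set n]).
Proof.
have [->//|/set0P[x [Bx <-]]] := eqVneq (B `&` L @^-1` [set n]) set0.
by rewrite fiberE//; exact: measurable_cell_at.
Qed.

Lemma measurable_first_stop : measurable [set x | exists k, P k x].
Proof. exact: measurable_fibers mfiber. Qed.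

(** The maximal stopped cells partition the set of points that are ever stopped, and the comparison
    is assumed on each of them. *)
Lemma first_stop_le (f g : X -> \bar R) : measurable_fun setT f -> measurable_fun setT g ->
  (forall x, 0 <= f x) -> (forall x, 0 <= g x) ->
  (forall k x, P k x -> \int[mu]_(y in cell_at k x) f y <= \int[mu]_(y in cell_at k x) g y) ->
  \int[mu]_(x in [set x | exists k, P k x]) f x <=
  \int[mu]_(x in [set x | exists k, P k x]) g x.
Proof.
move=> mf mg f0 g0 fg; apply: (@le_integral_fibers _ L) => // x Bx.
by rewrite fiberE//; apply: fg; exact: TP.
Qed.

End first_stop.

(** Such a set arises from the rule that stops at generation [n] exactly on [A]; countability of the
    labels does the rest. *)
Lemma measurable_saturated n (A : set X) :
  (forall x y, cell n x = cell n y -> A x -> A y) -> measurable A.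
Proof.
move=> sA; rewrite (_ : A = [set x | exists k, (k == n) && (x \in A)]).
  apply: measurable_first_stop => k x y xy.
  have [kn|//] := eqVneq k n; rewrite /=; subst k.
  by apply/idP/idP; rewrite !inE; apply: sA.
apply/seteqP; split=> [x Ax|x [k /andP[_]]]; last by rewrite inE.
by exists n; rewrite eqxx inE.
Qed.

Section doob.
Variables (sigma f : X -> R) (p : R).
Hypotheses (p1 : (1 < p)%R).
Hypotheses (msigma : measurable_fun setT sigma) (mf : measurable_fun setT f).
Hypotheses (sigma0 : forall x, (0 < sigma x)%R) (f0 : forall x, (0 <= f x)%R).

Let S k x := \int[mu]_(y in cell_at k x) (sigma y)%:E.
Let F k x := \int[mu]_(y in cell_at k x) (f y)%:E.

Hypothesis Sfin : forall k x, 0 < S k x < +oo.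

(** The average of [f / sigma] over the cell for the measure with density [sigma]. *)
Definition cell_average k x : \bar R := F k x / S k x.
Definition grid_maximal x : \bar R := ereal_sup (range (cell_average ^~ x)).

Let adS k x y : cell k x = cell k y -> S k x = S k y.
Proof. by move=> xy; rewrite /S (_ : cell_at k x = cell_at k y)// /cell_at xy. Qed.

Let adF k x y : cell k x = cell k y -> F k x = F k y.
Proof. by move=> xy; rewrite /F (_ : cell_at k x = cell_at k y)// /cell_at xy. Qed.

Let adA k x y : cell k x = cell k y -> cell_average k x = cell_average k y.
Proof. by move=> xy; rewrite /cell_average (adS xy) (adF xy). Qed.

Let F0 k x : 0 <= F k x.
Proof. by apply: integral_ge0 => y _; rewrite lee_fin. Qed.

Lemma cell_average_le k x : cell_average k x <= grid_maximal x.
Proof. by apply: ereal_sup_ubound; exists k. Qed.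

Lemma grid_maximal_ge0 x : 0 <= grid_maximal x.
Proof.
apply: le_trans (cell_average_le 0 x); rewrite /cell_average.
by rewrite mule_ge0// inve_ge0; have /andP[/ltW] := Sfin 0%N x.
Qed.

Lemma grid_maximal_gt l : [set x | l%:E < grid_maximal x] =
  [set x | exists k, l%:E < cell_average k x].
Proof.
apply/seteqP; split=> x /=; last by move=> [k /lt_le_trans]; apply; exact: cell_average_le.
by move=> /ereal_sup_gt[_ [k _ <-] h]; exists k.
Qed.

Lemma measurable_grid_maximal : measurable_fun setT grid_maximal.
Proof.
apply: (measurability _ (ErealGenOInfty.measurableE R)) => //.
move=> /= _ [_ [l ->]] <-; rewrite setTI.
rewrite (_ : _ @^-1` _ = [set x | l%:E < grid_maximal x]); last first.
  by apply/seteqP; split=> x /=; rewrite in_itv/= andbT.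
rewrite grid_maximal_gt; apply: (measurable_first_stop (P := fun k x => l%:E < cell_average k x)).
by move=> k x y /adA ->.
Qed.

Let mfE : measurable_fun setT (EFin \o f). Proof. exact/measurable_EFinP. Qed.
Let msE : measurable_fun setT (EFin \o sigma). Proof. exact/measurable_EFinP. Qed.

Let g x := (f x / sigma x)%R.

Let mg : measurable_fun setT g.
Proof.
apply: measurable_funM => //.
apply: (@eq_measurable_fun _ _ _ _ _ (fun x => sigma x `^ (-1))%R).
  by move=> x _; rewrite powR_inv1// ltW.
exact: (measurableT_comp (@measurable_powR R (-1)) msigma).
Qed.

Let mgl (l : R) : measurable [set x | l%:E < (g x)%:E].
Proof.
have := measurable_lte measurableT (measurable_cst l%:E) ((measurable_EFinP _ _).2 mg).
by rewrite setTI.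
Qed.

(** On a stopped cell [F > 2 l S], while the part of [f] where [f / sigma <= l] contributes at most
    [l S]. This quantity is finite and can be subtracted, so the part over [G] carries at least
    [l S]; then the maximal stopped cells are summed. *)
Let weak_type l : (0 < l)%R ->
  l%:E * \int[mu]_(x in [set x | (2 * l)%:E < grid_maximal x]) (sigma x)%:E <=
  \int[mu]_(x in [set x | l%:E < (g x)%:E]) (f x)%:E.
Proof.
move=> l0; rewrite grid_maximal_gt.
pose P k x := (2 * l)%:E < cell_average k x.
have adP k x y : cell k x = cell k y -> P k x = P k y by move=> /adA; rewrite /P => ->.
have mB := measurable_first_stop adP.
set G := [set x | l%:E < (g x)%:E]; have mG : measurable G by exact: mgl.
rewrite -[[set x | _]]/([set x | exists k, P k x]).
pose phi x := (f x * \1_G x)%:E; pose psi x := (l * sigma x)%:E.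
have mphi : measurable_fun setT phi.
  by apply/measurable_EFinP; apply: measurable_funM.
have mpsi : measurable_fun setT psi.
  by apply/measurable_EFinP; apply: measurable_funM.
have phi0 x : 0 <= phi x by rewrite lee_fin mulr_ge0.
have psi0 x : 0 <= psi x by rewrite lee_fin mulr_ge0 ?(ltW l0) ?(ltW (sigma0 x)).
rewrite -ge0_integralZl//; last 3 first.
- exact: measurable_funTS.
- by move=> x _; rewrite lee_fin ltW.
- by rewrite lee_fin ltW.
apply: (@le_trans _ _ (\int[mu]_(x in [set x | exists k, P k x]) psi x)) => //.
apply: (@le_trans _ _ (\int[mu]_(x in [set x | exists k, P k x]) phi x)).
  apply: first_stop_le => // k x.
  have /andP[S0 Sy] := Sfin k x.
  have Sf : S k x \is a fin_num by rewrite ge0_fin_numE// ltW.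
  have psiE : \int[mu]_(y in cell_at k x) psi y = l%:E * S k x.
    rewrite -ge0_integralZl//.
    - exact: measurable_cell_at.
    - exact: measurable_funTS.
    - by move=> y _; rewrite lee_fin ltW.
    - by rewrite lee_fin ltW.
  rewrite /P /cell_average => h.
  have {}h : (2 * l)%:E * S k x <= F k x.
    move: h; rewrite -[S k x]fineK// => /ltW.
    rewrite inver ifF ?lee_pdivlMr// ?gt_eqF// fine_gt0// S0.
  have : F k x <= \int[mu]_(y in cell_at k x) (phi y + psi y).
    apply: ge0_le_integral.
    - exact: measurable_cell_at.
    - by move=> y _; rewrite lee_fin.
    - exact: measurable_funTS.
    - by apply: measurable_funTS; exact: emeasurable_funD.
    - move=> y _; rewrite /phi /psi indicE -EFinD lee_fin.
      have [yG|] := boolP (y \in G).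
        by rewrite mulr1 lerDl mulr_ge0 ?(ltW l0) ?(ltW (sigma0 y)).
      rewrite mulr0 add0r /G mem_set_bool lte_fin -leNgt /g ler_pdivrMr//.
  rewrite ge0_integralD//; last 3 first.
  - exact: measurable_cell_at.
  - exact: measurable_funTS.
  - exact: measurable_funTS.
  move=> /(le_trans h); rewrite psiE -[S k x]fineK// -EFinM mulr2n mulrDl mul1r mulrDl.
  by rewrite EFinD leeD2rE.
apply: (@le_trans _ _ (\int[mu]_x phi x)).
  by apply: ge0_subset_integral.
rewrite [leRHS]integral_mkcond le_eqVlt; apply/orP; left; apply/eqP.
apply: eq_integral => x _; rewrite patchE /phi indicE.
by case: ifP => _; rewrite ?mulr1 ?mulr0.
Qed.

(** The weak-type bound is integrated against [p l ^ (p - 1)]. Its right-hand side is already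
    restricted to [f / sigma > l], so no power of the maximal function has to be absorbed or known
    to be integrable. The factor [2 ^ p] comes from the level [2 l], and [p / (p - 1)] from the two
    layer-cake weights. *)
Lemma doob_maximal :
  \int[mu]_x ((sigma x)%:E * grid_maximal x `^ p) <=
  (2 `^ p * (p / (p - 1)))%:E * \int[mu]_x (f x * (f x / sigma x) `^ (p - 1))%:E.
Proof.
have p0 : (0 < p)%R by exact: lt_trans p1.
have p10 : (0 < p - 1)%R by rewrite subr_gt0.
have mM := measurable_grid_maximal.
have mM2 : measurable_fun setT (fun x => (2^-1)%:E * grid_maximal x).
  exact: measurable_funeM.
have M20 x : 0 <= (2^-1)%:E * grid_maximal x by rewrite mule_ge0 ?grid_maximal_ge0 ?lee_fin.
have -> : \int[mu]_x ((sigma x)%:E * grid_maximal x `^ p) =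
    (2 `^ p)%:E * \int[mu]_x ((sigma x)%:E * ((2^-1)%:E * grid_maximal x) `^ p).
  rewrite -ge0_integralZl//.
  - apply: eq_integral => x _; rewrite poweRM ?grid_maximal_ge0 ?lee_fin//.
    rewrite muleCA poweR_EFin [(2 `^ p)%:E * _]muleA -EFinM -powRM//.
    by rewrite mulfV// powR1 mul1e.
  - apply: emeasurable_funM => //.
    exact: (measurableT_comp (measurable_poweR p) mM2).
  - by move=> x _; rewrite mule_ge0 ?poweR_ge0// lee_fin ltW.
rewrite EFinM -muleA lee_wpmul2l ?lee_fin ?powR_ge0//.
rewrite (layer_cake mu p0 measurableT msE mM2) => [|x _|//]; last by rewrite lee_fin ltW.
have -> : \int[mu]_x (f x * (f x / sigma x) `^ (p - 1))%:E =
    \int[mu]_x ((EFin \o f) x * (EFin \o g) x `^ (p - 1)).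
  by apply: eq_integral => x _; rewrite /= -EFinM.
have g0 x : (0 <= g x)%R by rewrite divr_ge0// ltW.
have mgE : measurable_fun setT (EFin \o g) by exact/measurable_EFinP.
rewrite (layer_cake mu p10 measurableT mfE mgE) => [|x _|x _]; [|by rewrite lee_fin|by rewrite lee_fin].
have niI (u v : X -> \bar R) : measurable_fun setT u -> measurable_fun setT v ->
    (forall x, 0 <= u x) -> measurable_fun (`]0%R, +oo[ : set (measurableTypeR R))
     (fun l : measurableTypeR R => \int[mu]_(x in setT `&` [set x | l%:E < v x]) u x).
  move=> mu_ mv u0; apply: nonincreasing_emeasurable; first exact: interval_is_interval.
  have mvl l : measurable [set x | l%:E < v x].
    by have := measurable_lte measurableT (measurable_cst l%:E) mv; rewrite setTI.
  move=> x y xy; rewrite !setTI; apply: ge0_subset_integral => //.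
  - exact: measurable_funTS.
  - by move=> z /=; apply: le_lt_trans; rewrite lee_fin.
rewrite -ge0_integralZl//; last 3 first.
- apply: emeasurable_funM; first exact: measurable_powR_deriv.
  by apply: niI => // x; rewrite lee_fin.
- move=> l _; rewrite mule_ge0//; first by rewrite lee_fin mulr_ge0 ?powR_ge0 ?(ltW p10).
  by apply: integral_ge0 => x _; rewrite lee_fin.
- by rewrite lee_fin divr_ge0 ?(ltW p0) ?(ltW p10).
apply: ge0_le_integral => //.
- move=> l _; rewrite mule_ge0//; first by rewrite lee_fin mulr_ge0 ?powR_ge0 ?(ltW p0).
  by apply: integral_ge0 => x _; rewrite lee_fin ltW.
- apply: emeasurable_funM; first exact: measurable_powR_deriv.
  by apply: niI => // x; rewrite lee_fin ltW.
- apply: measurable_funeM; apply: emeasurable_funM; first exact: measurable_powR_deriv.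
  by apply: niI => // x; rewrite lee_fin.
move=> l; rewrite /= in_itv/= andbT => l0.
rewrite !setTI muleA -EFinM mulrA divfK ?gt_eqF//.
(* One factor [l] is split off for the weak-type bound; what remains is, up to constants, the
   layer-cake weight of [(f / sigma) ^ (p - 1)]. *)
have -> : (p * l `^ (p - 1))%R = (p * l `^ (p - 1 - 1) * l)%R.
  by rewrite -mulrA [(_ * l)%R]mulrC mulr_powRB1// ltW.
rewrite [(_ * _ * l)%:E]EFinM -[leLHS]muleA lee_wpmul2l ?lee_fin ?mulr_ge0 ?powR_ge0 ?(ltW p0)//.
apply: le_trans (weak_type l0); rewrite lee_wpmul2l ?lee_fin ?(ltW l0)//.
rewrite (_ : [set x | l%:E < _] = [set x | (2 * l)%:E < grid_maximal x])//.
by apply/funext => x /=; rewrite EFinM -lte_pdivlMl.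
Qed.

End doob.

End NestedGrid.

(** * Principal cells and their sparsity *)

Section PrincipalCells.
Context {R : realType} {dX : measure_display} {X : measurableType dX} {J : countType}.
Variable mu : {sigma_finite_measure set X -> \bar R}.
Variable cell : nat -> X -> J.
Hypothesis measurable_cell : forall k j, measurable [set x | cell k x = j].
Hypothesis nested : forall k x y, cell k.+1 x = cell k.+1 y -> cell k x = cell k y.
Variables (f : X -> R) (m rho : nat -> R).
Hypotheses (mf : measurable_fun setT f) (f0 : forall x, (0 <= f x)%R).
Hypotheses (m0 : forall k, (0 < m k)%R) (rho0 : forall k, (0 < rho k)%R).
Hypothesis mE : forall k x, mu (cell_at cell k x) = (m k)%:E.
Hypothesis m_rho : forall k j, (k <= j)%N -> (m j * rho j <= m k * rho k)%R.
Hypothesis f_fin : forall k x, (\int[mu]_(y in cell_at cell k x) (f y)%:E < +oo)%E.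
Local Notation C := (cell_at cell).

(** In the application [m k] is the volume of a cell of generation [k] and [rho k] is its power
    [alpha/d - 1], so this is the fractional average of [f] over the cell. *)
Definition cell_value k x : R := rho k * fine (\int[mu]_(y in C k x) (f y)%:E)%E.

Local Notation c := cell_value.

(* The generation of the smallest principal cell around x up to generation n; a
   cell is principal when its value exceeds twice that of the previous one. *)
Fixpoint principal n x : nat :=
  if n is n'.+1 then
    if 2 * c (principal n' x) x < c n x then n else principal n' x
  else 0%N.

Let F0 k x : (0 <= \int[mu]_(y in C k x) (f y)%:E)%E.
Proof. by apply: integral_ge0 => y _; rewrite lee_fin. Qed.

Let FK k x : ((fine (\int[mu]_(y in C k x) (f y)%:E))%:E = \int[mu]_(y in C k x) (f y)%:E)%E.
Proof. by rewrite fineK// ge0_fin_numE. Qed.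

Lemma cell_value_ge0 k x : 0 <= c k x.
Proof. by rewrite mulr_ge0 ?fine_ge0// ltW. Qed.

Lemma cell_value_eq k x y : cell k x = cell k y -> c k x = c k y.
Proof. by move=> xy; rewrite /cell_value (_ : C k x = C k y)// /cell_at xy. Qed.

Lemma principal_le n x : (principal n x <= n)%N.
Proof. by elim: n => //= n ih; case: ifP => // _; exact: leqW. Qed.

(** A cell that is passed over has value at most twice that of the current principal cell, and the
    values of successive principal cells increase. *)
Lemma principal_max n x j : (j <= n)%N -> c j x <= 2 * c (principal n x) x.
Proof.
elim: n j => [|n ih] j.
  by rewrite leqn0 => /eqP ->; rewrite mulr_natl mulr2n lerDl cell_value_ge0.
rewrite leq_eqVlt => /predU1P[->|]; rewrite /=; case: ifPn => h.
- by rewrite mulr_natl mulr2n lerDl cell_value_ge0.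
- by rewrite leNgt.
- move=> /ih /le_trans; apply; apply: (le_trans (ltW h)).
  by rewrite mulr_natl mulr2n lerDl cell_value_ge0.
- exact: ih.
Qed.

Lemma principal_eq n x y : cell n x = cell n y -> principal n x = principal n y.
Proof.
elim: n => //= n ih xy; have xy' := nested xy.
rewrite ih// (cell_value_eq xy) (@cell_value_eq _ x y)//.
exact: nested_le (principal_le _ _) xy'.
Qed.

Lemma principal_idem n x : principal (principal n x) x = principal n x.
Proof. by elim: n => //= n ih; case: ifPn => //= ->. Qed.

(** The first change of principal cell after generation [k] is triggered by comparison with the
    value current at [k]. *)
Lemma principal_stop k n x : (k <= n)%N -> principal n x <> principal k x ->
  exists j, [/\ (k < j)%N, (j <= n)%N & 2 * c (principal k x) x < c j x].
Proof.
elim: n => [|n ih]; first by rewrite leqn0 => /eqP ->.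
rewrite leq_eqVlt => /predU1P[->//|]; rewrite ltnS => kn nk.
have [nk'|/eqP /(ih kn)[j [kj jn h]]] := eqVneq (principal n x) (principal k x); last first.
  by exists j; split=> //; exact: leqW.
exists n.+1; split=> //; move: nk => /=; rewrite nk'.
by case: ifP => // _; rewrite nk'.
Qed.

(** The set F_P for [P = C (principal n x) x]: the points of P around which no smaller principal
    cell appears up to generation [n]. *)
Definition principal_part n x : set X :=
  [set y | principal n y = principal n x /\ C (principal n x) x y].

Lemma measurable_principal_part n x : measurable (principal_part n x).
Proof.
apply: (measurable_saturated measurable_cell nested (n := n)) => y z yz [h1 h2]; split.
  by rewrite -(principal_eq yz).
have yz' : cell (principal n x) y = cell (principal n x) z.
  exact: nested_le (principal_le _ _) yz.
by rewrite /cell_at/= -yz'.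
Qed.

(* By Chebyshev, the descendants with value > 2c fill at most half of the cell. *)
Lemma principal_sparse n x : 0 < c (principal n x) x ->
  ((m (principal n x))%:E <= 2%:E * mu (principal_part n x))%E.
Proof.
set k := principal n x => c0; set G := principal_part n x.
have kn : (k <= n)%N by exact: principal_le.
pose P j y := [&& (k < j)%N, (j <= n)%N, cell k y == cell k x & 2 * c k x < c j y].
have adP j y z : cell j y = cell j z -> P j y = P j z.
  move=> yz; rewrite /P; have [kj|//] := ltnP k j; rewrite /=.
  by rewrite (nested_le nested (ltnW kj) yz) (cell_value_eq yz).
pose B := [set y | exists j, P j y].
have mB : measurable B by exact: (measurable_first_stop measurable_cell nested adP).
have mG : measurable G by exact: measurable_principal_part.
have mC j y : measurable (C j y) by exact: measurable_cell.
have mfE : measurable_fun setT (EFin \o f) by exact/measurable_EFinP.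
have BC : B `<=` C k x by move=> y [j /and4P[_ _ /eqP]].
have CGB : C k x `<=` G `|` B.
  move=> y yx; have [|/eqP yk] := eqVneq (principal n y) k; first by left; split.
  right; have ky : principal k y = k.
    by rewrite (principal_eq yx) /k principal_idem.
  have := @principal_stop k n y kn; rewrite ky => /(_ yk)[j [kj jn h]].
  by exists j; rewrite /P kj jn yx eqxx/= -(cell_value_eq yx).
have muB : (2%:E * mu B <= (m k)%:E)%E.
  (* On a stopped cell of generation [j], [2 c m_j] is at most [m_j rho_j] times the integral of
     [f], and [m_j rho_j <= m_k rho_k]. Over all of [B] the right-hand side is at most [m_k c], and
     [c > 0] cancels. *)
  have : (\int[mu]_(y in B) (2 * c k x)%:E <= \int[mu]_(y in B) (m k * rho k * f y)%:E)%E.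
    apply: (first_stop_le measurable_cell nested adP) => //.
    - by apply/measurable_EFinP; exact: measurable_funM.
    - by move=> y; rewrite lee_fin mulr_ge0 ?ltW.
    - by move=> y; rewrite lee_fin !mulr_ge0 ?(ltW (m0 _)) ?(ltW (rho0 _)).
    - move=> j y /and4P[kj jn /eqP yx h].
      rewrite integral_cst// [X in (_ * X)%E]mE.
      under eq_integral do rewrite EFinM.
      rewrite ge0_integralZl//; last 3 first.
      + exact: measurable_funTS.
      + by move=> z _; rewrite lee_fin.
      + by rewrite lee_fin mulr_ge0 ?ltW.
      rewrite -FK -!EFinM lee_fin.
      apply: (@le_trans _ _ (m j * rho j * fine (\int[mu]_(z in C j y) (f z)%:E)%E)).
        by rewrite mulrC -mulrA ler_wpM2l ?(ltW (m0 _))// ltW.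
      by rewrite ler_wpM2r ?fine_ge0// m_rho// ltnW.
  rewrite integral_cst//.
  under eq_integral do rewrite EFinM.
  rewrite ge0_integralZl//; last 3 first.
  - exact: measurable_funTS.
  - by move=> z _; rewrite lee_fin.
  - by rewrite lee_fin mulr_ge0 ?ltW.
  have : (\int[mu]_(y in B) (f y)%:E <= \int[mu]_(y in C k x) (f y)%:E)%E.
    apply: ge0_subset_integral => //; first exact: measurable_funTS.
    by move=> z _; rewrite lee_fin.
  move=> h1 h2; have {h1 h2} := le_trans h2 (lee_wpmul2l _ h1).
  rewrite lee_fin mulr_ge0 ?(ltW (m0 _)) ?(ltW (rho0 _))// => /(_ isT).
  rewrite -FK -EFinM -mulrA -/(c k x) [(2 * c k x)%:E]EFinM [(m k * c k x)%:E]EFinM.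
  by rewrite [leLHS]muleAC lee_pmul2r// lte_fin.
have : (mu (C k x) <= mu G + mu B)%E.
  apply: (@le_trans _ _ (mu (G `|` B))).
    by apply: le_measure; rewrite ?inE//; exact: measurableU.
  exact: measureU2.
rewrite mE => h.
have := @lee_wpmul2l _ 2%:E _ _ _ h; rewrite lee_fin => /(_ (ler0n _ 2)).
rewrite muleDr// ?ge0_adde_def ?inE//.
move=> /le_trans /(_ (leeD2l _ muB)).
by rewrite -[(2%:E * (m k)%:E)%E]EFinM mulr_natl mulr2n EFinD leeD2rE.
Qed.

End PrincipalCells.

(** * Dual mass, Hoelder inequalities and the estimate for one principal cell *)

Section PositiveIntegral.
Context {R : realType} {dX : measure_display} {X : measurableType dX}.
Variable mu : {measure set X -> \bar R}.
Local Open Scope ereal_scope.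

Lemma integral_gt0 (D : set X) (f : X -> \bar R) : measurable D -> measurable_fun D f ->
  (forall x, D x -> 0 < f x) -> 0 < mu D -> 0 < \int[mu]_(x in D) f x.
Proof.
move=> mD mf f0 muD; rewrite lt_neqAle integral_ge0 ?andbT; last by move=> x /f0/ltW.
apply/eqP => /esym I0.
have : \int[mu]_(x in D) `|f x| = 0.
  by rewrite -[RHS]I0; apply: eq_integral => x; rewrite inE => /f0/ltW/gee0_abs.
move=> /(ae_eq_integral_abs mu mD mf).1 [N [mN N0 DN]].
suff : mu D <= 0 by rewrite leNgt muD.
rewrite -N0; apply: le_measure; rewrite ?inE// => x Dx; apply: DN => /= /(_ Dx) fx0.
by have := f0 _ Dx; rewrite fx0 ltxx.
Qed.

End PositiveIntegral.

Lemma eq_implies_le {disp : Order.disp_t} {T : porderType disp} (x y : T) : x = y -> (x <= y)%O.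
Proof. by move=> ->. Qed.

Section WeightedHoelder.
Context {R : realType} {d : nat}.
Notation E := (euclid R d).
Notation mu := (@lebesgue R d).
Implicit Types (f v : E -> R) (Q G : set E).

(** W(Q) for a real-valued weight; like [dual_mass], it carries none of the powers of the volume
    present in [lorentz_cube]. *)
Definition restricted_norm (q : R) (s : \bar R) v Q : \bar R :=
  lorentz q s (fun x => (v x * \1_Q x)%:E).

Definition dual_mass (p' : R) v Q : \bar R := (\int[mu]_(x in Q) (v x `^ (- p'))%:E)%E.

Lemma measurable_EFin_indic v Q : measurable_fun setT v -> measurable Q ->
  measurable_fun setT (fun x => (v x * \1_Q x)%:E).
Proof.
by move=> mv mQ; apply/measurable_EFinP; apply: measurable_funM => //; exact: measurable_indic.
Qed.

Lemma measurable_dual (p' : R) v : measurable_fun setT v ->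
  measurable_fun setT (fun x => v x `^ (- p')).
Proof. by move=> mv; exact: (measurableT_comp (@measurable_powR R (- p')) mv). Qed.

Lemma lorentz_gt0 (q : R) (s : \bar R) (f : E -> \bar R) : 0 < q -> (q%:E <= s)%E ->
  measurable_fun setT f -> (0 < mu [set x | 0 < `|f x|])%E -> (0 < lorentz q s f)%E.
Proof.
move=> q0 qs mf; rewrite -[mu _]/(distribution f 0) -(rearrangement_gt 0)// => h.
have [l l0 lr] : exists2 l : R, 0 < l & (l%:E < rearrangement f 0)%E.
  move: h; case: (rearrangement f 0) => [r| |]//.
    by rewrite lte_fin => r0; exists (r / 2); rewrite ?divr_gt0// lte_fin ltr_pdivrMr// ltr_pMr// ltr1n.
  by move=> _; exists 1; rewrite // ltry.
have dl : (0 < distribution f l)%E by move: lr; rewrite rearrangement_gt// ltW.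
apply: lt_le_trans (lorentz_weak q0 qs mf l0).
by rewrite mule_gt0// poweR_gt0.
Qed.

Lemma lorentz0 (q : R) (s : \bar R) : 0 < q -> (q%:E <= s)%E ->
  lorentz q s (cst 0 : E -> \bar R) = 0%E.
Proof.
move=> q0 qs.
rewrite lorentzE//.
have -> : distribution (cst 0 : E -> \bar R) = fun l => if 0 <= l then 0%E else mu setT.
  apply/funext => l; rewrite /distribution; case: ifPn => l0.
    rewrite (_ : [set _ | _] = set0) ?measure0//.
    by apply/seteqP; split=> // x /=; rewrite ?normr0 lte_fin ltNge l0.
  congr (mu _); apply/seteqP; split=> // x _ /=.
  by rewrite ?normr0 lte_fin ltNge.
rewrite /lorentz_of_dist; case: s qs => [s'| |]//.
- rewrite lee_fin => qs'; have s0 : 0 < s' := lt_le_trans q0 qs'.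
  rewrite integral0_eq ?poweR0r ?gt_eqF ?invr_gt0// => l; rewrite /= in_itv/= andbT => l0.
  by rewrite (ltW l0) poweR0r ?mule0// gt_eqF// divr_gt0.
- move=> _; apply/eqP; rewrite eq_le; apply/andP; split.
    apply: ge_ereal_sup => /= _ [l + <-]; rewrite /= in_itv/= andbT => l0.
    by rewrite (ltW l0) poweR0r ?mule0// gt_eqF// invr_gt0.
  apply: ereal_sup_ubound; exists 1 => /=; first by rewrite in_itv/= ltr01.
  by rewrite ler01 poweR0r ?mule0// gt_eqF// invr_gt0.
Qed.

Lemma restricted_norm_gt0 (q : R) (s : \bar R) v Q : 0 < q -> (q%:E <= s)%E ->
  measurable_fun setT v -> (forall x, 0 < v x) -> measurable Q -> (0 < mu Q)%E ->
  (0 < restricted_norm q s v Q)%E.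
Proof.
move=> q0 qs mv v0 mQ muQ; apply: (lorentz_gt0 q0 qs (measurable_EFin_indic mv mQ)).
rewrite (_ : [set _ | _] = Q); first exact: muQ.
apply/seteqP; split=> y /=; rewrite indicE.
  by case: (boolP (y \in Q)) => [/set_mem//|_]; rewrite mulr0 normr0 ltxx.
by move=> yC; rewrite mem_set// mulr1 lte_fin normr_gt0 gt_eqF.
Qed.

Lemma dual_mass_gt0 (p' : R) v Q : measurable_fun setT v -> (forall x, 0 < v x) ->
  measurable Q -> (0 < mu Q)%E -> (0 < dual_mass p' v Q)%E.
Proof.
move=> mv v0 mQ muQ; apply: integral_gt0; [exact: mQ| | |exact: muQ].
  by apply: measurable_funTS; apply/measurable_EFinP; exact: measurable_dual.
by move=> y _; rewrite lte_fin powR_gt0.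
Qed.

Variables (p p' q : R) (s : \bar R).
Hypotheses (p1 : 1 < p) (pp' : p^-1 + p'^-1 = 1) (pq : p <= q) (qs : (q%:E <= s)%E).

Let p0 : 0 < p. Proof. exact: lt_trans p1. Qed.
Let q0 : 0 < q. Proof. exact: lt_le_trans pq. Qed.
Let p'0 : 0 < p'.
Proof. by rewrite -invr_gt0 -(addKr p^-1 p'^-1) pp' addrC subr_gt0 invf_lt1. Qed.

Let e := q^-1 + p'^-1.
Let e0 : 0 < e. Proof. by rewrite addr_gt0// invr_gt0. Qed.

(* Split at the level lambda = W U^(-1/(eq)), with U = W t^(1/p'), where both
   contributions are U^(1/e). *)
Lemma weak_hoelder v G (W t : R) : measurable_fun setT v -> (forall x, 0 < v x) ->
  measurable G -> 0 < W -> 0 < t ->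
  (restricted_norm q s v G <= W%:E)%E -> (dual_mass p' v G <= t%:E)%E ->
  (mu G <= (2 * (W * t `^ p'^-1) `^ e^-1)%:E)%E.
Proof.
move=> mv v0 mG W0 t0 hW ht.
set U := W * t `^ p'^-1; have U0 : 0 < U by rewrite mulr_gt0// powR_gt0.
pose l := W * U `^ (- (e * q)^-1).
have l0 : 0 < l by rewrite mulr_gt0// powR_gt0.
pose w x := (v x * \1_G x)%:E.
have mw : measurable_fun setT w by exact: measurable_EFin_indic.
pose A := [set x | (l%:E < `|w x|)%E].
have mA : measurable A by exact: measurable_superlevel.
have hA : (mu A <= (U `^ e^-1)%:E)%E.
  have := le_trans (lorentz_weak q0 qs mw l0) hW.
  have qV0 : 0 < q^-1 by rewrite invr_gt0.
  rewrite -lee_pdivlMl// -EFinM => /(poweR_le_root qV0 (measure_ge0 _ _)).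
  have -> : l^-1 * W = U `^ (e * q)^-1.
    by rewrite /l invfM -powRN opprK mulrAC mulVf ?gt_eqF// mul1r.
  rewrite invrK poweR_EFin -powRrM.
  by rewrite invfM -mulrA mulVf ?gt_eqF// mulr1.
pose H := G `\` A.
have mH : measurable H by exact: measurableD.
have mdual D : measurable_fun D (fun x => (v x `^ (- p'))%:E).
  by apply: measurable_funTS; apply/measurable_EFinP; exact: measurable_dual.
(* On [G] outside [A] the weight is at most [l], so [1 <= l ^ p' v ^ (- p')], and the measure is
   controlled by the dual mass. *)
have hH : (mu H <= (U `^ e^-1)%:E)%E.
  apply: (@le_trans _ _ (\int[mu]_(x in H) ((l `^ p')%:E * (v x `^ (- p'))%:E))%E).
    rewrite -[leLHS]mul1e -(integral_cst mu mH); apply: ge0_le_integral.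
    - exact: mH.
    - by move=> x _; rewrite lee_fin.
    - exact: measurable_cst.
    - exact: measurable_funeM.
    - move=> x [Gx /negP]; rewrite -leNgt /w indicE mem_set// mulr1 gee0_abs ?lee_fin ?(ltW (v0 x))//.
      move=> vl; rewrite powRN ler_pdivlMr ?powR_gt0// mul1r.
      by apply: ge0_ler_powR => //; rewrite ?nnegrE ?(ltW p'0) ?(ltW (v0 x)) ?(ltW l0).
  rewrite (@ge0_integralZl _ _ _ mu H mH _ (mdual H)); last 2 first.
  - by move=> x _; rewrite lee_fin powR_ge0.
  - by rewrite lee_fin powR_ge0.
  apply: (@le_trans _ _ ((l `^ p')%:E * t%:E)%E).
    apply: lee_wpmul2l; first by rewrite lee_fin powR_ge0.
    apply: le_trans ht; apply: ge0_subset_integral => //.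
    - by move=> x _; rewrite lee_fin powR_ge0.
    - by move=> x [].
  rewrite -EFinM lee_fin /l powRM ?powR_ge0 ?(ltW W0)//.
  have -> : W `^ p' * U `^ (- (e * q)^-1) `^ p' * t = U `^ p' * U `^ (- (e * q)^-1 * p').
    rewrite [in RHS]/U powRM ?powR_ge0 ?(ltW W0)// -!powRrM mulVf ?gt_eqF// powRr1 ?(ltW t0)//.
    by rewrite mulrAC.
  rewrite -powRD; last by rewrite (gt_eqF U0) implybT.
  apply/eq_implies_le; congr (_ `^ _); rewrite /e; field.
  by rewrite !gt_eqF// addr_gt0.
have : (mu G <= mu A + mu H)%E.
  apply: (@le_trans _ _ (mu (A `|` H))).
    apply: le_measure; rewrite ?inE//; first exact: measurableU.
    by move=> x Gx; have [Ax|nAx] := pselect (A x); [left|right].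
  exact: measureU2.
move=> /le_trans; apply; apply: (le_trans (leeD hA hH)).
by rewrite -EFinD lee_fin mulr_natl mulr2n.
Qed.

(** Hoelder's inequality for the factors [f v] and [v^-1 1_Q]. *)
Lemma hoelder_cell f v Q (N S : R) : measurable_fun setT f -> measurable_fun setT v ->
  (forall x, 0 <= f x) -> (forall x, 0 < v x) -> measurable Q -> 0 <= N -> 0 <= S ->
  (\int[mu]_x ((f x * v x) `^ p)%:E <= (N `^ p)%:E)%E -> (dual_mass p' v Q <= S%:E)%E ->
  (\int[mu]_(x in Q) (f x)%:E <= (N * S `^ p'^-1)%:E)%E.
Proof.
move=> mf mv f0 v0 mQ N0 S0 hN hS.
pose g x := v x `^ (-1) * \1_Q x.
have mg : measurable_fun setT g.
  by apply: measurable_funM; [exact: measurable_dual|exact: measurable_indic].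
have mfv : measurable_fun setT (fun x => f x * v x) by exact: measurable_funM.
have := hoelder mu mfv mg p0 p'0 pp'.
rewrite Lnorm1.
have -> : (\int[mu]_x `|(EFin \o (fun x => f x * v x) \* g)%R x|)%E = (\int[mu]_(x in Q) (f x)%:E)%E.
  rewrite [RHS]integral_mkcond; apply: eq_integral => x _.
  rewrite patchE /= /g indicE; case: ifPn => _; last by rewrite !mulr0 normr0.
  by rewrite mulr1 powR_inv1 ?(ltW (v0 x))// mulfK ?gt_eqF// ger0_norm.
move=> /le_trans; apply; rewrite EFinM; apply: lee_pmul; rewrite ?Lnorm_ge0//.
- rewrite unlock; apply: le_root_poweR; [exact: p0| |by rewrite lee_fin|].
    by apply: integral_ge0 => x _; exact: poweR_ge0.
  apply: le_trans hN; apply: eq_implies_le; apply: eq_integral => x _.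
  by rewrite /= ger0_norm// mulr_ge0// ltW.
- rewrite unlock -poweR_EFin; apply: le_poweR2; first by rewrite invr_ge0 ltW.
    by apply: integral_ge0 => x _; exact: poweR_ge0.
  apply: le_trans hS; apply: eq_implies_le; rewrite /dual_mass [RHS]integral_mkcond.
  apply: eq_integral => x _; rewrite patchE /= /g indicE; case: ifPn => _; last first.
    by rewrite mulr0 normr0 powR0// gt_eqF.
  by rewrite mulr1 ger0_norm ?powR_ge0// -powRrM mulN1r.
Qed.

(** For a principal cell P, [c] is its value, [m] its volume, [X] the integral of [f] over it, [W]
    is W(P), [S] is sigma(P), [t] is sigma(F_P), and [N] bounds the weighted norm of [f]. The 4 is
    the product of the factors 2 from sparsity and from the weak Hoelder inequality. *)
Lemma principal_cell_estimate (c m K N X S W t : R) :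
  0 < c -> 0 < m -> 0 < K -> 0 <= N -> 0 < S -> 0 < W -> 0 < t ->
  c = m `^ (- e) * X -> W * S `^ p'^-1 <= K * m `^ e ->
  m <= 4 * (W * t `^ p'^-1) `^ e^-1 -> X <= N * S `^ p'^-1 ->
  (2 * c * W) `^ q <=
    2 `^ q * 4 `^ (e * p') * K `^ (q + p') * N `^ (q - p) * ((X / S) `^ p * t).
Proof.
move=> c0 m0 K0 N0 S0 W0 t0 cE WS mt XN.
have me0 : 0 < m `^ (- e) by rewrite powR_gt0.
have X0 : 0 < X by move: c0; rewrite cE pmulr_rgt0.
have S'0 : 0 < S `^ p'^-1 by rewrite powR_gt0.
(* The A condition bounds [W S ^ (1/p')] by [K m ^ e], and [mt] bounds [m ^ e] by a multiple of
   [W t ^ (1/p')]. Cancelling [W] compares [S] with [t] at the price of [K ^ p']. *)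
have St : S <= 4 `^ (e * p') * K `^ p' * t.
  have me : m `^ e <= 4 `^ e * (W * t `^ p'^-1).
    have -> : W * t `^ p'^-1 = ((W * t `^ p'^-1) `^ e^-1) `^ e.
      by rewrite -powRrM mulVf ?gt_eqF// powRr1// mulr_ge0 ?powR_ge0// ltW.
    rewrite -powRM ?powR_ge0//; apply: ge0_ler_powR => //; rewrite ?nnegrE ?(ltW e0) ?(ltW m0)//.
    by rewrite mulr_ge0 ?powR_ge0.
  have h : S `^ p'^-1 <= K * 4 `^ e * t `^ p'^-1.
    rewrite -(ler_pM2l W0); apply: (le_trans WS).
    apply: (le_trans (ler_wpM2l (ltW K0) me)).
    by apply: eq_implies_le; ring.
  have -> : S = (S `^ p'^-1) `^ p' by rewrite -powRrM mulVf ?gt_eqF// powRr1// ltW.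
  have -> : 4 `^ (e * p') * K `^ p' * t = (K * 4 `^ e * t `^ p'^-1) `^ p'.
    rewrite !powRM ?mulr_ge0 ?powR_ge0 ?(ltW K0)// -!powRrM mulVf ?gt_eqF// powRr1 ?(ltW t0)//.
    by rewrite [K `^ p' * _]mulrC.
  by apply: ge0_ler_powR; rewrite ?nnegrE ?powR_ge0 ?mulr_ge0 ?powR_ge0 ?(ltW K0) ?(ltW p'0).
have cW : c * W <= K * (X / S `^ p'^-1).
  rewrite cE mulrA ler_pdivlMr//.
  rewrite (_ : _ * S `^ _ = m `^ (- e) * (W * S `^ p'^-1) * X); last by ring.
  by rewrite ler_pM2r// powRN ler_pdivrMl ?powR_gt0// [leRHS]mulrC.
have Y0 : 0 < X / S `^ p'^-1 by rewrite divr_gt0.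
have YN : X / S `^ p'^-1 <= N by rewrite ler_pdivrMr.
set Y := X / S `^ p'^-1 in cW Y0 YN *.
have YXS : Y `^ p = (X / S) `^ p * S.
  have -> : Y = (X / S) * S `^ p^-1.
    rewrite /Y -mulrA; congr (_ * _); rewrite -powRN -[S^-1]powR_inv1 ?(ltW S0)// -powRD.
      by rewrite -pp' opprD addrAC addNr add0r.
    by rewrite (gt_eqF S0) implybT.
  rewrite powRM ?powR_ge0 ?divr_ge0 ?(ltW X0) ?(ltW S0)// -powRrM mulVf ?gt_eqF// powRr1//.
  exact: ltW.
(* The bound [Y <= N] uses up [q - p] of the powers; the remaining [Y ^ p] equals [(X / S) ^ p S],
   the form that Doob's inequality can sum. *)
have Yq : Y `^ q <= N `^ (q - p) * ((X / S) `^ p * S).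
  have -> : Y `^ q = Y `^ (q - p) * Y `^ p.
    by rewrite -powRD ?subrK// (gt_eqF Y0) implybT.
  rewrite -YXS.
  apply: ler_wpM2r; first exact: powR_ge0.
  by apply: ge0_ler_powR; rewrite ?nnegrE ?subr_ge0 ?(ltW Y0).
apply: (@le_trans _ _ (2 `^ q * K `^ q * Y `^ q)).
  rewrite -!powRM ?mulr_ge0 ?(ltW K0) ?(ltW X0) ?invr_ge0 ?(ltW S'0)//.
  apply: ge0_ler_powR; rewrite ?nnegrE ?(ltW q0) ?mulr_ge0 ?(ltW c0) ?(ltW W0) ?(ltW K0) ?(ltW X0) ?invr_ge0 ?(ltW S'0)//.
  by rewrite -!mulrA ler_pM2l.
apply: (le_trans (ler_wpM2l _ Yq)); first by rewrite mulr_ge0 ?powR_ge0.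
have -> : K `^ (q + p') = K `^ q * K `^ p' by rewrite powRD ?(gt_eqF K0) ?implybT.
have := ler_wpM2l (_ : 0 <= 2 `^ q * K `^ q * N `^ (q - p) * (X / S) `^ p) St.
rewrite !mulr_ge0 ?powR_ge0// => /(_ isT) h.
have -> : 2 `^ q * K `^ q * (N `^ (q - p) * ((X / S) `^ p * S)) =
   2 `^ q * K `^ q * N `^ (q - p) * (X / S) `^ p * S by ring.
by apply: (le_trans h); apply: eq_implies_le; ring.
Qed.

End WeightedHoelder.

(** * The bound in a single grid *)

Section DyadicBound.
Context {R : realType} {d : nat} {J : countType}.
Notation E := (euclid R d).
Notation mu := (@lebesgue R d).
Definition lebesgue_sfinite : {sigma_finite_measure set E -> \bar R} := mu.
Local Notation smu := lebesgue_sfinite.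
Variable cell : nat -> E -> J.
Hypothesis measurable_cell : forall k j, measurable [set x | cell k x = j].
Hypothesis nested : forall k x y, cell k.+1 x = cell k.+1 y -> cell k x = cell k y.
Variables (p p' q : R) (s : \bar R).
Hypotheses (p1 : 1 < p) (pp' : p^-1 + p'^-1 = 1) (pq : p <= q) (qs : (q%:E <= s)%E).
Variables (m : nat -> R) (v f : E -> R) (K N : R).
Hypotheses (m0 : forall k, 0 < m k) (m_ni : forall k j, (k <= j)%N -> m j <= m k).
Hypothesis mE : forall k x, mu (cell_at cell k x) = (m k)%:E.
Hypotheses (mv : measurable_fun setT v) (v0 : forall x, 0 < v x).
Hypotheses (mf : measurable_fun setT f) (f0 : forall x, 0 <= f x).
Hypotheses (K0 : 0 < K) (N0 : 0 <= N).

Local Notation C := (cell_at cell).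
Local Notation W k x := (restricted_norm q s v (C k x)).
Local Notation S k x := (dual_mass p' v (C k x)).

Hypothesis A_cell : forall k x,
  (W k x * S k x `^ p'^-1 <= (K * m k `^ (q^-1 + p'^-1))%:E)%E.
Hypothesis fN : (\int[mu]_x ((f x * v x) `^ p)%:E <= (N `^ p)%:E)%E.

Let p0 : 0 < p. Proof. exact: lt_trans p1. Qed.
Let q0 : 0 < q. Proof. exact: lt_le_trans pq. Qed.
Let p'0 : 0 < p'.
Proof. by rewrite -invr_gt0 -(addKr p^-1 p'^-1) pp' addrC subr_gt0 invf_lt1. Qed.

Let e := q^-1 + p'^-1.
Let e0 : 0 < e. Proof. by rewrite addr_gt0// invr_gt0. Qed.
Let e1 : e <= 1. Proof. by rewrite -pp' lerD2r lef_pV2. Qed.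

Let rho k := m k `^ (- e).
Let rho0 k : 0 < rho k. Proof. by rewrite powR_gt0. Qed.

(** The product is [m ^ (1 - e)], and [e <= 1] because [p <= q]. *)
Let m_rho k j : (k <= j)%N -> m j * rho j <= m k * rho k.
Proof.
move=> kj; have H i : m i * rho i = m i `^ (1 - e).
  by rewrite powRD ?(gt_eqF (m0 _)) ?implybT// powRr1// ltW.
by rewrite !H; apply: ge0_ler_powR; rewrite ?nnegrE ?subr_ge0 ?(ltW (m0 _)) ?m_ni.
Qed.

Let mC k x : measurable (C k x). Proof. exact: measurable_cell. Qed.

Let sigma x := v x `^ (- p').
Let msigma : measurable_fun setT sigma. Proof. exact: measurable_dual. Qed.
Let sigma0 x : 0 < sigma x. Proof. by rewrite powR_gt0. Qed.
Let msE D : measurable_fun D (EFin \o sigma).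
Proof. by apply: measurable_funTS; exact/measurable_EFinP. Qed.

Let mw Q : measurable Q -> measurable_fun setT (fun x => (v x * \1_Q x)%:E).
Proof. exact: measurable_EFin_indic. Qed.

Let muC_gt0 k x : (0 < mu (C k x))%E. Proof. by rewrite mE lte_fin. Qed.

Let S_gt0 k x : (0 < S k x)%E.
Proof. exact: (dual_mass_gt0 p' mv v0 (mC k x) (muC_gt0 k x)). Qed.

Let W_gt0 k x : (0 < W k x)%E.
Proof. exact: (restricted_norm_gt0 q0 qs mv v0 (mC k x) (muC_gt0 k x)). Qed.

(** An infinite factor would make the product in [A_cell] infinite, the other factor being
    positive. *)
Let S_fin k x : (S k x < +oo)%E.
Proof.
rewrite ltey; apply/eqP => Sy; have := A_cell k x.
by rewrite Sy poweRyr ?gt0_muley ?leye_eq// gt_eqF// invr_gt0.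
Qed.

Let W_fin k x : (W k x < +oo)%E.
Proof.
rewrite ltey; apply/eqP => Wy; have := A_cell k x.
by rewrite Wy gt0_mulye ?leye_eq// poweR_gt0.
Qed.

Let fin_S k x : (fine (S k x))%:E = S k x.
Proof. by rewrite fineK// ge0_fin_numE// ltW. Qed.

Let fin_W k x : (fine (W k x))%:E = W k x.
Proof. by rewrite fineK// ge0_fin_numE// ltW. Qed.

Let F_le k x : (\int[mu]_(y in C k x) (f y)%:E <= (N * fine (S k x) `^ p'^-1)%:E)%E.
Proof.
apply: (hoelder_cell p1 pp' mf mv f0 v0 (mC k x) N0 _ fN).
- exact: fine_ge0 (ltW (S_gt0 _ _)).
- by rewrite fin_S.
Qed.

Lemma cell_integral_lty k x : (\int[mu]_(y in C k x) (f y)%:E < +oo)%E.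
Proof. exact: le_lt_trans (F_le k x) (ltry _). Qed.

Local Notation c := (cell_value smu cell f rho).
Local Notation tau := (principal smu cell f rho).

Definition principal_value n y : R := 2 * c (tau n y) y.

Lemma measurable_principal_value n : measurable_fun setT (principal_value n).
Proof.
move=> _ Y mY; rewrite setTI; apply: (measurable_saturated measurable_cell nested (n := n)).
move=> x y xy; rewrite /= /principal_value (principal_eq smu nested f rho xy).
rewrite (cell_value_eq smu f rho (y := y))//.
exact: (nested_le nested (principal_le smu cell f rho n y) xy).
Qed.

Let mhv n : measurable_fun setT (fun y => principal_value n y * v y).
Proof. by apply: measurable_funM => //; exact: measurable_principal_value. Qed.

(** Points with the same code form one principal part, so the principal parts are a countable
    partition of the space. *)
Let L n y := pickle (tau n y, cell (tau n y) y).

Let fiberE n x : [set: E] `&` L n @^-1` [set L n x] = principal_part smu cell f rho n x.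
Proof.
rewrite setTI; apply/seteqP; split=> y /=.
  by move=> /(pcan_inj pickleK)[h1 h2]; split=> //; rewrite /cell_at/= -h2 h1.
by move=> [h1 h2]; rewrite /L h1 h2.
Qed.

Let mfiber n j : measurable ([set: E] `&` L n @^-1` [set j]).
Proof.
have [->//|/set0P[x [_ <-]]] := eqVneq ([set: E] `&` L n @^-1` [set j]) set0.
by rewrite fiberE; exact: measurable_principal_part.
Qed.

Local Notation M := (grid_maximal smu cell sigma f).

Let B := 2 `^ q * 4 `^ (e * p') * K `^ (q + p') * N `^ (q - p).

(** On a principal part the function is [2 c v], of norm at most [2 c W(P)], to which
    [principal_cell_estimate] applies. The ratio [X / S] is the sigma-average over P, hence at most
    [M] at every point of the part. *)
Let fiber_le n j :
  (lorentz q s (fun y => (principal_value n y * v y * \1_([set: E] `&` L n @^-1` [set j]) y)%:E) `^ q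
   <= B%:E * \int[mu]_(y in [set: E] `&` L n @^-1` [set j]) ((sigma y)%:E * M y `^ p))%E.
Proof.
have B0 : 0 <= B by rewrite !mulr_ge0 ?powR_ge0.
have M0 x : (0 <= M x)%E.
  by apply: (grid_maximal_ge0 (mu := smu) f0) => k y; rewrite S_gt0 S_fin.
have rhs0 (D : set E) : (0 <= B%:E * \int[mu]_(y in D) ((sigma y)%:E * M y `^ p))%E.
  rewrite mule_ge0//; apply: integral_ge0 => y _.
  by rewrite mule_ge0 ?poweR_ge0// lee_fin ltW.
have zero (D : set E) : (forall y, D y -> principal_value n y = 0) ->
    lorentz q s (fun y => (principal_value n y * v y * \1_D y)%:E) = 0%E.
  move=> h; rewrite -[RHS](lorentz0 (d := d) q0 qs); congr lorentz; apply/funext => y /=.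
  rewrite indicE; case: (boolP ((y : E) \in D)) => [/set_mem/h ->|_]; last by rewrite mulr0.
  by rewrite !mul0r.
have [->|/set0P[x [_ xj]]] := eqVneq ([set: E] `&` L n @^-1` [set j]) set0.
  by rewrite zero// poweR0r ?gt_eqF.
rewrite -xj fiberE; set G := principal_part _ _ _ _ _ _; set k := tau n x.
have mG : measurable G by exact: measurable_principal_part.
have GC : G `<=` C k x by move=> y [_].
have Gc y : G y -> principal_value n y = 2 * c k x.
  by move=> [yk yx]; rewrite /principal_value yk (cell_value_eq smu f rho yx).
(* A cell of value 0 contributes nothing and is treated apart, since sparsity was obtained by
   dividing by the value. *)
have := cell_value_ge0 smu cell f0 rho0 k x; rewrite le_eqVlt => /predU1P[c0|c0].
  by rewrite zero ?poweR0r ?gt_eqF// => y Gy; rewrite Gc// -c0 mulr0.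
have mG2 : ((m k)%:E <= 2%:E * mu G)%E.
  exact: (principal_sparse (mu := smu) measurable_cell nested mf f0 m0 rho0 mE m_rho cell_integral_lty).
pose t := dual_mass p' v G.
have muG0 : (0 < mu G)%E.
  rewrite lt_neqAle measure_ge0 andbT; apply/eqP => h; move: mG2.
  by rewrite -h mule0 lee_fin leNgt m0.
have t0 : (0 < t)%E.
  by apply: integral_gt0; [exact: mG|exact: msE|move=> y _; rewrite lte_fin sigma0|exact: muG0].
have tS : (t <= S k x)%E.
  apply: ge0_subset_integral; [exact: mG|exact: mC|exact: msE| |exact: GC].
  by move=> y _; rewrite lee_fin ltW ?sigma0.
have tfin : t = (fine t)%:E by rewrite fineK// ge0_fin_numE ?ltW// (le_lt_trans tS).
have Wr0 : 0 < fine (W k x) by rewrite fine_gt0// W_gt0 W_fin.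
have Sr0 : 0 < fine (S k x) by rewrite fine_gt0// S_gt0 S_fin.
have tr0 : 0 < fine t by rewrite fine_gt0// t0 (le_lt_trans tS).
have GW : (restricted_norm q s v G <= (fine (W k x))%:E)%E.
  rewrite fin_W; apply: (lorentz_le q0 qs (mw mG) (mw (mC k x))) => y.
  rewrite lee_fin !normrM ler_wpM2l// !indicE.
  case: (boolP (y \in G)) => [yG|_]; last by rewrite normr0.
  by rewrite mem_set//; apply: GC; exact: set_mem.
have tt : (dual_mass p' v G <= (fine t)%:E)%E by rewrite -tfin.
have muG := weak_hoelder p1 pp' pq qs mv v0 mG Wr0 tr0 GW tt.
have mk4 : m k <= 4 * (fine (W k x) * fine t `^ p'^-1) `^ e^-1.
  have := le_trans mG2 (lee_wpmul2l _ muG); rewrite -EFinM !lee_fin mulrA => /(_ (ler0n _ 2)).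
  by rewrite -natrM.
set X := (\int[mu]_(y in C k x) (f y)%:E)%E.
have X0 : (0 <= X)%E by apply: integral_ge0 => y _; rewrite lee_fin f0.
have XK : (fine X)%:E = X.
  by apply: fineK; rewrite (ge0_fin_numE X0); exact: cell_integral_lty.
have XN : fine X <= N * fine (S k x) `^ p'^-1.
  by rewrite -lee_fin XK; exact: F_le.
have AK : fine (W k x) * fine (S k x) `^ p'^-1 <= K * m k `^ e.
  by rewrite -lee_fin EFinM -poweR_EFin fin_W fin_S; exact: A_cell.
have est := principal_cell_estimate p1 pp' pq c0 (m0 k) K0 N0 Sr0 Wr0 tr0 erefl AK mk4 XN.
apply: (@le_trans _ _ ((2 * c k x * fine (W k x)) `^ q)%:E).
  rewrite -poweR_EFin; apply: le_poweR2; first exact: ltW.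
    exact: (lorentz_ge0 q0 qs (measurable_EFin_indic (mhv n) mG)).
  have c20 : 0 < 2 * c k x by rewrite mulr_gt0.
  have mcw : measurable_fun setT (fun y => (2 * c k x)%:E * (v y * \1_(C k x) y)%:E)%E.
    exact: measurable_funeM (mw (mC k x)).
  rewrite EFinM fin_W; apply: le_trans (lorentzZ_le q0 qs c20 (mw (mC k x))).
  apply: (lorentz_le q0 qs (measurable_EFin_indic (mhv n) mG) mcw) => y.
  rewrite -EFinM lee_fin !indicE.
  case: (boolP (y \in G)) => [yG|_]; last by rewrite mulr0 normr0.
  have yC : y \in C k x by apply: mem_set; apply: GC; exact: set_mem.
  by rewrite (Gc y (set_mem yG)) yC !mulr1.
apply: (@le_trans _ _ (B * ((fine X / fine (S k x)) `^ p * fine t))%:E); first by rewrite lee_fin.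
rewrite EFinM lee_wpmul2l ?lee_fin//.
rewrite EFinM -tfin /t /dual_mass -(@ge0_integralZl _ _ _ mu G mG _ (@msE G)); last 2 first.
- by move=> y _; rewrite lee_fin ltW ?sigma0.
- by rewrite lee_fin powR_ge0.
have mM : measurable_fun setT M.
  exact: (measurable_grid_maximal smu measurable_cell nested).
apply: ge0_le_integral.
- exact: mG.
- by move=> y _; rewrite mule_ge0 ?lee_fin ?powR_ge0.
- by apply: measurable_funeM; exact: msE.
- apply: emeasurable_funM; first exact: msE.
  by apply: measurable_funTS; exact: (measurableT_comp (measurable_poweR p) mM).
- move=> y Gy; rewrite muleC; apply: lee_wpmul2l; first by rewrite lee_fin ltW ?sigma0.
  rewrite -poweR_EFin; apply: le_poweR2; first exact: ltW.
    by rewrite lee_fin; apply: divr_ge0; [exact: fine_ge0|exact: ltW Sr0].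
  apply: le_trans (cell_average_le smu cell sigma f k y).
  rewrite /cell_average (cell_at_eq (GC _ Gy)) EFinM XK -/X.
  rewrite -[X in (_ <= _ * X^-1)%E]/(S k x) -[in leRHS]fin_S inver gt_eqF//.
Qed.

(** The upper q-estimate over the principal parts, followed by Doob. The q-th root turns
    [K ^ (q + p')] into [K ^ (1 + p' / q)] and [N ^ (q - p) N ^ p] into [N]. The bound does not
    depend on [n], which permits a limit later. *)
Lemma dyadic_bound n :
  (lorentz q s (fun y => (principal_value n y * v y)%:E) <=
    ((2 `^ q * 4 `^ (e * p') * (2 `^ p * (p / (p - 1)))) `^ q^-1 * K `^ (1 + p' / q) * N)%:E)%E.
Proof.
have B0 : 0 <= B by rewrite !mulr_ge0 ?powR_ge0.
have p10 : 0 < p - 1 by rewrite subr_gt0.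
have mM : measurable_fun setT M.
  exact: (measurable_grid_maximal smu measurable_cell nested).
have mhvE : measurable_fun setT (fun y => (principal_value n y * v y)%:E).
  by apply/measurable_EFinP.
have mF j : measurable_fun setT
   (fun y => (principal_value n y * v y * \1_([set: E] `&` L n @^-1` [set j]) y)%:E).
  exact: measurable_EFin_indic (mhv n) (mfiber n j).
have mMs : measurable_fun setT (fun y => (sigma y)%:E * M y `^ p)%E.
  apply: emeasurable_funM; first exact: msE.
  exact: (measurableT_comp (measurable_poweR p) mM).
have Ms0 y : (0 <= (sigma y)%:E * M y `^ p)%E by rewrite mule_ge0 ?poweR_ge0// lee_fin ltW.
have H : (lorentz q s (fun y => (principal_value n y * v y)%:E) `^ q <=
    B%:E * \int[mu]_y ((sigma y)%:E * M y `^ p))%E.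
  rewrite (integral_fibers smu (mfiber n) mMs)//.
  apply: (le_trans (lorentz_sup_sum q0 qs mhvE mF _)).
    move=> x l l0 lx; exists (L n x).
    by rewrite indicE mem_set ?mulr1.
  rewrite -nneseriesZl; last by move=> j _; exact: integral_ge0.
  apply: lee_nneseries => [j *|j _]; first exact: poweR_ge0.
  exact: fiber_le.
have Sok k x : (0 < \int[mu]_(y in C k x) (sigma y)%:E < +oo)%E by rewrite S_gt0 S_fin.
have D := doob_maximal (mu := smu) measurable_cell nested p1 msigma mf sigma0 f0 Sok.
(* With [sigma = v ^ (- p')] the integrand is [(f v) ^ p], because [p' (p - 1) = p]. *)
have I1 : (\int[mu]_x (f x * (f x / sigma x) `^ (p - 1))%:E <= (N `^ p)%:E)%E.
  apply: le_trans fN; apply: eq_implies_le; apply: eq_integral => x _; congr _%:E.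
  have vx := v0 x.
  rewrite -[_ / _](_ : f x * v x `^ p' = _); last by rewrite /sigma powRN invrK.
  rewrite !powRM ?powR_ge0 ?(ltW vx)// mulrA mulr_powRB1// -powRrM; congr (_ * _ `^ _).
  rewrite mulrBr mulr1; have -> : p' = p / (p - 1).
    have p'E : p'^-1 = 1 - p^-1 by apply/eqP; rewrite eq_sym subr_eq addrC pp'.
    by rewrite -[p']invrK p'E; field; rewrite !gt_eqF.
  by field; rewrite !gt_eqF.
set A := 2 `^ q * _ * _.
have A0 : 0 <= A by rewrite !mulr_ge0 ?powR_ge0// ?invr_ge0 ltW.
set Z := A `^ q^-1 * _ * _.
have Z0 : 0 <= Z by rewrite !mulr_ge0 ?powR_ge0.
have ZE : Z `^ q = B * (2 `^ p * (p / (p - 1)) * N `^ p).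
  have qn0 := lt0r_neq0 q0.
  rewrite /Z (powRM q (mulr_ge0 (powR_ge0 _ _) (powR_ge0 _ _)) N0).
  rewrite (powRM q (powR_ge0 _ _) (powR_ge0 _ _)) -!powRrM (mulVf qn0) (powRr1 A0).
  have -> : (1 + p' / q) * q = q + p' by rewrite mulrDl mul1r (divfK qn0).
  have -> : N `^ q = N `^ (q - p) * N `^ p by rewrite -powRD subrK// (negbTE qn0).
  by rewrite /A /B; ring.
rewrite -[Z](_ : (Z `^ q) `^ q^-1 = _); last by rewrite -powRrM mulfV ?gt_eqF// powRr1.
rewrite -poweR_EFin; apply: poweR_le_root => //; first exact: lorentz_ge0.
apply: (le_trans H); rewrite ZE [(B * _)%:E]EFinM; apply: lee_wpmul2l; first by rewrite lee_fin.
apply: (le_trans D); rewrite [(_ * N `^ p)%:E]EFinM; apply: lee_wpmul2l; last exact: I1.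
rewrite lee_fin.
by rewrite !mulr_ge0 ?powR_ge0// ?invr_ge0 ltW.
Qed.

End DyadicBound.

(** * Volumes of products, shifted grids and the one-third trick *)

Section ProductVolume.
Context {R : realType}.

(** Products of arbitrary sets, since grid cells are half-open and hence not of the form [box]. *)
Definition product_set n (A : 'I_n -> set (measurableTypeR R)) :
    set (n.-tuple (measurableTypeR R)) :=
  [set t | forall i, A i (tnth t i)].

Lemma product_set_cons n (A : 'I_n.+1 -> set (measurableTypeR R)) : product_set A =
  [set t | A ord0 (thead t) /\ product_set (A \o lift ord0) [tuple of behead t]].
Proof.
have tS (t : n.+1.-tuple (measurableTypeR R)) j :
    tnth t (lift ord0 j) = tnth [tuple of behead t] j.
  by rewrite {1}(tuple_eta t) tnthS.
apply/seteqP; split=> t /=.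
  by move=> ht; split; [exact: ht|move=> i; rewrite -tS; exact: ht].
move=> -[h0 h] i; case: (unliftP ord0 i) => [j ->|->//].
by rewrite tS; exact: h.
Qed.

Lemma measurable_product_set n (A : 'I_n -> set (measurableTypeR R)) :
  (forall i, measurable (A i)) -> measurable (product_set A).
Proof.
move=> mA; rewrite (_ : product_set A = \bigcap_(i in [set: 'I_n])
    [set t | A i (tnth t i)]); last first.
  by apply/seteqP; split=> t /= h i; [move=> _; exact: h|exact: h i Logic.I].
apply: fin_bigcap_measurable => // i _.
rewrite -[X in measurable X]setTI.
by apply: (@measurable_tnth _ (measurableTypeR R) n i).
Qed.

Lemma borel_lebesgue_product n (A : 'I_n -> set (measurableTypeR R)) (r : 'I_n -> R) :
  (forall i, measurable (A i)) -> (forall i, lebesgue_measure (A i) = (r i)%:E) ->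
  borel_lebesgue n (product_set A) = (\prod_(i < n) r i)%:E.
Proof.
elim: n A r => [|n ih] A r mA Ar.
  rewrite big_ord0 /= diracE mem_set//.
  by case.
rewrite product_set_cons [LHS](@cons_measureE R n (borel_lebesgue n)
  (A ord0) (product_set (A \o lift ord0))); last 2 first.
- exact: mA.
- by apply: measurable_product_set => i; exact: mA.
rewrite (ih _ (r \o lift ord0)); last 2 first.
- by move=> i; exact: mA.
- by move=> i; exact: Ar.
by rewrite big_ord_recl /= EFinM Ar.
Qed.

Lemma lebesgue_product d (A : 'I_d -> set (measurableTypeR R)) (r : 'I_d -> R) :
  (forall i, measurable (A i)) -> (forall i, lebesgue_measure (A i) = (r i)%:E) ->
  lebesgue (product_set A : set (euclid R d)) = (\prod_(i < d) r i)%:E.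
Proof.
move=> mA Ar; rewrite /lebesgue /completed_measure_extension.
rewrite measurable_mu_extE; last exact: measurable_product_set.
exact: borel_lebesgue_product.
Qed.

Lemma measurable_euclid_product d (A : 'I_d -> set (measurableTypeR R)) :
  (forall i, measurable (A i)) -> measurable (product_set A : set (euclid R d)).
Proof.
move=> mA; apply: caratheodory_measurable_mu_ext; exact: measurable_product_set.
Qed.

End ProductVolume.

Section FloorFacts.
Context {R : realType}.
Implicit Types x y : R.

(** [floor x] is the integer part of half of [floor (2 x)]; this is what nests the generations of a
    grid. *)
Lemma floor_double_eq x y : Num.floor (2 * x) = Num.floor (2 * y) ->
  Num.floor x = Num.floor y.
Proof.
move=> xy; apply/esym/floor_def.
have /andP[h1 h2] := floor_itv x.
have /andP[k1 k2] := floor_itv (2 * y); rewrite -xy in k1 k2.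
set n := Num.floor x in h1 h2 *.
have a1 : (2 * n <= Num.floor (2 * x))%R by rewrite floor_ge_int intrM ler_pM2l.
have a2 : (Num.floor (2 * x) + 1 <= 2 * (n + 1))%R.
  rewrite lezD1 -(ltr_int R) intrM.
  by apply: (le_lt_trans (floor_le _)); rewrite ltr_pM2l.
have A1 : (2 * n)%:~R <= (Num.floor (2 * x))%:~R :> R by rewrite ler_int.
have A2 : (Num.floor (2 * x) + 1)%:~R <= (2 * (n + 1))%:~R :> R by rewrite ler_int.
rewrite intrM in A1; rewrite [leRHS]intrM in A2; rewrite !intrD in A2 k2 *.
by apply/andP; split; lra.
Qed.

Let floor_neq_le x y : x <= y -> Num.floor x <> Num.floor y ->
  x < (Num.floor y)%:~R <= y.
Proof.
move=> xy /eqP n; rewrite floor_le andbT; apply: (lt_le_trans (floorD1_gt x)).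
by rewrite ler_int lezD1 lt_neqAle n/=; exact: le_floor.
Qed.

(* Two grids of mesh 1 whose offset is 2^k/3 modulo 1 cannot both separate
   the endpoints of an interval of length at most 1/3. *)
Lemma one_third_trick (k : nat) x y : x <= y -> y <= x + 3^-1 ->
  Num.floor x = Num.floor y \/ Num.floor (x - 2 ^+ k / 3) = Num.floor (y - 2 ^+ k / 3).
Proof.
move=> xy yx; apply: contrapT => /not_orP[h1 h2].
have /andP[a1 a2] := floor_neq_le xy h1.
have xy' : x - 2 ^+ k / 3 <= y - 2 ^+ k / 3 by rewrite lerD2r.
have /andP[b1 b2] := floor_neq_le xy' h2.
set m := Num.floor y in a1 a2; set m' := Num.floor _ in b1 b2.
(* If both grids separate, [m] and [m' + 2 ^ k / 3] lie in the half-open interval from [x] to [y],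
   so they differ by less than 1/3. The integer [3 (m - m') - 2 ^ k] is then 0, but 3 does not
   divide a power of 2. *)
have : `|3 * (m - m') - 2 ^+ k| < 1.
  rewrite -(ltr_int R) intr_norm intrB intrM intrB rmorphXn/= ltr_norml.
  by apply/andP; split; lra.
have nz (z : int) : `|z| < 1 -> z = 0.
  by move=> z1; apply/eqP; rewrite -normr_le0 -ltzD1 add0r.
move=> /nz /eqP; rewrite subr_eq0 => /eqP e.
have : (3 %| 2 ^ k)%N.
  apply/dvdnP; exists `|m - m'|%N; have /(congr1 absz) := e.
  by rewrite abszM abszX mulnC => <-.
by rewrite Euclid_dvdX.
Qed.

End FloorFacts.

Section DyadicGrid.
Context {R : realType} {d : nat}.
Notation E := (euclid R d).
Notation mu := (@lebesgue R d).

Section translated.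
Variables (L : R) (b : 'I_d -> R).
Hypothesis L0 : 0 < L.

Definition grid_side (k : nat) : R := L / 2 ^+ k.

Definition grid_cell (k : nat) (x : E) : {ffun 'I_d -> int} :=
  [ffun i => Num.floor ((Defs.coord x i - b i) / grid_side k)].

Lemma grid_side_gt0 k : 0 < grid_side k.
Proof. by rewrite divr_gt0// exprn_gt0. Qed.

Lemma grid_side_ni k j : (k <= j)%N -> grid_side j <= grid_side k.
Proof.
by move=> kj; rewrite ler_pM2l// lef_pV2 ?posrE ?exprn_gt0// ler_weXn2l// ler1n.
Qed.

Lemma grid_nested k (x y : E) :
  grid_cell k.+1 x = grid_cell k.+1 y -> grid_cell k x = grid_cell k y.
Proof.
move=> /ffunP xy; apply/ffunP => i; have := xy i; rewrite !ffunE.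
have H (t : R) : t / grid_side k.+1 = 2 * (t / grid_side k).
  rewrite /grid_side exprS; field.
  by rewrite !gt_eqF// exprn_gt0.
by rewrite !H; exact: floor_double_eq.
Qed.

Lemma grid_cellE k (j : {ffun 'I_d -> int}) : [set x | grid_cell k x = j] =
  product_set (fun i => `[b i + (j i)%:~R * grid_side k,
                          b i + (j i + 1)%:~R * grid_side k[%classic : set (measurableTypeR R)).
Proof.
have s0 := grid_side_gt0 k.
have H (t c : R) (z : int) : (Num.floor ((t - c) / grid_side k) == z) =
    (c + z%:~R * grid_side k <= t < c + (z + 1)%:~R * grid_side k).
  by rewrite floor_eq ler_pdivlMr// ltr_pdivrMr// lerBrDl ltrBlDl.
apply/seteqP; split=> x /= => [xj i|h].
  by rewrite /= in_itv/= -H -xj ffunE.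
apply/ffunP => i; rewrite ffunE; apply/eqP; rewrite H.
by have := h i; rewrite /= in_itv.
Qed.

Lemma measurable_grid_cell k j : measurable [set x : E | grid_cell k x = j].
Proof. by rewrite grid_cellE; apply: measurable_euclid_product => i; exact: measurable_itv. Qed.

Lemma lebesgue_grid_cell k x : mu (cell_at grid_cell k x) = (grid_side k ^+ d)%:E.
Proof.
rewrite /cell_at grid_cellE (@lebesgue_product _ _ _ (fun=> grid_side k)).
- by rewrite prodr_const card_ord.
- by move=> i; exact: measurable_itv.
- move=> i; rewrite lebesgue_measure_itv/= lte_fin ltrD2l ltr_pM2r ?grid_side_gt0//.
  rewrite ltr_int ltrDl ltr01 -EFinB; congr _%:E.
  by rewrite intrD; ring.
Qed.

Lemma grid_cell_sub_cube k x : exists c : E, cell_at grid_cell k x `<=` cube c (grid_side k).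
Proof.
exists [tuple b i + (grid_cell k x i)%:~R * grid_side k | i < d] => y.
rewrite /cell_at grid_cellE => h i; have := h i.
rewrite /Defs.coord /= in_itv/= tnth_mktuple => /andP[-> /ltW h2]; apply: (le_trans h2).
by rewrite intrD mulrDl mul1r addrA.
Qed.

End translated.

(** Measured in sides [L / 2 ^ k] the shift is [2 ^ k / 3], which is 1/3 or 2/3 modulo 1; one
    translation thus serves every generation. *)
Definition third_shift (L : R) (beta : {ffun 'I_d -> bool}) (i : 'I_d) : R :=
  if beta i then L / 3 else 0.

(** Coordinates are handled separately: the unshifted grid is kept where it does not separate the
    endpoints of the cube, and the shifted one is taken elsewhere. After division by the side,
    [3 l <= grid_side L k] is the length bound 1/3 of the one-third trick. *)
Lemma cube_sub_grid_cell (L : R) k (c : E) (l : R) : 0 < L -> 0 < l ->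
  3 * l <= grid_side L k ->
  exists beta, forall x y : E, cube c l x -> cube c l y ->
    grid_cell L (third_shift L beta) k x = grid_cell L (third_shift L beta) k y.
Proof.
move=> L0 l0 lk; set g := grid_side L k in lk.
have g0 : 0 < g by exact: grid_side_gt0.
pose F t := Num.floor (t / g).
exists [ffun i => F (Defs.coord c i) != F (Defs.coord c i + l)] => x y cx cy.
apply/ffunP => i; rewrite !ffunE /third_shift ffunE -/g.
have H a t : Num.floor ((Defs.coord c i - a) / g) = Num.floor ((Defs.coord c i + l - a) / g) ->
    Defs.coord c i <= t <= Defs.coord c i + l ->
    Num.floor ((t - a) / g) = Num.floor ((Defs.coord c i - a) / g).
  move=> e /andP[t1 t2]; apply/eqP; rewrite eq_le; apply/andP; split.
    by rewrite e; apply: le_floor; rewrite ler_pM2r ?invr_gt0// lerD2r.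
  by apply: le_floor; rewrite ler_pM2r ?invr_gt0// lerD2r.
suff e : Num.floor ((Defs.coord c i - (if F (Defs.coord c i) != F (Defs.coord c i + l) then L / 3 else 0)) / g) =
    Num.floor ((Defs.coord c i + l - (if F (Defs.coord c i) != F (Defs.coord c i + l) then L / 3 else 0)) / g).
  by rewrite (H _ _ e (cx i)) (H _ _ e (cy i)).
case: ifPn => [|/negPn/eqP e]; last by rewrite !subr0.
have gE t : (t - L / 3) / g = t / g - 2 ^+ k / 3.
  rewrite /g /grid_side; field.
  by rewrite !gt_eqF// exprn_gt0.
rewrite !gE => /eqP n.
have h1 : Defs.coord c i / g <= (Defs.coord c i + l) / g.
  by rewrite ler_pM2r ?invr_gt0// lerDl ltW.
have h2 : (Defs.coord c i + l) / g <= Defs.coord c i / g + 3^-1.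
  rewrite mulrDl lerD2l ler_pdivrMr//; lra.
by have [] := one_third_trick k h1 h2.
Qed.

(** [k] is the last generation of side at least [3 l]; the next side is half as large and below
    [3 l]. For large [N] the numbers [2 ^ N] and [2 ^ (- N)] enclose [3 l]. *)
Lemma grid_generation (l : R) : 0 < l -> exists N0, forall N, (N0 <= N)%N ->
  exists k, [/\ (k <= 2 * N)%N, 3 * l <= grid_side (2 ^+ N) k & grid_side (2 ^+ N) k < 6 * l].
Proof.
move=> l0; have l30 : 0 < 3 * l by rewrite mulr_gt0.
pose N0 := maxn (Num.truncn (3 * l)).+1 (Num.truncn (3 * l)^-1).+1.
have p2 (n : nat) (t : R) : 0 <= t -> (Num.truncn t < n)%N -> t < 2 ^+ n.
  move=> t0 tn; apply: (lt_le_trans (truncnS_gt t)).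
  rewrite -natrX ler_nat; apply: (leq_trans tn); apply: ltnW; exact: ltn_expl.
exists N0 => N; rewrite geq_max => /andP[h1 h2].
have a1 : 3 * l < 2 ^+ N by apply: p2 => //; exact: ltW.
have a2 : (3 * l)^-1 < 2 ^+ N by apply: p2 => //; rewrite invr_ge0 ltW.
pose P k := 3 * l <= grid_side (2 ^+ N) k.
have P0 : exists k, P k by exists 0%N; rewrite /P /grid_side expr0 divr1 ltW.
have Pub k : P k -> (k <= 2 * N)%N.
  rewrite /P /grid_side => hk; rewrite leqNgt; apply/negP => kN.
  have : 3 * l <= (2 ^+ N)^-1.
    apply: (le_trans hk); rewrite ler_pdivrMr ?exprn_gt0//.
    rewrite ler_pdivlMl ?exprn_gt0// -exprD addnn -mul2n.
    by rewrite ler_weXn2l ?ler1n// ltnW.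
  rewrite leNgt => /negP; apply.
  by rewrite -[ltRHS]invrK ltf_pV2 ?posrE ?invr_gt0 ?exprn_gt0.
case: (ex_maxnP P0 Pub) => k Pk kmax; exists k; split=> //; first exact: Pub.
rewrite ltNge; apply/negP => h; suff /kmax : P k.+1 by rewrite ltnn.
move: h; rewrite /P /grid_side exprS invfM; lra.
Qed.

End DyadicGrid.

(** * The fractional maximal function and its measurability *)

Section FractionalMaximal.
Context {R : realType} {d : nat}.
Notation E := (euclid R d).
Notation mu := (@lebesgue R d).
Variable alpha : R.
Let kappa := 1 - alpha / d%:R.
Definition cube_value (f : E -> \bar R) (c : E) (l : R) : \bar R :=
  (((l ^+ d) `^ (- kappa))%:E * \int[mu]_(y in cube c l) `|f y|)%E.

Lemma cube_valueE f c l : 0 < l ->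
  (mu (cube c l) `^ (alpha / d%:R) * ((mu (cube c l))^-1 * \int[mu]_(y in cube c l) `|f y|))%E
  = cube_value f c l.
Proof.
move=> l0; have ld0 : 0 < l ^+ d by rewrite exprn_gt0.
rewrite lebesgue_cube ?(ltW l0)// inver gt_eqF// poweR_EFin muleA -EFinM; congr (_%:E * _)%E.
by rewrite /kappa opprB powRB ?(gt_eqF ld0) ?implybT// powRr1// ltW.
Qed.

Lemma cube_value_le_fractional_maximal f (x c : E) l : 0 < l -> cube c l x ->
  (cube_value f c l <= fractional_maximal alpha f x)%E.
Proof.
move=> l0 cx; apply: ereal_sup_ubound; exists (cube c l).
  by split=> //; exists c, l.
exact: cube_valueE.
Qed.

Lemma fractional_maximal_gt f (x : E) (y : \bar R) : (y < fractional_maximal alpha f x)%E ->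
  exists c l, [/\ 0 < l, cube c l x & (y < cube_value f c l)%E].
Proof.
move=> /ereal_sup_gt[_ [_ [[c [l [l0 ->]]] cx] <-]]; rewrite cube_valueE// => h.
by exists c, l.
Qed.

Lemma fractional_maximal_ge0 f (x : E) : (0 <= fractional_maximal alpha f x)%E.
Proof.
apply: (@le_trans _ _ (cube_value f x 1)).
  by rewrite /cube_value mule_ge0 ?lee_fin ?powR_ge0// integral_ge0.
apply: cube_value_le_fractional_maximal => // i.
by rewrite lexx/= lerDl.
Qed.

(* A cube with a large average can be enlarged to one with rational corner and
   side, the average being lower semicontinuous under enlargement. *)
Lemma measurable_fractional_maximal (f : E -> \bar R) : measurable_fun setT f ->
  measurable_fun setT (fractional_maximal alpha f).
Proof.
move=> mf; apply: (measurability _ (ErealGenOInfty.measurableE R)) => //.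
move=> /= _ [_ [y ->]] <-; rewrite setTI.
pose Q (r : {ffun 'I_d -> rat} * rat) : set E :=
  let c := [tuple ratr (r.1 i) | i < d] in let l := ratr r.2 : R in
  if (0 < l) && (y%:E < cube_value f c l)%E then cube c l else set0.
have mQ r : measurable (Q r) by rewrite /Q; case: ifP => _ //; exact: measurable_cube.
rewrite (_ : _ @^-1` _ = \bigcup_r Q r).
  by apply: countable_bigcupT_measurable; [exact: countableP|exact: mQ].
apply/seteqP; split=> [x|x [r _]]; last first.
  rewrite /Q; case: ifP => // /andP[l0 h] cx; rewrite /= in_itv/= andbT.
  exact: lt_le_trans (cube_value_le_fractional_maximal f l0 cx).
rewrite /= in_itv/= andbT => /fractional_maximal_gt[c [l [l0 cx h]]].
(* The integral stays over the original cube and only the power of the volume varies, continuously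
   in the side. An infinite integral allows any enlargement. *)
have [e e0 he] : exists2 e : R, 0 < e & forall t, l < t -> t < l + e ->
    (y%:E < ((t ^+ d) `^ (- kappa))%:E * \int[mu]_(z in cube c l) `|f z|)%E.
  move: h; rewrite /cube_value; set I := (\int[mu]_(z in _) _)%E.
  have : (0 <= I)%E by exact: integral_ge0.
  case: I => [I| |]// I0.
    rewrite -EFinM lte_fin => h.
    have ct : (t ^+ d) `^ (- kappa) * I @[t --> l] --> (l ^+ d) `^ (- kappa) * I.
      apply: cvgM; last exact: cvg_cst.
      apply: (@cvg_comp _ _ _ (fun t : R => t ^+ d) (fun u : R => u `^ (- kappa)) _ (nbhs (l ^+ d))).
        exact: exprn_continuous.
      by apply: powR_continuous_gt0; rewrite exprn_gt0.
    have := cvgr_gt _ ct _ h; rewrite near_simpl => -[e /= e0 he].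
    exists e => // t lt te; rewrite -EFinM lte_fin; apply: he => /=.
    by rewrite distrC ger0_norm ?subr_ge0 ?(ltW lt)// ltrBlDl.
  move=> _; exists 1 => // t lt _.
  by rewrite gt0_muley ?ltry// lte_fin powR_gt0// exprn_gt0// (lt_trans l0).
(* The side grows by more than [e / 2] while the corner moves down by less than [e / 2], so the
   rational cube contains the original one. *)
have [t] := @rat_in_itvoo R (l + e / 2) (l + e) ltac:(lra).
rewrite in_itv/= => /andP[t1 t2].
have hc i : exists r : rat, ratr r \in `](Defs.coord c i - e / 2), (Defs.coord c i)[.
  by apply: rat_in_itvoo; lra.
pose r := ([ffun i => projT1 (cid (hc i))], t).
have rP i : Defs.coord c i - e / 2 < ratr (r.1 i) < Defs.coord c i.
  by rewrite ffunE; have := projT2 (cid (hc i)); rewrite in_itv.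
have lt0 : 0 < ratr t :> R by lra.
have sub : cube c l `<=` cube ([tuple ratr (r.1 i) | i < d] : E) (ratr t).
  move=> z cz i; have := cz i; have := rP i; rewrite /Defs.coord tnth_mktuple.
  by move=> /andP[? ?] /andP[? ?]; apply/andP; split; lra.
exists r => //; rewrite /Q ifT; first exact: sub.
rewrite lt0/=; apply: (lt_le_trans (he _ _ t2)); first by lra.
rewrite /cube_value; apply: lee_wpmul2l; first by rewrite lee_fin powR_ge0.
have mfa : measurable_fun setT (fun z => `|f z|)%E by exact: measurableT_comp.
apply: ge0_subset_integral.
- exact: measurable_cube.
- exact: measurable_cube.
- exact: measurable_funTS mfa.
- by [].
- exact: sub.
Qed.

End FractionalMaximal.

(** * From the shifted grids to the fractional maximal function *)

Section LorentzFiniteSum.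
Context {R : realType} {d : nat}.
Notation E := (euclid R d).
Variables (q : R) (s : \bar R).
Hypotheses (q0 : 0 < q) (qs : (q%:E <= s)%E).

(** Where the sum of [n] terms exceeds a level, [n] times some term does too, so [lorentz_sup_sum]
    applies to the scaled terms. The crude constant is harmless, as the sum runs over the shifts of
    the grids only. *)
Lemma lorentz_finite_sum (T : finType) (t0 : T) (F : T -> E -> R) (B : R) :
  (forall t, measurable_fun setT (F t)) -> (forall t x, 0 <= F t x) -> 0 <= B ->
  (forall t, lorentz q s (EFin \o F t) <= B%:E)%E ->
  (lorentz q s (fun x => (\sum_t F t x)%:E) <=
     (#|T|%:R `^ q^-1 * #|T|%:R * B)%:E)%E.
Proof.
move=> mF F0 B0 hB; set n := #|T|.
have n0 : (0 < n)%N by apply/card_gt0P; exists t0.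
have nR : 0 < n%:R :> R by rewrite ltr0n.
pose e : 'I_n -> T := enum_val.
pose G (j : nat) : E -> \bar R :=
  if insub j is Some i then fun x => (n%:R%:E * (F (e i) x)%:E)%E else cst 0%E.
have mFE t : measurable_fun setT (EFin \o F t) by exact/measurable_EFinP.
have mG j : measurable_fun setT (G j).
  by rewrite /G; case: insubP => [i _ _|_]; [exact: measurable_funeM (mFE _)|exact: measurable_cst].
have mS : measurable_fun setT (fun x => (\sum_t F t x)%:E).
  by apply/measurable_EFinP; exact: measurable_sum.
have hG j : (lorentz q s (G j) `^ q <= if (j < n)%N then ((n%:R * B) `^ q)%:E else 0%E)%E.
  rewrite /G; case: insubP => [i jn _|/negbTE jn]; rewrite jn; last first.
    by rewrite (lorentz0 (d := d) q0 qs) poweR0r ?gt_eqF.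
  rewrite -poweR_EFin; apply: le_poweR2; first exact: ltW.
    exact: (lorentz_ge0 q0 qs (measurable_funeM _ (mFE _))).
  apply: (le_trans (lorentzZ_le q0 qs nR (mFE _))).
  by rewrite EFinM lee_wpmul2l ?lee_fin ?(ltW nR).
have H : (lorentz q s (fun x => (\sum_t F t x)%:E) `^ q <= (n%:R * (n%:R * B) `^ q)%:E)%E.
  apply: (le_trans (lorentz_sup_sum q0 qs mS mG _)).
    move=> x l l0; rewrite gee0_abs ?lee_fin ?sumr_ge0// lte_fin => lx.
    have [t lt] : exists t, l < n%:R * F t x.
      apply: contrapT => /forallNP h; move: lx; rewrite ltNge => /negP; apply.
      have -> : l = \sum_(t : T) (l / n%:R).
        by rewrite sumr_const -[RHS]mulr_natr divfK// gt_eqF.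
      apply: ler_sum => t _; rewrite ler_pdivlMr// mulrC leNgt; exact/negP.
    exists (enum_rank t : nat); rewrite /G insubT//= => tn.
    have -> : Sub (enum_rank t : nat) tn = enum_rank t by exact: val_inj.
    by rewrite /e enum_rankK ger0_norm ?mulr_ge0// lte_fin.
  apply: lime_le; first by apply: is_cvg_nneseries => j *; exact: poweR_ge0.
  apply: nearW => m.
  apply: (@le_trans _ _ (\sum_(0 <= j < m) if (j < n)%N then ((n%:R * B) `^ q)%:E else 0%E)%E).
    by apply: lee_sum => j _.
  have -> : (\sum_(0 <= j < m) (if (j < n)%N then ((n%:R * B) `^ q)%:E else 0%E))%E =
      ((minn m n)%:R * (n%:R * B) `^ q)%:E.
    elim: m => [|m ih]; first by rewrite big_nil min0n mul0r.
    rewrite big_nat_recr//= ih; case: ltnP => mn.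
      by rewrite -EFinD (minn_idPl mn) -natr1 mulrDl mul1r.
    by rewrite adde0 (minn_idPr (leqW mn)).
  by rewrite lee_fin ler_wpM2r ?powR_ge0// ler_nat geq_minr.
have := poweR_le_root q0 (lorentz_ge0 q0 qs mS) H.
rewrite poweR_EFin powRM ?powR_ge0 ?(ltW nR)// -powRrM mulfV ?gt_eqF// powRr1.
  by rewrite mulrA.
by rewrite mulr_ge0 ?(ltW nR).
Qed.

End LorentzFiniteSum.

Section MaximalBound.
Context {R : realType} {d : nat}.
Notation E := (euclid R d).
Notation mu := (@lebesgue R d).
Variables (alpha p p' q : R) (s : \bar R).
Hypotheses (p1 : 1 < p) (pp' : p^-1 + p'^-1 = 1) (pq : p <= q) (qs : (q%:E <= s)%E).
Hypothesis qE : q^-1 + p'^-1 = 1 - alpha / d%:R.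
Variables (v g : E -> R) (K N : R).
Hypotheses (mv : measurable_fun setT v) (v0 : forall x, 0 < v x).
Hypotheses (mg : measurable_fun setT g) (g0 : forall x, 0 <= g x).
Hypotheses (K0 : 0 < K) (N0 : 0 <= N).
Local Notation e := (q^-1 + p'^-1).

Hypothesis A_cube : forall c l, 0 < l ->
  (restricted_norm q s v (cube c l) * dual_mass p' v (cube c l) `^ p'^-1 <=
   (K * (l ^+ d) `^ e)%:E)%E.
Hypothesis gN : (\int[mu]_x ((g x * v x) `^ p)%:E <= (N `^ p)%:E)%E.

Let p0 : 0 < p. Proof. exact: lt_trans p1. Qed.
Let q0 : 0 < q. Proof. exact: lt_le_trans pq. Qed.
Let p'0 : 0 < p'.
Proof. by rewrite -invr_gt0 -(addKr p^-1 p'^-1) pp' addrC subr_gt0 invf_lt1. Qed.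
Let e0 : 0 < e. Proof. by rewrite addr_gt0// invr_gt0. Qed.

Local Notation shifts := {ffun 'I_d -> bool}.

Let cell (n : nat) (beta : shifts) : nat -> E -> {ffun 'I_d -> int} :=
  grid_cell (2 ^+ n) (third_shift (2 ^+ n) beta).
Let m (n k : nat) : R := grid_side (2 ^+ n) k ^+ d.

Let L0 (n : nat) : 0 < 2 ^+ n :> R. Proof. by rewrite exprn_gt0. Qed.

(** With coarsest side [2 ^ n] and generations up to [2 * n], the sides range from [2 ^ n] down to
    [2 ^ (- n)]. *)
Let value n beta := principal_value (cell n beta) p' q (m n) g (2 * n).

Let m0 n k : 0 < m n k.
Proof. by rewrite exprn_gt0// grid_side_gt0. Qed.

Let m_ni n k j : (k <= j)%N -> m n j <= m n k.
Proof.
move=> kj; rewrite lerXn2r ?nnegrE ?(ltW (grid_side_gt0 (L0 _) _))//.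
exact: (grid_side_ni (L0 n) kj).
Qed.

Let nested n beta k x y : cell n beta k.+1 x = cell n beta k.+1 y -> cell n beta k x = cell n beta k y.
Proof. exact: grid_nested. Qed.

Let mcell n beta k j : measurable [set x | cell n beta k x = j].
Proof. exact: measurable_grid_cell. Qed.

(** A cell lies in a closed cube of the same side, so the condition passes from cubes to cells by
    monotonicity, with the same [K]. *)
Let A_cell n beta k x :
  (restricted_norm q s v (cell_at (cell n beta) k x) *
   dual_mass p' v (cell_at (cell n beta) k x) `^ p'^-1 <= (K * m n k `^ e)%:E)%E.
Proof.
have [c sub] := grid_cell_sub_cube (third_shift (2 ^+ n) beta) (L0 n) k x.
have mC : measurable (cell_at (cell n beta) k x) by exact: mcell.
have mQ : measurable (cube c (grid_side (2 ^+ n) k)) by exact: measurable_cube.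
apply: le_trans (A_cube c (grid_side_gt0 (L0 n) k)); apply: lee_pmul.
- exact: (lorentz_ge0 q0 qs (measurable_EFin_indic mv mC)).
- exact: poweR_ge0.
- apply: (lorentz_le q0 qs (measurable_EFin_indic mv mC) (measurable_EFin_indic mv mQ)) => x'.
  rewrite lee_fin !normrM ler_wpM2l// !indicE.
  case: (boolP (x' \in cell_at (cell n beta) k x)) => [xC|_]; last by rewrite normr0.
  by rewrite mem_set//; apply: sub; exact: set_mem.
- apply: le_poweR2; first by rewrite invr_ge0 ltW.
    by apply: integral_ge0 => y _; rewrite lee_fin powR_ge0.
  apply: ge0_subset_integral; [exact: mC|exact: mQ| |by move=> y _; rewrite lee_fin powR_ge0|exact: sub].
  by apply: measurable_funTS; apply/measurable_EFinP; exact: measurable_dual.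
Qed.

Let value_bound n beta :
  (lorentz q s (fun y => (value n beta y * v y)%:E) <=
   ((2 `^ q * 4 `^ (e * p') * (2 `^ p * (p / (p - 1)))) `^ q^-1 * K `^ (1 + p' / q) * N)%:E)%E.
Proof.
apply: (dyadic_bound (@mcell n beta) (@nested n beta) p1 pp' pq qs (m0 n) (@m_ni n) _ mv v0 mg g0 K0 N0
  (A_cell n beta) gN).
by move=> k x; exact: lebesgue_grid_cell.
Qed.

Let value_ge0 n beta x : 0 <= value n beta x.
Proof.
rewrite /value /principal_value mulr_ge0// cell_value_ge0// => k.
by rewrite powR_gt0.
Qed.

Let mvalue n beta : measurable_fun setT (value n beta).
Proof. exact: (measurable_principal_value (@mcell n beta) (@nested n beta)). Qed.

Let B0 : R := (2 `^ q * 4 `^ (e * p') * (2 `^ p * (p / (p - 1)))) `^ q^-1.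
Let c6 : R := (6 ^+ d) `^ e.
Let nT : R := #|{: shifts}|%:R.

(** For large [n] the cube lies in a cell of side below [6 l] of one of the shifted grids. Enlarging
    the domain of integration is free, and the power of the volume loses at most [c6], since
    [alpha/d - 1 = - e]. *)
Lemma value_dominates (x c : E) l : 0 < l -> cube c l x -> exists n0, forall n, (n0 <= n)%N ->
  exists beta, (cube_value alpha (EFin \o g) c l <= (c6 * value n beta x)%:E)%E.
Proof.
move=> l0 cx; have [n0 hn0] := @grid_generation R l l0.
exists n0 => n /hn0[k [kn lk kl]].
have [beta hb] := cube_sub_grid_cell c (L0 n) l0 lk; exists beta.
have mC : measurable (cell_at (cell n beta) k x) by exact: mcell.
have mQ : measurable (cube c l) by exact: measurable_cube.
have mgE : measurable_fun setT (EFin \o g) by exact/measurable_EFinP.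
have sub : cube c l `<=` cell_at (cell n beta) k x by move=> y cy; exact: hb.
have ld0 : 0 < l ^+ d by rewrite exprn_gt0.
set c0 := cell_value (@lebesgue_sfinite R d) (cell n beta) g (fun j => m n j `^ (- e)) k x.
suff h : (cube_value alpha (EFin \o g) c l <= (c6 * c0)%:E)%E.
  apply: (le_trans h).
  rewrite lee_fin ler_wpM2l ?powR_ge0//; apply: principal_max => // j.
  by rewrite powR_gt0.
have gfin : (\int[mu]_(y in cell_at (cell n beta) k x) (g y)%:E < +oo)%E.
  exact: (cell_integral_lty (@mcell n beta) p1 pp' pq qs (m0 n)
    (fun k x => lebesgue_grid_cell _ (L0 n) k x) mv v0 mg g0 N0 (A_cell n beta) gN).
rewrite /c0 /cell_value EFinM EFinM fineK; last first.
  by rewrite ge0_fin_numE// integral_ge0// => y _; rewrite lee_fin.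
rewrite muleA -EFinM /cube_value; apply: lee_pmul.
- by rewrite lee_fin powR_ge0.
- by apply: integral_ge0.
- rewrite lee_fin -qE /c6 powRN [in leRHS]powRN -ler_pdivrMl ?powR_gt0 ?exprn_gt0//.
  rewrite -invfM lef_pV2 ?posrE ?mulr_gt0 ?powR_gt0 ?exprn_gt0 ?grid_side_gt0//.
  rewrite -powRM ?exprn_ge0 ?(ltW l0)//; apply: ge0_ler_powR; rewrite ?nnegrE ?(ltW e0)//.
  - by rewrite exprn_ge0// ltW// grid_side_gt0.
  - by rewrite mulr_ge0 ?exprn_ge0// ltW.
  - rewrite -exprMn lerXn2r ?nnegrE ?(ltW (grid_side_gt0 (L0 n) k)) ?(ltW kl)//.
    by rewrite mulr_ge0// ltW.
- apply: (@le_trans _ _ (\int[mu]_(y in cube c l) (g y)%:E)%E).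
    by apply: eq_implies_le; apply: eq_integral => y _; rewrite /= ger0_norm.
  apply: ge0_subset_integral; [exact: mQ|exact: mC|exact: measurable_funTS mgE| |exact: sub].
  by move=> y _; rewrite lee_fin g0.
Qed.

Lemma maximal_bound :
  (lorentz q s (fun x => fractional_maximal alpha (EFin \o g) x * (v x)%:E) <=
   (nT `^ q^-1 * nT * (c6 * B0) * K `^ (1 + p' / q) * N)%:E)%E.
Proof.
have mgE : measurable_fun setT (EFin \o g) by exact/measurable_EFinP.
have mvE : measurable_fun setT (EFin \o v) by exact/measurable_EFinP.
have mM := measurable_fractional_maximal alpha mgE.
have c60 : 0 <= c6 by exact: powR_ge0.
have c6p : 0 < c6 by rewrite powR_gt0// exprn_gt0.
have mF n beta : measurable_fun setT (fun x => c6 * (value n beta x * v x)).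
  exact: measurable_funM (measurable_cst c6) (measurable_funM (mvalue n beta) mv).
have F0 n beta x : 0 <= c6 * (value n beta x * v x).
  by rewrite mulr_ge0// mulr_ge0// ltW.
have mS n : measurable_fun setT (fun x => (\sum_beta c6 * (value n beta x * v x))%:E).
  exact/(measurable_EFinP _ _)/(measurable_sum _ (mF n)).
have mMv : measurable_fun setT (fun x => fractional_maximal alpha (EFin \o g) x * (v x)%:E)%E.
  exact: emeasurable_funM mM mvE.
(* The index from which a grid catches the cube depends on its side, hence on the point and the
   level, and the sums need not be monotone in [n]; this is why Fatou's property is used. *)
apply: (lorentz_fatou q0 qs mMv mS).
  move=> x l l0 lx.
  have : (((v x)^-1 * l)%:E < fractional_maximal alpha (EFin \o g) x)%E.
    rewrite EFinM lte_pdivrMl// muleC; move: lx.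
    by rewrite gee0_abs// mule_ge0 ?fractional_maximal_ge0// lee_fin ltW.
  move=> /fractional_maximal_gt[c [l' [l'0 cx h]]].
  have [n0 hn0] := value_dominates l'0 cx.
  exists n0 => n /hn0[beta hb]; have := lt_le_trans h hb.
  rewrite lte_fin ltr_pdivrMl// => lb.
  rewrite gee0_abs ?lee_fin ?sumr_ge0//.
  rewrite lte_fin (bigD1 beta)//=; apply: (lt_le_trans lb).
  have -> : v x * (c6 * value n beta x) = c6 * (value n beta x * v x) by ring.
  by rewrite lerDl; apply: sumr_ge0 => b _; exact: F0.
move=> n; set B := B0 * K `^ (1 + p' / q) * N.
have B'0 : 0 <= B := mulr_ge0 (mulr_ge0 (powR_ge0 _ _) (powR_ge0 _ _)) N0.
have -> : nT `^ q^-1 * nT * (c6 * B0) * K `^ (1 + p' / q) * N = nT `^ q^-1 * nT * (c6 * B).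
  by rewrite /B; ring.
apply: (lorentz_finite_sum q0 qs [ffun=> true] (mF n) (F0 n)); first by rewrite mulr_ge0.
move=> beta.
have mvv : measurable_fun setT (fun x => (value n beta x * v x)%:E).
  exact/(measurable_EFinP _ _)/(measurable_funM (mvalue n beta) mv).
apply: le_trans (lorentzZ_le q0 qs c6p mvv) _.
by rewrite EFinM lee_wpmul2l ?lee_fin//; exact: value_bound.
Qed.

End MaximalBound.

(** * Regular weights and the weight constant on cubes *)

Section RegularWeight.
Context {R : realType} {d : nat}.
Notation E := (euclid R d).
Notation mu := (@lebesgue R d).

(** By completeness of the Lebesgue sigma-algebra. It is used for the measurability of the inverse
    weight. *)
Lemma ae_eq_measurable (f g : E -> \bar R) : measurable_fun setT f ->
  {ae mu, forall x, f x = g x} -> measurable_fun setT g.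
Proof.
move=> mf fg; apply: (@ae_measurable_fun _ _ _ mu _ setT f g _ mf).
  exact: measure_is_complete_caratheodory.
by apply: filterS fg => x h _.
Qed.

(** The value 1 is substituted on the null set where [0 < w < +oo] fails. Lorentz norms do not see
    the change, and the weight becomes a positive real function. *)
Lemma weight_regularization (w : E -> \bar R) : weight w ->
  exists v : E -> R, [/\ measurable_fun setT v, forall x, 0 < v x &
    {ae mu, forall x, w x = (v x)%:E}].
Proof.
move=> [mw aw].
exists (fun x => if (0 < w x)%E && (w x < +oo)%E then fine (w x) else 1); split.
- apply: measurable_fun_ifT; last exact: measurable_cst.
    apply: measurable_and; apply: measurable_fun_lte; first exact: measurable_cst.
    + exact: mw.
    + exact: mw.
    + exact: measurable_cst.
  exact: (measurableT_comp (@fine_measurable R setT measurableT) mw).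
- by move=> x; case: ifPn => // /andP[w0 wy]; rewrite fine_gt0// w0.
- apply: filterS aw => x /= h; rewrite h; case/andP: h => w0 wy.
  by rewrite fineK// ge0_fin_numE// ltW.
Qed.

(** The two normalising powers of the volume combine, and the norm of the inverse weight is an
    ordinary Lebesgue norm by [lorentz_diag]. *)
Lemma A_cubeE (q p' : R) (s : \bar R) (w : E -> \bar R) (v : E -> R) (c : E) (l : R) :
  0 < q -> (q%:E <= s)%E -> 0 < p' -> measurable_fun setT w ->
  measurable_fun setT v -> (forall x, 0 < v x) -> {ae mu, forall x, w x = (v x)%:E} ->
  0 < l ->
  (lorentz_cube q s (cube c l) w * lorentz_cube p' p'%:E (cube c l) (fun x => (w x)^-1) =
   ((l ^+ d) `^ (- (q^-1 + p'^-1)))%:E *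
     (restricted_norm q s v (cube c l) * dual_mass p' v (cube c l) `^ p'^-1))%E.
Proof.
move=> q0 qs p'0 mw mv v0 wv l0; set Q := cube c l.
have mQ : measurable Q by exact: measurable_cube.
have ld0 : 0 < l ^+ d by rewrite exprn_gt0.
have mV : measurable_fun setT (fun x => (v x)^-1).
  rewrite (_ : (fun _ => _) = (fun x => v x `^ (- 1))).
    exact: measurable_dual.
  by apply/funext => x; rewrite powRN powRr1// ltW.
have wV : {ae mu, forall x, ((v x)^-1)%:E = (w x)^-1%E}.
  by apply: filterS wv => x ->; rewrite inver gt_eqF.
have mwV : measurable_fun setT (fun x => (w x)^-1%E).
  by apply: ae_eq_measurable wV; exact/measurable_EFinP.
have mI : measurable_fun setT (fun x => (\1_Q x)%:E : \bar R).
  by apply/measurable_EFinP; exact: measurable_indic.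
have E1 : lorentz q s (fun x => w x * (\1_Q x)%:E)%E = restricted_norm q s v Q.
  apply: (lorentz_ae q0 qs (emeasurable_funM mw mI) (measurable_EFin_indic mv mQ)).
  by apply: filterS wv => x ->; rewrite EFinM.
have E2 : lorentz p' p'%:E (fun x => (w x)^-1 * (\1_Q x)%:E)%E = (dual_mass p' v Q `^ p'^-1)%E.
  rewrite -(lorentz_ae p'0 (lexx _) (measurable_EFin_indic mV mQ) (emeasurable_funM mwV mI)).
    rewrite (lorentz_diag p'0 (measurable_EFin_indic mV mQ)).
    congr (_ `^ _)%E; rewrite /dual_mass [RHS]integral_mkcond.
    apply: eq_integral => x _.
    rewrite patchE indicE; case: (x \in Q); last by rewrite mulr0 abse0 (poweR0r (lt0r_neq0 p'0)).
    rewrite mulr1 gee0_abs ?lee_fin ?invr_ge0 ?(ltW (v0 _))// poweR_EFin.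
    by rewrite -powR_inv1 ?(ltW (v0 _))// -powRrM mulN1r.
  by apply: filterS wV => x <-; rewrite EFinM.
rewrite /lorentz_cube E1 E2 lebesgue_cube ?(ltW l0)// !poweR_EFin.
by rewrite muleACA -EFinM -powRD ?(gt_eqF ld0) ?implybT// opprD.
Qed.

End RegularWeight.

Section WeightConstant.
Context {R : realType} {d : nat}.
Notation E := (euclid R d).
Notation mu := (@lebesgue R d).
Variables (p' q : R) (s : \bar R) (w : E -> \bar R) (v : E -> R).
Hypotheses (q0 : 0 < q) (qs : (q%:E <= s)%E) (p'0 : 0 < p').
Hypotheses (mw : measurable_fun setT w) (mv : measurable_fun setT v).
Hypotheses (v0 : forall x, 0 < v x) (wv : {ae mu, forall x, w x = (v x)%:E}).

Let e := q^-1 + p'^-1.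

Lemma A_const_le (K : R) :
  (A_const p' q s w <= K%:E)%E <->
  (forall c l, 0 < l -> (restricted_norm q s v (cube c l) *
     dual_mass p' v (cube c l) `^ p'^-1 <= (K * (l ^+ d) `^ e)%:E)%E).
Proof.
have key (c : E) l : 0 < l -> (lorentz_cube q s (cube c l) w *
    lorentz_cube p' p'%:E (cube c l) (fun x => (w x)^-1) <= K%:E)%E =
    (restricted_norm q s v (cube c l) *
     dual_mass p' v (cube c l) `^ p'^-1 <= (K * (l ^+ d) `^ e)%:E)%E.
  move=> l0; have ld0 : 0 < l ^+ d by rewrite exprn_gt0.
  rewrite (A_cubeE _ q0 qs p'0 mw mv v0 wv l0) powRN.
  by rewrite lee_pdivrMl ?powR_gt0// -EFinM [_ * K]mulrC.
split=> [h c l l0|h].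
  rewrite -(key _ _ l0); apply: le_trans h; apply: ereal_sup_ubound.
  by exists (cube c l) => //; exists c, l.
by apply: ge_ereal_sup => _ [_ [c [l [l0 ->]]] <-]; rewrite (key _ _ l0); exact: h.
Qed.

(** A single cube of side 1 already gives a positive product. Positivity lets the constant itself
    play the role of [K]. *)
Lemma A_const_gt0 : (0 < A_const p' q s w)%E.
Proof.
pose c : E := [tuple 0 | i < d].
have mQ : measurable (cube c 1) by exact: measurable_cube.
have muQ : (0 < mu (cube c 1))%E by rewrite lebesgue_cube// lte_fin exprn_gt0.
apply: (@lt_le_trans _ _ (lorentz_cube q s (cube c 1) w *
    lorentz_cube p' p'%:E (cube c 1) (fun x => (w x)^-1))%E); last first.
  by apply: ereal_sup_ubound; exists (cube c 1) => //; exists c, 1.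
rewrite (A_cubeE _ q0 qs p'0 mw mv v0 wv ltr01) !mule_gt0//.
- exact: (restricted_norm_gt0 q0 qs mv v0 mQ muQ).
- exact: (poweR_gt0 _ (dual_mass_gt0 p' mv v0 mQ muQ)).
Qed.

End WeightConstant.

Lemma abse_fine_of_power {R : realType} (p r : R) (y : \bar R) : 0 < p -> 0 < r ->
  (`|y * r%:E| `^ p)%E \is a fin_num -> `|y|%E = (fine `|y|%E)%:E.
Proof.
move=> p0 r0; case: y => [y| |]//=.
  by rewrite gt0_mulye ?lte_fin// poweRyr ?gt_eqF.
by rewrite gt0_mulNye ?lte_fin// poweRyr ?gt_eqF.
Qed.

(** * Sufficiency of the A condition, with its quantitative bound *)

Section Sufficiency.
Context {R : realType} {d : nat}.
Notation E := (euclid R d).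
Notation mu := (@lebesgue R d).

Lemma fractional_maximal_ae (alpha : R) (f g : E -> \bar R) :
  measurable_fun setT f -> measurable_fun setT g ->
  {ae mu, forall x, `|f x|%E = `|g x|%E} ->
  fractional_maximal alpha f = fractional_maximal alpha g.
Proof.
move=> mf mg fg; apply/funext => x; congr ereal_sup; apply: eq_imagel.
move=> _ [[c [l [l0 ->]]] _]; congr (_ * (_ * _))%E.
have m (h : E -> \bar R) : measurable_fun setT h ->
    measurable_fun (cube c l) (fun y => `|h y|%E).
  by move=> mh; apply: measurable_funTS; exact: (measurableT_comp (@abse_measurable R setT) mh).
apply: (ge0_ae_eq_integral (measurable_cube c l) (m _ mf) (m _ mg)).
- by move=> y _; exact: abse_ge0.
- by move=> y _; exact: abse_ge0.
- by apply: filterS fg => y h _.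
Qed.

Variables (alpha p p' q : R) (s : \bar R).
Hypotheses (p1 : 1 < p) (pp' : p^-1 + p'^-1 = 1) (pq : p <= q) (qs : (q%:E <= s)%E).
Hypothesis qE : q^-1 + p'^-1 = 1 - alpha / d%:R.

Let p0 : 0 < p. Proof. exact: lt_trans p1. Qed.
Let q0 : 0 < q. Proof. exact: lt_le_trans pq. Qed.
Let p'0 : 0 < p'.
Proof. by rewrite -invr_gt0 -(addKr p^-1 p'^-1) pp' addrC subr_gt0 invf_lt1. Qed.

(** [C] is chosen before the weight and involves only [d], [p], [p'] and [q]; this is the
    independence claimed for the implicit constant. A function of finite weighted norm is finite
    almost everywhere, so it can be replaced by the real-valued [g] with the same maximal function
    and norm. *)
Lemma op_bound_of_A_const : exists2 C : R, 0 < C &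
  forall (w : E -> \bar R) (K : R), weight w -> 0 < K -> (A_const p' q s w <= K%:E)%E ->
    op_bound p p%:E q s w (fractional_maximal alpha) (C * K `^ (1 + p' / q)).
Proof.
pose C := #|{: {ffun 'I_d -> bool}}|%:R `^ q^-1 * #|{: {ffun 'I_d -> bool}}|%:R *
  ((6 ^+ d) `^ (q^-1 + p'^-1) *
   (2 `^ q * 4 `^ ((q^-1 + p'^-1) * p') * (2 `^ p * (p / (p - 1)))) `^ q^-1) : R.
have C0 : 0 < C.
  have n0 : 0 < #|{: {ffun 'I_d -> bool}}|%:R :> R.
    by rewrite ltr0n; apply/card_gt0P; exists [ffun=> true].
  have p10 : 0 < p - 1 by rewrite subr_gt0.
  rewrite /C mulr_gt0//; first by rewrite mulr_gt0// powR_gt0.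
  by rewrite mulr_gt0// powR_gt0// ?exprn_gt0// mulr_gt0 ?mulr_gt0 ?invr_gt0 ?powR_gt0.
exists C => // w K ww K0 AK.
have [v [mv v0 wv]] := weight_regularization ww; have [mw _] := ww.
have mvE : measurable_fun setT (EFin \o v) by exact/measurable_EFinP.
split=> [|f [mf fL]]; first by rewrite mulr_ge0 ?powR_ge0// ltW.
pose g x := fine `|f x|%E.
have mg : measurable_fun setT g.
  apply: (measurableT_comp (@fine_measurable R setT measurableT)).
  exact: (measurableT_comp (@abse_measurable R setT) mf).
have mgE : measurable_fun setT (EFin \o g) by exact/measurable_EFinP.
have g0 x : 0 <= g x by rewrite /g fine_ge0.
have mfv : measurable_fun setT (fun x => f x * (v x)%:E)%E := emeasurable_funM mf mvE.
have Lv : lorentz_weighted p p%:E w f = lorentz p p%:E (fun x => f x * (v x)%:E)%E.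
  apply: (lorentz_ae p0 (lexx _) (emeasurable_funM mf mw) mfv).
  by apply: filterS wv => x ->.
have mpow : measurable_fun setT (fun x => `|f x * (v x)%:E|%E `^ p)%E.
  exact: (measurableT_comp (measurable_poweR p)
    (measurableT_comp (@abse_measurable R setT) mfv)).
set I := (\int[mu]_x (`|f x * (v x)%:E| `^ p))%E.
have LI : lorentz_weighted p p%:E w f = (I `^ p^-1)%E.
  by rewrite Lv (lorentz_diag p0 mfv).
have I0 : (0 <= I)%E by apply: integral_ge0 => x _; exact: poweR_ge0.
have Ioo : (I < +oo)%E.
  rewrite ltey; apply/eqP => Iy.
  have : (lorentz_weighted p p%:E w f < +oo)%E by exact: fL.
  by rewrite LI Iy poweRyr ?invr_neq0 ?gt_eqF// ltxx.
have int_pow : mu.-integrable setT (fun x => `|f x * (v x)%:E|%E `^ p)%E.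
  apply/integrableP; split; first exact: mpow.
  have -> : (\int[mu]_x `| `|f x * (v x)%:E| `^ p |)%E = I; last exact: Ioo.
  by apply: eq_integral => x _; exact: (gee0_abs (poweR_ge0 _ _)).
have fg : {ae mu, forall x, `|f x|%E = (g x)%:E}.
  apply: filterS (integrable_ae measurableT int_pow) => x /(_ Logic.I) fin.
  exact: (abse_fine_of_power p0 (v0 x) fin).
have Mfg : fractional_maximal alpha f = fractional_maximal alpha (EFin \o g).
  apply: (fractional_maximal_ae alpha mf mgE); apply: filterS fg => x ->.
  by rewrite /= ger0_norm.
have Ig : (\int[mu]_x ((g x * v x) `^ p)%:E = I)%E.
  apply: (ge0_ae_eq_integral measurableT _ mpow).
  - apply/measurable_EFinP.
    exact: (measurableT_comp (@measurable_powR R p) (measurable_funM mg mv)).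
  - by move=> x _; rewrite lee_fin powR_ge0.
  - by move=> x _; exact: poweR_ge0.
  apply: filterS fg => x fgx _.
  by rewrite abseM fgx gee0_abs ?lee_fin ?(ltW (v0 _))// -EFinM poweR_EFin.
have -> : lorentz_weighted q s w (fractional_maximal alpha f) =
    lorentz q s (fun x => fractional_maximal alpha (EFin \o g) x * (v x)%:E)%E.
  have mM := measurable_fractional_maximal alpha mgE.
  rewrite /lorentz_weighted Mfg.
  apply: (lorentz_ae q0 qs (emeasurable_funM mM mw) (emeasurable_funM mM mvE)).
  by apply: filterS wv => x ->.
have L0 : (0 <= lorentz_weighted p p%:E w f)%E by rewrite LI; exact: poweR_ge0.
have Lfin : lorentz_weighted p p%:E w f \is a fin_num.
  by rewrite (ge0_fin_numE L0); exact: fL.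
set N := fine (lorentz_weighted p p%:E w f).
have LN : lorentz_weighted p p%:E w f = N%:E := esym (fineK Lfin).
have N0 : 0 <= N by exact: (fine_ge0 L0).
have gN : (\int[mu]_x ((g x * v x) `^ p)%:E <= (N `^ p)%:E)%E.
  by rewrite Ig -poweR_EFin -LN LI (poweRVK (lt0r_neq0 p0) I0).
rewrite LN -EFinM.
have A_cube := (A_const_le q0 qs p'0 mw mv v0 wv K).1 AK.
exact: (maximal_bound p1 pp' pq qs qE mv v0 mg g0 K0 N0 A_cube gN).
Qed.

End Sufficiency.

(** * Necessity of the A condition *)

Section Necessity.
Context {R : realType} {d : nat}.
Notation E := (euclid R d).
Notation mu := (@lebesgue R d).
Variables (alpha p p' q : R) (s : \bar R).
Hypotheses (p1 : 1 < p) (pp' : p^-1 + p'^-1 = 1) (pq : p <= q) (qs : (q%:E <= s)%E).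
Hypothesis qE : q^-1 + p'^-1 = 1 - alpha / d%:R.
Variables (w : E -> \bar R) (v : E -> R) (C : R).
Hypotheses (mw : measurable_fun setT w) (mv : measurable_fun setT v).
Hypotheses (v0 : forall x, 0 < v x) (wv : {ae mu, forall x, w x = (v x)%:E}).
Hypothesis opC : op_bound p p%:E q s w (fractional_maximal alpha) C.

Let p0 : 0 < p. Proof. exact: lt_trans p1. Qed.
Let q0 : 0 < q. Proof. exact: lt_le_trans pq. Qed.
Let p'0 : 0 < p'.
Proof. by rewrite -invr_gt0 -(addKr p^-1 p'^-1) pp' addrC subr_gt0 invf_lt1. Qed.

(** The exponents satisfy [p + p' = p p']. Hence the p-th power of [sigma v] is [sigma] itself,
    which makes [sigma] the natural test function. *)
Let conjugate_powR (x : R) : 0 < x -> (x `^ (- p') * x) `^ p = x `^ (- p').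
Proof.
move=> x0; rewrite -[X in _ * X]powRr1 ?(ltW x0)// -powRD ?(gt_eqF x0) ?implybT//.
rewrite -powRrM; congr (_ `^ _).
have h : p + p' = p * p'.
  rewrite -[RHS]mul1r -pp' mulrDl mulrA mulVf ?gt_eqF// mul1r addrC; congr (_ + _).
  by rewrite mulrCA mulVf ?gt_eqF// mulr1.
by rewrite mulrDl mul1r mulNr mulrC -h opprD addrAC addNr add0r.
Qed.

(** For [f = sigma 1_G] and [S] the dual mass of [G], the maximal function is on all of the cube at
    least [a], the volume to the power [- (1/q + 1/p')] times [S], and the weighted norm of [f] is
    [S ^ (1/p)]. Thus [a W(Q) <= C S ^ (1/p)]; multiplying by [S ^ (1/p')] and dividing by [a]
    cancels [S]. *)
Lemma A_cube_testing (c : E) (l : R) (G : set E) : 0 < l -> measurable G -> G `<=` cube c l ->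
  (dual_mass p' v G < +oo)%E ->
  (restricted_norm q s v (cube c l) * dual_mass p' v G `^ p'^-1 <=
    (C * (l ^+ d) `^ (q^-1 + p'^-1))%:E)%E.
Proof.
move=> l0 mG GQ Goo; have [C0 opC'] := opC; set Q := cube c l.
have mQ : measurable Q by exact: measurable_cube.
set m := l ^+ d; have m0 : 0 < m by rewrite exprn_gt0.
have mD := measurable_dual p' mv.
have dG0 : (0 <= dual_mass p' v G)%E.
  by apply: integral_ge0 => x _; rewrite lee_fin powR_ge0.
set S := fine (dual_mass p' v G).
have GS : dual_mass p' v G = S%:E by rewrite /S fineK// ge0_fin_numE.
(* A vanishing dual mass is set aside because the argument divides by [a]. *)
have := dG0; rewrite GS lee_fin le_eqVlt => /predU1P[<-|S0].
  by rewrite poweR0r ?invr_neq0 ?gt_eqF// mule0 lee_fin mulr_ge0// powR_ge0.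
pose f (x : E) := (v x `^ (- p') * \1_G x)%:E.
have mf : measurable_fun setT f.
  by apply/measurable_EFinP; exact: (measurable_funM mD (measurable_indic mG)).
have mvE : measurable_fun setT (EFin \o v) by exact/measurable_EFinP.
have mfv : measurable_fun setT (fun x => f x * (v x)%:E)%E := emeasurable_funM mf mvE.
have f0 x : (0 <= f x)%E by rewrite lee_fin mulr_ge0 ?powR_ge0.
have Lf : lorentz_weighted p p%:E w f = (S `^ p^-1)%:E.
  rewrite -[LHS](lorentz_ae p0 (lexx _) mfv (emeasurable_funM mf mw)); last first.
    by apply: filterS wv => x ->.
  have -> : (S `^ p^-1)%:E = (dual_mass p' v G `^ p^-1)%E by rewrite GS poweR_EFin.
  rewrite (lorentz_diag p0 mfv); apply: (congr1 (fun y => y `^ p^-1)%E).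
  rewrite /dual_mass [RHS]integral_mkcond; apply: eq_integral => x _.
  rewrite patchE /f indicE; case: (x \in G); last first.
    by rewrite mulr0 mul0e abse0 (poweR0r (lt0r_neq0 p0)).
  rewrite mulr1 -EFinM gee0_abs ?lee_fin ?mulr_ge0 ?powR_ge0 ?(ltW (v0 _))// poweR_EFin.
  by rewrite (conjugate_powR (v0 x)).
have fin : lorentz_space p p%:E w f.
  by split; [exact: mf|rewrite Lf; exact: ltry].
have := opC' f fin; rewrite Lf => H.
pose a := m `^ (- (q^-1 + p'^-1)) * S; have a0 : 0 < a by rewrite mulr_gt0// powR_gt0.
have If : (\int[mu]_(y in Q) `|f y|)%E = S%:E.
  rewrite -GS /dual_mass integral_mkcond [RHS]integral_mkcond; apply: eq_integral => x _.
  rewrite !patchE (gee0_abs (f0 x)) /f indicE; case: (boolP (x \in G)) => xG.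
    by rewrite (mem_set (GQ _ (set_mem xG))) mulr1.
  by rewrite mulr0; case: ifP.
have Ma x : Q x -> (a%:E <= fractional_maximal alpha f x)%E.
  move=> Qx; apply: (le_trans _ (cube_value_le_fractional_maximal alpha f l0 Qx)).
  by rewrite /cube_value If -qE -EFinM.
have mM := measurable_fractional_maximal alpha mf.
have mI := measurable_EFin_indic mv mQ.
have maI : measurable_fun setT (fun x => a%:E * (v x * \1_Q x)%:E)%E := measurable_funeM _ mI.
have {}H : (lorentz q s (fun x => a%:E * (v x * \1_Q x)%:E)%E <= (C * S `^ p^-1)%:E)%E.
  rewrite EFinM; apply: le_trans H.
  rewrite -[leRHS](lorentz_ae q0 qs (emeasurable_funM mM mvE) (emeasurable_funM mM mw)).
    apply: (lorentz_le q0 qs maI (emeasurable_funM mM mvE)) => x.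
    rewrite indicE; case: (boolP (x \in Q)) => [/set_mem Qx|_]; last first.
      by rewrite mulr0 mule0 abse0; exact: abse_ge0.
    rewrite mulr1 !abseM lee_wpmul2r ?abse_ge0//.
    by rewrite !gee0_abs ?fractional_maximal_ge0 ?lee_fin ?(ltW a0)//; exact: Ma.
  by apply: filterS wv => x ->.
have aV0 : 0 < a^-1 by rewrite invr_gt0.
have W_le : (restricted_norm q s v Q <= (a^-1 * (C * S `^ p^-1))%:E)%E.
  have := lorentzZ_le q0 qs aV0 maI.
  rewrite (_ : (fun x => _ * _)%E = (fun x => (v x * \1_Q x)%:E)); last first.
    by apply/funext => x; rewrite muleA -[((a^-1)%:E * _)%E]EFinM mulVf ?(gt_eqF a0)// mul1e.
  move=> h; apply: (le_trans h); rewrite [leRHS]EFinM.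
  by apply: lee_wpmul2l; [rewrite lee_fin ltW|exact: H].
rewrite poweR_EFin.
apply: (@le_trans _ _ ((a^-1 * (C * S `^ p^-1))%:E * (S `^ p'^-1)%:E)%E).
  by apply: lee_wpmul2r; [rewrite lee_fin powR_ge0|exact: W_le].
rewrite -EFinM lee_fin -!mulrA -powRD ?(gt_eqF S0) ?implybT// pp' powRr1 ?(ltW S0)//.
by rewrite /a powRN invfM invrK mulrACA (mulVf (lt0r_neq0 S0)) mulr1 mulrC.
Qed.

Lemma A_const_le_op_bound : (A_const p' q s w <= C%:E)%E.
Proof.
apply/(A_const_le q0 qs p'0 mw mv v0 wv) => c l l0; set Q := cube c l.
have [C0 _] := opC.
have mQ : measurable Q by exact: measurable_cube.
have muQ : mu Q = (l ^+ d)%:E by rewrite /Q lebesgue_cube// ltW.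
have muQ0 : (0 < mu Q)%E by rewrite muQ lte_fin exprn_gt0.
pose F (n : nat) : set E := Q `&` [set x | n.+1%:R^-1 < v x].
have mF n : measurable (F n).
  apply: measurableI; first exact: mQ.
  rewrite -[X in measurable X]setTI -preimage_itvoy.
  exact: (mv measurableT (measurable_itv _)).
have Foo n : (dual_mass p' v (F n) < +oo)%E.
  apply: (@le_lt_trans _ _ (\int[mu]_(x in Q) (n.+1%:R `^ p')%:E)%E); last first.
    have -> : (\int[mu]_(x in Q) (n.+1%:R `^ p')%:E = (n.+1%:R `^ p')%:E * mu Q)%E.
      exact: integral_cst.
    by rewrite muQ -EFinM ltry.
  rewrite /dual_mass integral_mkcond [leRHS]integral_mkcond; apply: ge0_le_integral.
  - exact: measurableT.
  - by move=> x _; rewrite patchE; case: ifP => // _; rewrite lee_fin powR_ge0.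
  - apply/(measurable_restrictT _ (mF n)); apply: measurable_funTS.
    by apply/measurable_EFinP; exact: measurable_dual.
  - by apply/(measurable_restrictT _ mQ); exact: measurable_cst.
  - move=> x _; rewrite !patchE; case: ifPn => [/set_mem[Qx vx]|_]; last first.
      by case: ifP => // _; rewrite lee_fin powR_ge0.
    rewrite mem_set// lee_fin powRN -[leRHS]invrK lef_pV2 ?posrE ?invr_gt0 ?powR_gt0//.
    rewrite -powR_inv1 ?powR_ge0// -powRrM mulrN1 -[- p']mulN1r powRrM powR_inv1//.
    by apply: ge0_ler_powR; rewrite ?nnegrE ?invr_ge0 ?(ltW p'0) ?(ltW (v0 _))// ltW.
have Q_lim x : (forall n, dual_mass p' v (F n) <= x)%E -> (dual_mass p' v Q <= x)%E.
  move=> h.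
  have -> : Q = \bigcup_n F n.
    apply/seteqP; split=> [y Qy|y [n _ []//]].
    have [n n1] : exists n : nat, (v y)^-1 < n.+1%:R.
      by exists (Num.truncn (v y)^-1); exact: truncnS_gt.
    exists n => //; split=> //=.
    by rewrite -[ltRHS]invrK ltf_pV2 ?posrE ?invr_gt0.
  have ndF : {homo F : n m / (n <= m)%N >-> (n <= m)%O}.
    move=> n m nm; apply/subsetPset => y [Qy /= vy]; split=> //=.
    by apply: le_lt_trans vy; rewrite lef_pV2 ?posrE// ler_nat.
  have mD (D : set E) : measurable_fun D (fun y => (v y `^ (- p'))%:E).
    by apply: measurable_funTS; apply/measurable_EFinP; exact: measurable_dual.
  have cv := ge0_nondecreasing_set_cvg_integral (mu := mu) ndF mF (fun n => mD (F n))
    (fun n y _ => powR_ge0 (v y) (- p')).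
  rewrite /dual_mass -(cvg_lim _ cv)//; apply: lime_le; first by apply/cvg_ex; eexists; exact: cv.
  by apply: nearW => n; exact: h.
have W0 := restricted_norm_gt0 q0 qs mv v0 mQ muQ0.
have H n : (restricted_norm q s v Q * dual_mass p' v (F n) `^ p'^-1 <=
    (C * (l ^+ d) `^ (q^-1 + p'^-1))%:E)%E.
  by apply: (A_cube_testing l0 (mF n) _ (Foo n)) => y [].
set e := q^-1 + p'^-1; set W := restricted_norm q s v Q in W0 H *.
set B := C * (l ^+ d) `^ e; have B0 : 0 <= B by rewrite mulr_ge0// powR_ge0.
have dF0 n : (0 <= dual_mass p' v (F n))%E.
  by apply: integral_ge0 => x _; rewrite lee_fin powR_ge0.
have dQ0 : (0 < dual_mass p' v Q)%E := dual_mass_gt0 p' mv v0 mQ muQ0.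
have p'V0 : 0 < p'^-1 by rewrite invr_gt0.
(* An infinite W(Q) would force every [F n] to have zero dual mass, hence also their union [Q],
   whose dual mass is positive. *)
move: W0 H; case: W => [W| |]//; last first.
  move=> _ H; suff : (dual_mass p' v Q <= 0)%E by rewrite leNgt dQ0.
  apply: Q_lim => n; rewrite leNgt; apply/negP => Fn.
  by have := H n; rewrite gt0_mulye// poweR_gt0.
rewrite lte_fin => W0 H.
(* The inequality is solved for the dual mass: the resulting bound is uniform in [n] and passes to
   the increasing union. *)
have H' n : (dual_mass p' v (F n) <= (W^-1 * B)%:E `^ p'^-1^-1)%E.
  apply: (poweR_le_root p'V0 (dF0 n)); rewrite EFinM.
  by rewrite lee_pdivlMl//; exact: H.
rewrite -lee_pdivlMl// -EFinM.
apply: (le_trans (le_poweR2 (ltW p'V0) (ltW dQ0) (Q_lim _ H'))).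
by rewrite poweRVK ?gt_eqF// lee_fin mulr_ge0 ?invr_ge0 ?(ltW W0).
Qed.

End Necessity.

Theorem theorem4p9 (R : realType) (d : nat) (alpha p p' q : R) (s : \bar R)
    (alpha_ge0 : 0 <= alpha) (alpha_ltd : alpha < d%:R)
    (p_gt1 : 1 < p) (pp' : p^-1 + p'^-1 = 1)
    (qE : q^-1 = p^-1 - alpha / d%:R) (qV_gt0 : 0 < q^-1)
    (qs : (q%:E <= s)%E) :
  (forall w : euclid R d -> \bar R, weight w ->
     bounded_op p p%:E q s w (fractional_maximal alpha) <->
     A_class p' q s w) /\
  (exists2 c : R, 0 < c &
     forall w : euclid R d -> \bar R, weight w ->
       (op_norm p p%:E q s w (fractional_maximal alpha) <=
        c%:E * A_const p' q s w `^ (1 + p' / q))%E).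
Proof.
have p0 : 0 < p by exact: lt_trans p_gt1.
have q0 : 0 < q by rewrite -invr_gt0.
have p'0 : 0 < p'.
  by rewrite -invr_gt0 -(addKr p^-1 p'^-1) pp' addrC subr_gt0 invf_lt1.
(* Non-negativity of [alpha] enters here, as [1/q <= 1/p]. *)
have pq : p <= q.
  by rewrite -lef_pV2 ?posrE// qE lerBlDr lerDl divr_ge0.
(* The power of the volume in the A condition matches the one in the maximal function, so volumes
   cancel on each cube. *)
have eE : q^-1 + p'^-1 = 1 - alpha / d%:R by rewrite qE addrAC pp'.
have [C C0 opC] := op_bound_of_A_const p_gt1 pp' pq qs eE.
have opA (w : euclid R d -> \bar R) : weight w -> (A_const p' q s w < +oo)%E ->
    op_bound p p%:E q s w (fractional_maximal alpha)
      (C * fine (A_const p' q s w) `^ (1 + p' / q)).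
  move=> ww Aoo; have [v [mv v0 wv]] := weight_regularization ww; have [mw _] := ww.
  have A0 := A_const_gt0 q0 qs p'0 mw mv v0 wv.
  have Kpos : 0 < fine (A_const p' q s w) by rewrite fine_gt0// A0.
  have AK : (A_const p' q s w <= (fine (A_const p' q s w))%:E)%E.
    by rewrite fineK// ge0_fin_numE// ltW.
  exact: (opC w _ ww Kpos AK).
split=> [w ww|].
  split=> [[_ [K opK]]|[_ Aoo]].
    split=> //; have [v [mv v0 wv]] := weight_regularization ww; have [mw _] := ww.
    exact: le_lt_trans (A_const_le_op_bound p_gt1 pp' pq qs eE mw mv v0 wv opK) (ltry _).
  have opw := opA _ ww Aoo; split; last by exists (C * fine (A_const p' q s w) `^ (1 + p' / q)).
  move=> f Lf; have [mf Lfoo] := Lf; split.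
    exact: measurable_fractional_maximal.
  apply: le_lt_trans (opw.2 f Lf) _.
  apply: lte_mul_pinfty => //; first by rewrite lee_fin; exact: opw.1.
exists C => // w ww; have [v [mv v0 wv]] := weight_regularization ww; have [mw _] := ww.
have A0 := A_const_gt0 q0 qs p'0 mw mv v0 wv.
(* If the weight constant is infinite, the right-hand side is [+oo], its exponent and [C] being
   positive. *)
case: (ltP (A_const p' q s w) +oo%E) => [Aoo|]; last first.
  rewrite leye_eq => /eqP ->; rewrite poweRyr ?gt_eqF ?addr_gt0 ?divr_gt0//.
  by rewrite gt0_muley ?leey// lte_fin.
apply: (@le_trans _ _ (C * fine (A_const p' q s w) `^ (1 + p' / q))%:E).
  by apply: ereal_inf_lbound; exists (C * fine (A_const p' q s w) `^ (1 + p' / q)) => //; exact: opA.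
by rewrite EFinM -poweR_EFin fineK// ge0_fin_numE// ltW.
Qed.
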